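(* Let $\mathcal C$ be a finite tensor category over $\Bbbk$, let $T$ be a ($\Bbbk$-linear) right exact faithful Hopf monad on $\mathcal C$, and let $\mathcal M$ be an exact indecomposable $\mathcal C^T$-module category. Then there exists a $T$-equivariant indecomposable exact $\mathcal C$-module category $\mathcal N$ with simple and exact equivariant structure given by $U:\mathcal N\to\mathcal N$ such that $\mathcal M\simeq\mathcal N^U$ as $\mathcal C^T$-module categories.
   Context: $\Bbbk$ is an algebraically closed field of characteristic $0$; all functors between $\Bbbk$-linear categories are $\Bbbk$-linear. A tensor category over $\Bbbk$ is a $\Bbbk$-linear abelian rigid monoidal category with bilinear tensor product, finite-dimensional Hom spaces, all objects of finite length and simple unit $\mathbf 1$; it is assumed strict. It is finite if it has finitely many simple objects up to isomorphism and each has a projective cover. Module categories. A (left) $\mathcal C$-module category is a locally finite $\Bbbk$-linear abelian category $\mathcal M$ with a $\Bbbk$-bilinear bi-exact bifunctor $\overline\otimes:\mathcal C\times\mathcal M\to\mathcal M$ and natural isomorphisms $m_{X,Y,M}:(X\otimes Y)\overline\otimes M\to X\overline\otimes(Y\overline\otimes M)$, $\ell_M:\mathbf 1\overline\otimes M\to M$ satisfying the pentagon and unit axioms; it is lax if $m,\ell$ are not required to be isomorphisms. A module functor $(F,c)$ is a left exact functor $F$ with natural isomorphisms $c_{X,M}:F(X\overline\otimes M)\to X\overline\otimes F(M)$ such that $(\mathrm{id}_X\overline\otimes c_{Y,M})c_{X,Y\overline\otimes M}F(m_{X,Y,M})=m_{X,Y,F(M)}c_{X\otimes Y,M}$ and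 $\ell_{F(M)}c_{\mathbf 1,M}=F(\ell_M)$; lax if the $c_{X,M}$ are not required to be isomorphisms. A morphism $\alpha:(F,c)\to(G,d)$ of (lax) module functors is a natural transformation with $d_{X,M}\alpha_{X\overline\otimes M}=(\mathrm{id}_X\overline\otimes\alpha_M)c_{X,M}$. A module category is indecomposable if it is not equivalent to a direct sum of two non-trivial module categories. A module category $\mathcal M$ over a finite tensor category is exact if $\mathcal M$ is finite and $P\overline\otimes M$ is projective for every projective object $P$ of the tensor category and every $M\in\mathcal M$. Hopf monads. A Hopf monad on $\mathcal C$ is a monad $(T,\mu,\eta)$ with a comonoidal structure $\xi_{X,Y}:T(X\otimes Y)\to T(X)\otimes T(Y)$, $\phi:T(\mathbf 1)\to\mathbf 1$ such that $\mu,\eta$ are comonoidal transformations and the fusion operators $(\mathrm{id}\otimes\mu_Y)\xi_{X,T(Y)}$, $(\mu_X\otimes\mathrm{id})\xi_{T(X),Y}$ are isomorphisms. $\mathcal C^T$ is the category of $T$-modules, with $(X,r)\otimes(Y,s)=(X\otimes Y,(r\otimes s)\xi_{X,Y})$ and unit $(\mathbf 1,\phi)$; under the hypotheses on $\mathcal C$ and $T$ it is a finite tensor category. $T$-equivariance. For a $\mathcal C$-module category $\mathcal N$, $\mathcal N(T)$ is the lax $\mathcal C$-module category with underlying category $\mathcal N$, action $X\overline\otimes^TN=T(X)\overline\otimes N$, $m^T_{X,Y,N}=m_{T(X),T(Y),N}(\xi_{X,Y}\overline\otimes\mathrm{id}_N)$, $\ell^T_N=\ell_N(\phi\overline\otimes\mathrm{id}_N)$.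 A $T$-equivariant $\mathcal C$-module category is a triple $(\mathcal N,U,c)$ with $\mathcal N$ a $\mathcal C$-module category, $(U,c):\mathcal N\to\mathcal N(T)$ a lax $\mathcal C$-module functor and $(U,\nu,u)$ a monad on $\mathcal N$ such that $\nu:U^2\to U$ and $u:\mathrm{Id}_{\mathcal N}\to U$ are morphisms of $\mathcal C$-module functors $\mathcal N\to\mathcal N(T)$, where $\mathrm{Id}_{\mathcal N}$ has structure $\eta_X\overline\otimes\mathrm{id}_N$ and $U^2$ has structure $(\mu_X\overline\otimes\mathrm{id})c_{T(X),U(N)}U(c_{X,N})$. The category $\mathcal N^U$ of $U$-modules is a $\mathcal C^T$-module category with $(X,r)\overline\otimes(N,s)=(X\overline\otimes N,(r\overline\otimes s)c_{X,N})$. A morphism of $T$-equivariant structures $(\mathcal N,U,c)\to(\mathcal N,\widetilde U,\widetilde c)$ on the same $\mathcal N$ is a monad morphism $\alpha:U\to\widetilde U$ that is also a morphism of lax module functors; it is surjective if $\alpha_N$ is surjective for every $N\in\mathcal N$. The structure $(\mathcal N,U,c)$ is simple if any surjective morphism of $T$-equivariant structures $U\to\widetilde U$ is an isomorphism; it is exact if $U$ is an exact functor.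
   Formalization: In the definition of a simple equivariant structure, only surjective morphisms U → Ũ with Ũ non-zero are required to be isomorphisms; with Ũ = 0 allowed, every non-zero U would fail to be simple and the claim would be false for every M ≠ 0. *)

(* Defs.v *)
From HB Require Import structures.
From mathcomp Require Import all_boot all_algebra.
Set Implicit Arguments.
Unset Strict Implicit.
Unset Printing Implicit Defensive.
Import GRing.Theory.
Local Open Scope ring_scope.

Declare Scope cat_scope.
Delimit Scope cat_scope with cat.
Local Open Scope cat_scope.

Reserved Notation "g ∘ f" (at level 40, left associativity).
Reserved Notation "X ⊗ Y" (at level 38, left associativity).
Reserved Notation "f ⊗m g" (at level 38, left associativity).
Reserved Notation "X ⊳ M" (at level 38, left associativity).
Reserved Notation "f ⊳m g" (at level 38, left associativity).

(* Finite dimensionality of the Hom spaces is carried by [vectType k]. *)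
Record lincat (k : fieldType) := LinCat {
  ob :> Type;
  hom : ob -> ob -> vectType k;
  idm : forall X, hom X X;
  comp : forall X Y Z, hom Y Z -> hom X Y -> hom X Z;
  comp_linl : forall X Y Z (f : hom X Y),
    linear (fun g : hom Y Z => comp g f);
  comp_linr : forall X Y Z (g : hom Y Z),
    linear (fun f : hom X Y => comp g f);
  compA : forall X Y Z W (h : hom Z W) (g : hom Y Z) (f : hom X Y),
    comp h (comp g f) = comp (comp h g) f;
  comp1m : forall X Y (f : hom X Y), comp (idm Y) f = f;
  compm1 : forall X Y (f : hom X Y), comp f (idm X) = f }.

Arguments hom {k _}.
Arguments idm {k _}.
Arguments comp {k _ X Y Z}.
Notation "g ∘ f" := (comp g f) : cat_scope.

Section CategoryNotions.
Context {k : fieldType} {A : lincat k}.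
Implicit Types X Y Z : A.

Definition is_iso X Y (f : hom X Y) :=
  exists g : hom Y X, g ∘ f = idm X /\ f ∘ g = idm Y.

Definition isomorphic X Y := exists f : hom X Y, is_iso f.

Definition is_mono X Y (f : hom X Y) :=
  forall Z (g h : hom Z X), f ∘ g = f ∘ h -> g = h.

Definition is_epi X Y (f : hom X Y) :=
  forall Z (g h : hom Y Z), g ∘ f = h ∘ f -> g = h.

Definition is_zero_ob X :=
  (forall Y (f : hom X Y), f = 0) /\ (forall Y (f : hom Y X), f = 0).

Definition is_biproduct X Y S
    (i1 : hom X S) (i2 : hom Y S) (p1 : hom S X) (p2 : hom S Y) :=
  [/\ p1 ∘ i1 = idm X, p2 ∘ i2 = idm Y, p1 ∘ i2 = 0, p2 ∘ i1 = 0
    & i1 ∘ p1 + i2 ∘ p2 = idm S].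

Definition is_kernel X Y K (f : hom X Y) (i : hom K X) :=
  f ∘ i = 0 /\
  forall Z (g : hom Z X), f ∘ g = 0 -> exists! h : hom Z K, i ∘ h = g.

Definition is_cokernel X Y Q (f : hom X Y) (q : hom Y Q) :=
  q ∘ f = 0 /\
  forall Z (g : hom Y Z), g ∘ f = 0 -> exists! h : hom Q Z, h ∘ q = g.

Definition is_simple X :=
  ~ is_zero_ob X /\
  forall Y (i : hom Y X), is_mono i -> is_zero_ob Y \/ is_iso i.

Inductive finite_length : A -> Prop :=
| finite_length0 X : is_zero_ob X -> finite_length X
| finite_lengthS X Y S (i : hom Y X) (p : hom X S) :
    is_kernel p i -> is_cokernel i p -> is_simple S ->
    finite_length Y -> finite_length X.

Definition is_projective P :=
  forall X Y (e : hom X Y) (f : hom P Y), is_epi e ->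
  exists g : hom P X, e ∘ g = f.

Definition is_projective_cover P X (p : hom P X) :=
  [/\ is_projective P, is_epi p
    & forall Y (h : hom Y P), is_epi (p ∘ h) -> is_epi h].

(* The identity of X, seen as a morphism to an object equal to X. *)
Definition eqhom X Y (e : X = Y) : hom X Y :=
  match e in _ = Z return hom X Z with erefl => idm X end.

End CategoryNotions.

Record is_abelian (k : fieldType) (A : lincat k) : Prop := IsAbelian {
  has_zero : exists Z : A, is_zero_ob Z;
  has_biproducts : forall X Y : A,
    exists (S : A) (i1 : hom X S) (i2 : hom Y S) (p1 : hom S X) (p2 : hom S Y),
      is_biproduct i1 i2 p1 p2;
  has_kernels : forall (X Y : A) (f : hom X Y),
    exists (K : A) (i : hom K X), is_kernel f i;
  has_cokernels : forall (X Y : A) (f : hom X Y),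
    exists (Q : A) (q : hom Y Q), is_cokernel f q;
  mono_kernel : forall (X Y : A) (f : hom X Y), is_mono f ->
    exists (Z : A) (g : hom Y Z), is_kernel g f;
  epi_cokernel : forall (X Y : A) (f : hom X Y), is_epi f ->
    exists (Z : A) (g : hom Z X), is_cokernel g f }.

Definition is_locally_finite (k : fieldType) (A : lincat k) :=
  forall X : A, finite_length X.

Definition is_finite_cat (k : fieldType) (A : lincat k) :=
  [/\ is_abelian A,
      is_locally_finite A,
      exists (n : nat) (S : 'I_n -> A),
        forall X : A, is_simple X -> exists i, isomorphic X (S i)
    & forall X : A, is_simple X ->
        exists (P : A) (p : hom P X), is_projective_cover p].

Record functor (k : fieldType) (A B : lincat k) := Functor {
  fob :> A -> B;
  fmor : forall X Y, hom X Y -> hom (fob X) (fob Y);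
  fmor_lin : forall X Y, linear (@fmor X Y);
  fmor1 : forall X, fmor (idm X) = idm (fob X);
  fmorM : forall X Y Z (g : hom Y Z) (f : hom X Y),
    fmor (g ∘ f) = fmor g ∘ fmor f }.

Arguments fmor {k A B} _ {X Y}.

Section FunctorNotions.
Context {k : fieldType}.

Definition fid (A : lincat k) : functor A A.
Proof. by exists id (fun X Y f => f). Defined.

Definition fcomp (A B D : lincat k) (G : functor B D) (F : functor A B) :
  functor A D.
Proof.
exists (fun X => G (F X)) (fun X Y f => fmor G (fmor F f)).
- by move=> X Y a f g; rewrite !fmor_lin.
- by move=> X; rewrite !fmor1.
- by move=> X Y Z g f; rewrite !fmorM.
Defined.

Section Props.
Context {A B : lincat k}.
Implicit Types F G : functor A B.

Definition is_natural F G (a : forall X, hom (F X) (G X)) :=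
  forall X Y (f : hom X Y), a Y ∘ fmor F f = fmor G f ∘ a X.

(* Linear functors preserve finite biproducts, so between abelian categories
   preservation of kernels is left exactness, and dually. *)
Definition left_exact F :=
  forall (X Y K : A) (f : hom X Y) (i : hom K X),
    is_kernel f i -> is_kernel (fmor F f) (fmor F i).

Definition right_exact F :=
  forall (X Y Q : A) (f : hom X Y) (q : hom Y Q),
    is_cokernel f q -> is_cokernel (fmor F f) (fmor F q).

Definition exact_functor F := left_exact F /\ right_exact F.

Definition faithful F :=
  forall (X Y : A) (f g : hom X Y), fmor F f = fmor F g -> f = g.

End Props.

Definition nat_isomorphic (A B : lincat k) (F G : functor A B) :=
  exists a : forall X, hom (F X) (G X), is_natural a /\ forall X, is_iso (a X).

Definition is_equivalence (A B : lincat k) (F : functor A B) :=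
  exists G : functor B A,
    nat_isomorphic (fcomp G F) (fid A) /\ nat_isomorphic (fcomp F G) (fid B).

End FunctorNotions.

Record bifunctor (k : fieldType) (A B D : lincat k) := Bifunctor {
  bob :> A -> B -> D;
  bmor : forall X X' Y Y', hom X X' -> hom Y Y' -> hom (bob X Y) (bob X' Y');
  bmor_linl : forall X X' Y Y' (g : hom Y Y'),
    linear (fun f : hom X X' => bmor f g);
  bmor_linr : forall X X' Y Y' (f : hom X X'),
    linear (fun g : hom Y Y' => bmor f g);
  bmor1 : forall X Y, bmor (idm X) (idm Y) = idm (bob X Y);
  bmorM : forall X X' X'' Y Y' Y'' (f' : hom X' X'') (f : hom X X')
      (g' : hom Y' Y'') (g : hom Y Y'),
    bmor (f' ∘ f) (g' ∘ g) = bmor f' g' ∘ bmor f g }.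

Arguments bmor {k A B D} _ {X X' Y Y'}.

Section BifunctorNotions.
Context {k : fieldType} {A B D : lincat k} (F : bifunctor A B D).

Definition bfix1 (X : A) : functor B D.
Proof.
exists (F X) (fun Y Y' g => bmor F (idm X) g).
- by move=> Y Y'; apply: bmor_linr.
- by move=> Y; apply: bmor1.
- by move=> Y Y' Y'' g' g; rewrite -bmorM comp1m.
Defined.

Definition bfix2 (Y : B) : functor A D.
Proof.
exists (fun X => F X Y) (fun X X' f => bmor F f (idm Y)).
- by move=> X X'; apply: bmor_linl.
- by move=> X; apply: bmor1.
- by move=> X X' X'' f' f; rewrite -bmorM comp1m.
Defined.

Lemma bmor_compl X X' X'' Y Y' (f' : hom X' X'') (f : hom X X')
    (g : hom Y Y') :
  bmor F (f' ∘ f) g = bmor F f' g ∘ bmor F f (idm Y).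
Proof. by rewrite -bmorM compm1. Qed.

Lemma bmor_compr X X' Y Y' Y'' (f : hom X X') (g' : hom Y' Y'')
    (g : hom Y Y') :
  bmor F f (g' ∘ g) = bmor F f g' ∘ bmor F (idm X) g.
Proof. by rewrite -bmorM compm1. Qed.

Definition biexact :=
  (forall X : A, exact_functor (bfix1 X)) /\ (forall Y : B, exact_functor (bfix2 Y)).

End BifunctorNotions.

Record moncat (k : fieldType) := MonCat {
  mon_cat :> lincat k;
  tens : bifunctor mon_cat mon_cat mon_cat;
  munit : mon_cat;
  assoc : forall X Y Z : mon_cat,
    hom (tens (tens X Y) Z) (tens X (tens Y Z));
  lunit : forall X : mon_cat, hom (tens munit X) X;
  runit : forall X : mon_cat, hom (tens X munit) X;
  assoc_nat : forall (X X' Y Y' Z Z' : mon_cat)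
      (f : hom X X') (g : hom Y Y') (h : hom Z Z'),
    assoc X' Y' Z' ∘ bmor tens (bmor tens f g) h
    = bmor tens f (bmor tens g h) ∘ assoc X Y Z;
  lunit_nat : forall (X Y : mon_cat) (f : hom X Y),
    lunit Y ∘ bmor tens (idm munit) f = f ∘ lunit X;
  runit_nat : forall (X Y : mon_cat) (f : hom X Y),
    runit Y ∘ bmor tens f (idm munit) = f ∘ runit X;
  assoc_iso : forall X Y Z, is_iso (assoc X Y Z);
  lunit_iso : forall X, is_iso (lunit X);
  runit_iso : forall X, is_iso (runit X);
  pentagon : forall X Y Z W : mon_cat,
    bmor tens (idm X) (assoc Y Z W) ∘ assoc X (tens Y Z) W
      ∘ bmor tens (assoc X Y Z) (idm W)
    = assoc X Y (tens Z W) ∘ assoc (tens X Y) Z W;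
  triangle : forall X Y : mon_cat,
    bmor tens (idm X) (lunit Y) ∘ assoc X munit Y = bmor tens (runit X) (idm Y)
}.

Arguments tens {k}.
Arguments munit {k}.
Arguments assoc {k _}.
Arguments lunit {k _}.
Arguments runit {k _}.
Notation "X ⊗ Y" := (bob (tens _) X Y) : cat_scope.
Notation "f ⊗m g" := (bmor (tens _) f g) : cat_scope.

Section TensorCategories.
Context {k : fieldType} (C : moncat k).

(* The two zigzag identities; to avoid naming inverses of the structure
   isomorphisms, they are composed with unitors, and [a] is the inverse of
   the associator. *)
Definition is_left_dual (X X' : C)
    (ev : hom (X' ⊗ X) (munit C)) (coev : hom (munit C) (X ⊗ X')) :=
  runit X ∘ (idm X ⊗m ev) ∘ assoc X X' X ∘ (coev ⊗m idm X) = lunit X /\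
  forall a : hom (X' ⊗ (X ⊗ X')) ((X' ⊗ X) ⊗ X'),
    assoc X' X X' ∘ a = idm _ ->
    lunit X' ∘ (ev ⊗m idm X') ∘ a ∘ (idm X' ⊗m coev) = runit X'.

(* A right dual of X is an object having X as a left dual. *)
Definition is_rigid :=
  (forall X : C, exists (X' : C)
     (ev : hom (X' ⊗ X) (munit C)) (coev : hom (munit C) (X ⊗ X')),
     is_left_dual ev coev) /\
  (forall X : C, exists (X' : C)
     (ev : hom (X ⊗ X') (munit C)) (coev : hom (munit C) (X' ⊗ X)),
     is_left_dual ev coev).

Definition is_strict :=
  [/\ forall X Y Z : C, exists e : (X ⊗ Y) ⊗ Z = X ⊗ (Y ⊗ Z),
        assoc X Y Z = eqhom e,
      forall X : C, exists e : munit C ⊗ X = X, lunit X = eqhom e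
    & forall X : C, exists e : X ⊗ munit C = X, runit X = eqhom e].

Definition is_tensor_category :=
  [/\ is_abelian C, is_rigid, is_locally_finite C, is_simple (munit C)
    & is_strict].

Definition is_finite_tensor_category :=
  is_tensor_category /\ is_finite_cat C.

End TensorCategories.

(* For invertible m the axiom [act_lunit] follows from the other two; in the
   lax case it has to be required. *)
Record lax_modcat (k : fieldType) (V : moncat k) := LaxModCat {
  mod_cat :> lincat k;
  act : bifunctor V mod_cat mod_cat;
  act_m : forall (X Y : V) (M : mod_cat),
    hom (act (X ⊗ Y) M) (act X (act Y M));
  act_l : forall M : mod_cat, hom (act (munit V) M) M;
  act_m_nat : forall (X X' Y Y' : V) (M M' : mod_cat)
      (f : hom X X') (g : hom Y Y') (h : hom M M'),
    act_m X' Y' M' ∘ bmor act (f ⊗m g) h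
    = bmor act f (bmor act g h) ∘ act_m X Y M;
  act_l_nat : forall (M M' : mod_cat) (h : hom M M'),
    act_l M' ∘ bmor act (idm (munit V)) h = h ∘ act_l M;
  act_pentagon : forall (X Y Z : V) (M : mod_cat),
    bmor act (idm X) (act_m Y Z M) ∘ act_m X (Y ⊗ Z) M
      ∘ bmor act (assoc X Y Z) (idm M)
    = act_m X Y (act Z M) ∘ act_m (X ⊗ Y) Z M;
  act_runit : forall (X : V) (M : mod_cat),
    bmor act (idm X) (act_l M) ∘ act_m X (munit V) M
    = bmor act (runit X) (idm M);
  act_lunit : forall (X : V) (M : mod_cat),
    act_l (act X M) ∘ act_m (munit V) X M = bmor act (lunit X) (idm M) }.

Arguments act {k V}.
Arguments act_m {k V _}.
Arguments act_l {k V _}.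
Notation "X ⊳ M" := (bob (act _) X M) : cat_scope.
Notation "f ⊳m g" := (bmor (act _) f g) : cat_scope.

Section ModuleCategories.
Context {k : fieldType} {V : moncat k}.
Implicit Types M N : lax_modcat V.

Definition is_modcat M :=
  [/\ is_abelian M, is_locally_finite M, biexact (act M),
      forall (X Y : V) (P : M), is_iso (act_m X Y P)
    & forall P : M, is_iso (act_l P)].

Definition is_exact_modcat M :=
  is_finite_cat M /\
  forall (P : V) (Q : M), is_projective P -> is_projective (P ⊳ Q).

Record is_lax_modfun M N (F : functor M N)
    (c : forall (X : V) (P : M), hom (F (X ⊳ P)) (X ⊳ F P)) : Prop :=
  IsLaxModfun {
  modfun_left_exact : left_exact F;
  modfun_nat : forall (X Y : V) (P Q : M) (f : hom X Y) (g : hom P Q),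
    c Y Q ∘ fmor F (f ⊳m g) = (f ⊳m fmor F g) ∘ c X P;
  modfun_m : forall (X Y : V) (P : M),
    (idm X ⊳m c Y P) ∘ c X (Y ⊳ P) ∘ fmor F (act_m X Y P)
    = act_m X Y (F P) ∘ c (X ⊗ Y) P;
  modfun_l : forall P : M, act_l (F P) ∘ c (munit V) P = fmor F (act_l P) }.

Definition is_modfun M N (F : functor M N)
    (c : forall (X : V) (P : M), hom (F (X ⊳ P)) (X ⊳ F P)) :=
  is_lax_modfun c /\ forall X P, is_iso (c X P).

Definition is_modfun_morphism M N (F G : functor M N)
    (c : forall (X : V) (P : M), hom (F (X ⊳ P)) (X ⊳ F P))
    (d : forall (X : V) (P : M), hom (G (X ⊳ P)) (X ⊳ G P))
    (a : forall P : M, hom (F P) (G P)) :=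
  is_natural a /\
  forall (X : V) (P : M), d X P ∘ a (X ⊳ P) = (idm X ⊳m a P) ∘ c X P.

Definition modcat_equivalent M N :=
  exists (F : functor M N)
    (c : forall (X : V) (P : M), hom (F (X ⊳ P)) (X ⊳ F P)),
    is_modfun c /\ is_equivalence F.

End ModuleCategories.

Section DirectSum.
Context {k : fieldType}.

Definition lincat_sum (A B : lincat k) : lincat k.
Proof.
exists (A * B)%type (fun X Y => (hom X.1 Y.1 * hom X.2 Y.2)%type : vectType k)
  (fun X => (idm X.1, idm X.2))
  (fun X Y Z g f => (g.1 ∘ f.1, g.2 ∘ f.2)).
- by move=> X Y Z f a g h; congr pair; rewrite /= comp_linl.
- by move=> X Y Z g a f h; congr pair; rewrite /= comp_linr.
- by move=> X Y Z W h g f; rewrite /= !compA.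
- by move=> X Y [f1 f2]; rewrite /= !comp1m.
- by move=> X Y [f1 f2]; rewrite /= !compm1.
Defined.

Context {V : moncat k} (M N : lax_modcat V).

Definition act_sum : bifunctor V (lincat_sum M N) (lincat_sum M N).
Proof.
exists (fun X (P : lincat_sum M N) => (X ⊳ P.1, X ⊳ P.2) : lincat_sum M N)
  (fun X X' (P P' : lincat_sum M N) f (g : hom P P') =>
     (f ⊳m g.1, f ⊳m g.2)).
- by move=> X X' P P' g a f h; congr pair; rewrite /= bmor_linl.
- by move=> X X' P P' f a g h; congr pair; rewrite /= bmor_linr.
- by move=> X P; congr pair; rewrite /= bmor1.
- by move=> X X' X'' P P' P'' f' f g' g; congr pair; rewrite /= bmorM.
Defined.

Definition modcat_sum : lax_modcat V.
Proof.
exists (lincat_sum M N) act_sum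
  (fun X Y P => (act_m X Y P.1, act_m X Y P.2))
  (fun P => (act_l P.1, act_l P.2)).
- by move=> X X' Y Y' P P' f g h; congr pair; rewrite /= act_m_nat.
- by move=> P P' h; congr pair; rewrite /= act_l_nat.
- by move=> X Y Z P; congr pair; rewrite /= act_pentagon.
- by move=> X P; congr pair; rewrite /= act_runit.
- by move=> X P; congr pair; rewrite /= act_lunit.
Defined.

End DirectSum.

Definition is_trivial_cat (k : fieldType) (A : lincat k) :=
  forall X : A, is_zero_ob X.

Definition is_indecomposable (k : fieldType) (V : moncat k)
    (M : lax_modcat V) :=
  ~ exists M1 M2 : lax_modcat V,
      [/\ is_modcat M1 /\ ~ is_trivial_cat M1,
          is_modcat M2 /\ ~ is_trivial_cat M2
        & modcat_equivalent M (modcat_sum M1 M2)].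

Record monad (k : fieldType) (A : lincat k) := Monad {
  monad_fun :> functor A A;
  monad_mu : forall X : A, hom (monad_fun (monad_fun X)) (monad_fun X);
  monad_eta : forall X : A, hom X (monad_fun X);
  monad_mu_nat :
    is_natural (F := fcomp monad_fun monad_fun) (G := monad_fun) monad_mu;
  monad_eta_nat : is_natural (F := fid A) (G := monad_fun) monad_eta;
  monad_muA : forall X,
    monad_mu X ∘ fmor monad_fun (monad_mu X) = monad_mu X ∘ monad_mu (monad_fun X);
  monad_mu1 : forall X, monad_mu X ∘ monad_eta (monad_fun X) = idm (monad_fun X);
  monad_mu1r : forall X,
    monad_mu X ∘ fmor monad_fun (monad_eta X) = idm (monad_fun X) }.

Arguments monad_mu {k A}.
Arguments monad_eta {k A}.

Section EilenbergMoore.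
Context {k : fieldType} {A : lincat k} (T : monad A).

Record em_ob := EMOb {
  em_car : A;
  em_act : hom (T em_car) em_car;
  em_actM : em_act ∘ fmor T em_act = em_act ∘ monad_mu T em_car;
  em_act1 : em_act ∘ monad_eta T em_car = idm em_car }.

Definition em_defect (X Y : em_ob) (f : hom (em_car X) (em_car Y)) :
  hom (T (em_car X)) (em_car Y) := f ∘ em_act X - em_act Y ∘ fmor T f.

Lemma em_defect_lin X Y : linear (@em_defect X Y).
Proof.
move=> a f g; rewrite /em_defect comp_linl fmor_lin comp_linr.
by rewrite scalerBr opprD addrACA.
Qed.

HB.instance Definition _ X Y :=
  GRing.isLinear.Build k _ _ _ (@em_defect X Y) (@em_defect_lin X Y).

Definition em_homs (X Y : em_ob) : {vspace hom (em_car X) (em_car Y)} :=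
  lker (linfun (@em_defect X Y)).

Lemma em_homsP X Y (f : hom (em_car X) (em_car Y)) :
  reflect (f ∘ em_act X = em_act Y ∘ fmor T f) (f \in em_homs X Y).
Proof. by rewrite memv_ker lfunE /= subr_eq0; apply: eqP. Qed.

Definition em_hom (X Y : em_ob) : vectType k := subvs_of (em_homs X Y).

Definition em_mk X Y (f : hom (em_car X) (em_car Y))
    (Hf : f ∘ em_act X = em_act Y ∘ fmor T f) : em_hom X Y :=
  Subvs (introT (em_homsP f) Hf).
Arguments em_mk : clear implicits.

Lemma em_homE X Y (f : em_hom X Y) :
  vsval f ∘ em_act X = em_act Y ∘ fmor T (vsval f).
Proof. exact/em_homsP/subvsP. Qed.

Lemma em_id_subproof X :
  idm (em_car X) ∘ em_act X = em_act X ∘ fmor T (idm (em_car X)).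
Proof. by rewrite comp1m fmor1 compm1. Qed.

Lemma em_comp_subproof X Y Z (g : em_hom Y Z) (f : em_hom X Y) :
  (vsval g ∘ vsval f) ∘ em_act X = em_act Z ∘ fmor T (vsval g ∘ vsval f).
Proof. by rewrite -compA em_homE compA em_homE -compA fmorM. Qed.

Definition em_cat : lincat k.
Proof.
exists em_ob em_hom (fun X => em_mk X X _ (em_id_subproof X))
  (fun X Y Z g f => em_mk X Z _ (em_comp_subproof g f)).
- by move=> X Y Z f a g h; apply: val_inj; rewrite /= !comp_linl.
- by move=> X Y Z g a f h; apply: val_inj; rewrite /= !comp_linr.
- by move=> X Y Z W h g f; apply: val_inj; apply: compA.
- by move=> X Y f; apply: val_inj; apply: comp1m.
- by move=> X Y f; apply: val_inj; apply: compm1.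
Defined.

Lemma em_iso (X Y : em_cat) (f : hom X Y) :
  is_iso (vsval f : hom (em_car X) (em_car Y)) -> is_iso f.
Proof.
case=> g [gf fg].
have Hg : g ∘ em_act Y = em_act X ∘ fmor T g.
  rewrite -[LHS]compm1 -(fmor1 T) -fg fmorM compA -(compA g) -em_homE.
  by rewrite (compA g) gf comp1m.
by exists (em_mk Y X g Hg); split; apply: val_inj.
Qed.

End EilenbergMoore.

Arguments em_mk {k A T}.

(* If c is compatible with the monads T and U, then (r ⊗ s)c makes X ⊗ N a
   U-module for every T-module (X, r) and every U-module (N, s). *)
Section LiftBifunctor.
Context {k : fieldType} {A B : lincat k} (T : monad A) (U : monad B).
Context (F : bifunctor A B B).
Context (c : forall X N, hom (U (F X N)) (F (T X) (U N))).
Hypothesis c_nat : forall (X X' : A) (N N' : B) (f : hom X X') (g : hom N N'),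
  c X' N' ∘ fmor U (bmor F f g) = bmor F (fmor T f) (fmor U g) ∘ c X N.
Hypothesis c_mu : forall X N, c X N ∘ monad_mu U (F X N) =
  bmor F (monad_mu T X) (monad_mu U N) ∘ c (T X) (U N) ∘ fmor U (c X N).
Hypothesis c_eta : forall X N,
  c X N ∘ monad_eta U (F X N) = bmor F (monad_eta T X) (monad_eta U N).

Definition em_bob (X : em_cat T) (N : em_cat U) : em_cat U.
Proof.
exists (F (em_car X) (em_car N)) (bmor F (em_act X) (em_act N) ∘ c _ _).
- rewrite fmorM !compA -(compA _ _ (fmor U (bmor _ _ _))) c_nat.
  rewrite !compA -bmorM !em_actM bmorM -!compA; congr (_ ∘ _).
  by rewrite c_mu !compA.
- by rewrite -compA c_eta -bmorM !em_act1 bmor1.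
Defined.

Lemma em_bmor_subproof (X X' : em_cat T) (N N' : em_cat U)
    (f : hom X X') (g : hom N N') :
  bmor F (vsval f) (vsval g) ∘ em_act (em_bob X N)
  = em_act (em_bob X' N') ∘ fmor U (bmor F (vsval f) (vsval g)).
Proof. by rewrite /= -compA c_nat !compA -!bmorM !em_homE. Qed.

Definition em_bifunctor : bifunctor (em_cat T) (em_cat U) (em_cat U).
Proof.
exists em_bob
  (fun (X X' : em_cat T) (N N' : em_cat U) (f : hom X X') (g : hom N N') =>
     em_mk (em_bob X N) (em_bob X' N') _ (em_bmor_subproof f g)).
- by move=> X X' N N' g a f f'; apply: val_inj; rewrite /= !bmor_linl.
- by move=> X X' N N' f a g g'; apply: val_inj; rewrite /= !bmor_linr.
- by move=> X N; apply: val_inj; apply: bmor1.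
- by move=> *; apply: val_inj; apply: bmorM.
Defined.

End LiftBifunctor.

Record hopf_monad (k : fieldType) (C : moncat k) := HopfMonad {
  hopf_T :> monad C;
  hopf_xi : forall X Y : C, hom (hopf_T (X ⊗ Y))
    (hopf_T X ⊗ hopf_T Y);
  hopf_phi : hom (hopf_T (munit C)) (munit C);
  hopf_xi_nat : forall (X X' Y Y' : C) (f : hom X X') (g : hom Y Y'),
    hopf_xi X' Y' ∘ fmor hopf_T (f ⊗m g)
    = (fmor hopf_T f ⊗m fmor hopf_T g) ∘ hopf_xi X Y;
  hopf_xiA : forall X Y Z : C,
    (idm _ ⊗m hopf_xi Y Z) ∘ hopf_xi X (Y ⊗ Z)
      ∘ fmor hopf_T (assoc X Y Z)
    = assoc _ _ _ ∘ (hopf_xi X Y ⊗m idm _) ∘ hopf_xi (X ⊗ Y) Z;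
  hopf_xi1 : forall X : C,
    lunit _ ∘ (hopf_phi ⊗m idm _) ∘ hopf_xi (munit C) X
    = fmor hopf_T (lunit X);
  hopf_xi1r : forall X : C,
    runit _ ∘ (idm _ ⊗m hopf_phi) ∘ hopf_xi X (munit C)
    = fmor hopf_T (runit X);
  hopf_mu_xi : forall X Y : C,
    hopf_xi X Y ∘ monad_mu hopf_T (X ⊗ Y)
    = (monad_mu hopf_T X ⊗m monad_mu hopf_T Y)
      ∘ hopf_xi _ _ ∘ fmor hopf_T (hopf_xi X Y);
  hopf_mu_phi :
    hopf_phi ∘ monad_mu hopf_T (munit C)
    = hopf_phi ∘ fmor hopf_T hopf_phi;
  hopf_eta_xi : forall X Y : C,
    hopf_xi X Y ∘ monad_eta hopf_T (X ⊗ Y)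
    = monad_eta hopf_T X ⊗m monad_eta hopf_T Y;
  hopf_eta_phi : hopf_phi ∘ monad_eta hopf_T (munit C) = idm _;
  hopf_fusionl : forall X Y : C,
    is_iso ((idm _ ⊗m monad_mu hopf_T Y)
            ∘ hopf_xi X (hopf_T Y));
  hopf_fusionr : forall X Y : C,
    is_iso ((monad_mu hopf_T X ⊗m idm _)
            ∘ hopf_xi (hopf_T X) Y) }.

Arguments hopf_xi {k C}.
Arguments hopf_phi {k C}.

(* The monoidal category of T-modules *)
Section HopfModules.
Context {k : fieldType} {C : moncat k} (T : hopf_monad C).

Definition hopf_tens : bifunctor (em_cat T) (em_cat T) (em_cat T) :=
  em_bifunctor (@hopf_xi_nat _ _ T) (hopf_mu_xi T) (hopf_eta_xi T).

Definition hopf_unit : em_cat T :=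
  EMOb (esym (hopf_mu_phi T)) (hopf_eta_phi T).

Lemma hopf_assoc_subproof (X Y Z : em_cat T) :
  assoc (em_car X) (em_car Y) (em_car Z)
    ∘ em_act (hopf_tens (hopf_tens X Y) Z)
  = em_act (hopf_tens X (hopf_tens Y Z)) ∘ fmor T (assoc _ _ _).
Proof.
rewrite /= bmor_compl bmor_compr -[RHS]compA -[RHS]compA
  (compA _ (hopf_xi T _ _) (fmor T _)).
by rewrite hopf_xiA !compA assoc_nat.
Qed.

Lemma hopf_lunit_subproof (X : em_cat T) :
  lunit (em_car X) ∘ em_act (hopf_tens hopf_unit X)
  = em_act X ∘ fmor T (lunit _).
Proof.
rewrite /= -(comp1m (hopf_phi T)) -(compm1 (em_act X)) bmorM !compA compm1.
by rewrite lunit_nat -!compA -hopf_xi1 !compA.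
Qed.

Lemma hopf_runit_subproof (X : em_cat T) :
  runit (em_car X) ∘ em_act (hopf_tens X hopf_unit)
  = em_act X ∘ fmor T (runit _).
Proof.
rewrite /= -(comp1m (hopf_phi T)) -(compm1 (em_act X)) bmorM !compA compm1.
by rewrite runit_nat -!compA -hopf_xi1r !compA.
Qed.

Definition hopf_modules : moncat k.
Proof.
exists (em_cat T) hopf_tens hopf_unit
  (fun X Y Z => em_mk (hopf_tens (hopf_tens X Y) Z) (hopf_tens X (hopf_tens Y Z)) _
     (hopf_assoc_subproof X Y Z))
  (fun X => em_mk (hopf_tens hopf_unit X) X _ (hopf_lunit_subproof X))
  (fun X => em_mk (hopf_tens X hopf_unit) X _ (hopf_runit_subproof X)).
- by move=> *; apply: val_inj; apply: assoc_nat.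
- by move=> *; apply: val_inj; apply: lunit_nat.
- by move=> *; apply: val_inj; apply: runit_nat.
- by move=> *; apply: em_iso; apply: assoc_iso.
- by move=> *; apply: em_iso; apply: lunit_iso.
- by move=> *; apply: em_iso; apply: runit_iso.
- by move=> *; apply: val_inj; apply: pentagon.
- by move=> *; apply: val_inj; apply: triangle.
Defined.

End HopfModules.

(* The lax module category N(T) *)
Section Twist.
Context {k : fieldType} {C : moncat k} (T : hopf_monad C) (N : lax_modcat C).

Definition twist_act : bifunctor C N N.
Proof.
exists (fun X P => T X ⊳ P) (fun X X' P P' f g => fmor T f ⊳m g).
- by move=> X X' P P' g a f f'; rewrite fmor_lin bmor_linl.
- by move=> X X' P P' f a g g'; rewrite bmor_linr.
- by move=> X P; rewrite fmor1 bmor1.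
- by move=> *; rewrite fmorM bmorM.
Defined.

Definition twist : lax_modcat C.
Proof.
exists N twist_act
  (fun X Y P => act_m (T X) (T Y) P ∘ (hopf_xi T X Y ⊳m idm P))
  (fun P => act_l P ∘ (hopf_phi T ⊳m idm P)).
- move=> X X' Y Y' P P' f g h /=.
  rewrite -compA -bmorM comp1m hopf_xi_nat -[h in LHS]compm1 bmorM.
  by rewrite !compA act_m_nat.
- move=> P P' h /=.
  rewrite fmor1 -compA -bmorM comp1m compm1 compA -act_l_nat -compA -bmorM.
  by rewrite comp1m compm1.
- move=> X Y Z P /=.
  rewrite fmor1 bmor_compr -!compA -bmor_compl.
  rewrite (compA _ (act_m _ _ _)) -act_m_nat -compA -bmor_compl compA.
  rewrite [_ ∘ (_ ∘ fmor T _)]compA hopf_xiA bmor_compl.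
  rewrite [bmor _ (assoc _ _ _ ∘ _) _]bmor_compl !compA act_pentagon.
  by rewrite -!compA (compA (act_m _ _ _) (_ ⊳m idm P)) act_m_nat bmor1 !compA.
- move=> X P /=.
  rewrite fmor1 bmor_compr -!compA (compA _ (act_m _ _ _)) -act_m_nat.
  by rewrite -compA -bmor_compl compA act_runit -bmor_compl compA hopf_xi1r.
- move=> X P /=.
  rewrite -!compA (compA _ (act_m _ _ _)) -[idm (_ ⊳ _)]bmor1 -act_m_nat.
  by rewrite -compA -bmor_compl compA act_lunit -bmor_compl compA hopf_xi1.
Defined.

End Twist.

Section Equivariance.
Context {k : fieldType} {C : moncat k} (T : hopf_monad C).

Record equivariant (N : lax_modcat C) := Equivariant {
  eqv_U :> monad N;
  eqv_c : forall (X : C) (P : N), hom (eqv_U (X ⊳ P)) (T X ⊳ eqv_U P);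
  eqv_c_modfun : is_lax_modfun (M := N) (N := twist T N) (F := eqv_U) eqv_c;
  eqv_nu_mor : is_modfun_morphism (M := N) (N := twist T N)
    (F := fcomp eqv_U eqv_U) (G := eqv_U)
    (fun X P => (monad_mu T X ⊳m idm (eqv_U (eqv_U P)))
                  ∘ eqv_c (T X) (eqv_U P) ∘ fmor eqv_U (eqv_c X P))
    eqv_c (monad_mu eqv_U);
  eqv_u_mor : is_modfun_morphism (M := N) (N := twist T N)
    (F := fid N) (G := eqv_U)
    (fun X P => monad_eta T X ⊳m idm P) eqv_c (monad_eta eqv_U) }.

Section Morphisms.
Context {N : lax_modcat C}.
Implicit Types U : equivariant N.

Definition is_eqv_morphism U U' (a : forall P : N, hom (U P) (U' P)) :=
  [/\ is_modfun_morphism (M := N) (N := twist T N) (F := U) (G := U')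
        (eqv_c U) (eqv_c U') a,
      forall P, a P ∘ monad_mu U P = monad_mu U' P ∘ a (U' P) ∘ fmor U (a P)
    & forall P, a P ∘ monad_eta U P = monad_eta U' P].

Definition is_eqv_iso U U' (a : forall P : N, hom (U P) (U' P)) :=
  is_eqv_morphism a /\
  exists b : forall P : N, hom (U' P) (U P),
    is_eqv_morphism b /\
    forall P, b P ∘ a P = idm (U P) /\ a P ∘ b P = idm (U' P).

(* The zero functor carries a T-equivariant structure (its category of modules
   is zero) and receives a surjective morphism from every U. As for quotients
   of a simple ring, the quotient 0 has to be left out, for otherwise only
   U = 0 would be simple. *)
Definition is_simple_eqv U :=
  forall U' (a : forall P : N, hom (U P) (U' P)),
    ~ (forall P, is_zero_ob (U' P)) ->
    is_eqv_morphism a -> (forall P, is_epi (a P)) -> is_eqv_iso a.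

Definition is_exact_eqv U := exact_functor U.

End Morphisms.

Context (N : lax_modcat C) (U : equivariant N).

Lemma eqv_c_nat (X X' : C) (P P' : N) (f : hom X X') (g : hom P P') :
  eqv_c U X' P' ∘ fmor U (f ⊳m g) = (fmor T f ⊳m fmor U g) ∘ eqv_c U X P.
Proof. exact: (modfun_nat (eqv_c_modfun U)). Qed.

Lemma eqv_c_mu (X : C) (P : N) :
  eqv_c U X P ∘ monad_mu U (X ⊳ P)
  = (monad_mu T X ⊳m monad_mu U P) ∘ eqv_c U (T X) (U P) ∘ fmor U (eqv_c U X P).
Proof.
rewrite (eqv_nu_mor U).2 /= fmor1 !compA -bmorM comp1m.
by rewrite compm1.
Qed.

Lemma eqv_c_eta (X : C) (P : N) :
  eqv_c U X P ∘ monad_eta U (X ⊳ P) = monad_eta T X ⊳m monad_eta U P.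
Proof. by rewrite (eqv_u_mor U).2 /= fmor1 -bmorM comp1m compm1. Qed.

Definition eqv_act : bifunctor (hopf_modules T) (em_cat U) (em_cat U) :=
  em_bifunctor eqv_c_nat eqv_c_mu eqv_c_eta.

Lemma eqv_m_subproof (X Y : hopf_modules T) (P : em_cat U) :
  act_m (em_car X) (em_car Y) (em_car P) ∘ em_act (eqv_act (X ⊗ Y) P)
  = em_act (eqv_act X (eqv_act Y P)) ∘ fmor U (act_m _ _ _).
Proof.
have /= H := modfun_m (eqv_c_modfun U) (em_car X) (em_car Y) (em_car P).
rewrite fmor1 in H.
rewrite /= bmor_compl bmor_compr -[RHS]compA -[RHS]compA
  (compA _ (eqv_c U _ _) (fmor U _)).
by rewrite H !compA act_m_nat.
Qed.

Lemma eqv_l_subproof (P : em_cat U) :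
  act_l (em_car P) ∘ em_act (eqv_act (munit (hopf_modules T)) P)
  = em_act P ∘ fmor U (act_l _).
Proof.
have /= H := modfun_l (eqv_c_modfun U) (em_car P).
rewrite /= -(comp1m (hopf_phi T)) -(compm1 (em_act P)) bmorM !compA compm1.
by rewrite act_l_nat -!compA -H !compA.
Qed.

(* The category of U-modules as a module category over the T-modules *)
Definition eqv_modules : lax_modcat (hopf_modules T).
Proof.
exists (em_cat U) eqv_act
  (fun X Y P => em_mk (eqv_act (X ⊗ Y) P) (eqv_act X (eqv_act Y P)) _
     (eqv_m_subproof X Y P))
  (fun P => em_mk (eqv_act (munit _) P) P _ (eqv_l_subproof P)).
- by move=> *; apply: val_inj; apply: act_m_nat.
- by move=> *; apply: val_inj; apply: act_l_nat.
- by move=> *; apply: val_inj; apply: act_pentagon.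
- by move=> *; apply: val_inj; apply: act_runit.
- by move=> *; apply: val_inj; apply: act_lunit.
Defined.

End Equivariance.

(* Main.v *)
From mathcomp Require Import all_boot all_algebra.
From HB Require Import structures.
From mathcomp Require Import boolp.
Require Import Defs.

(* For P in M, the functor H X = L X ⊳ P from C to M, where L is the free T-module functor, is
   right exact and so has a right adjoint G. Because the category of T-modules has left duals,
   G is a module functor, which makes U = G H a T-equivariant structure on the regular module
   category C. Since M is exact, H preserves projectives and G is exact.

   Let P be simple. The objects of M killed by G form a direct summand of M not containing P, so
   they vanish if M is indecomposable; then every object is a quotient of some H X, the functor G
   is faithful, and Beck's theorem gives M ≃ C^U. In the same way a nonzero quotient of U defines
   a submodule category of M containing a simple object, hence all of M, and U is simple.

   Finally U is exact because T is, which follows by comparing the growth of the lengths of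
   tensor powers of T Q and of a complement of Q in T Q, for a projective Q covering the unit. *)

Set Implicit Arguments.
Unset Strict Implicit.
Unset Printing Implicit Defensive.
Import GRing.Theory.
Local Open Scope ring_scope.
Local Open Scope cat_scope.

(** * Linear abelian categories *)

(** The regular category [C] serves for every [M]: a projective tensored with any object is
    projective, and simplicity of the unit excludes a decomposition. All information on [M] sits in
    [U].

    Left exactness is the obstacle. A lax module functor has to be left exact; for [U] this rests on
    left exactness of [T], of which only right exactness is given. The two fusion operators have
    separate tasks: the left one turns duals in [C] into duals of T-modules, the right one moves [T]
    past powers of [T Q] in the length estimate.

    Exactness of [M] enters twice, through projective objects. It makes [G] right exact; and it
    covers every [Q] by a projective of the form [Y ⊳ Q], which stays in any class stable under the
    action. Because of this, the objects killed by [G] form a direct summand and not merely a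
    torsion class.

    Lengths are replaced by dimensions of Hom spaces out of finitely many projectives. These numbers
    are additive on short exact sequences without any Jordan-Hölder argument, and they also bound
    the objects that compete to be a value of the right adjoint. *)

Section LinearCategories.
Context {k : fieldType} {A : lincat k}.
Implicit Types X Y Z P Q S : A.

(** [is_iso] only asserts existence, so an inverse is chosen by [cid]; it is used through [invK] and
    [invKV]. *)
Definition inv X Y (f : hom X Y) (fi : is_iso f) : hom Y X := projT1 (cid fi).

Lemma invK X Y (f : hom X Y) (fi : is_iso f) : inv fi ∘ f = idm X.
Proof. by rewrite /inv; case: cid => g []. Qed.

Lemma invKV X Y (f : hom X Y) (fi : is_iso f) : f ∘ inv fi = idm Y.
Proof. by rewrite /inv; case: cid => g []. Qed.

Lemma inv_iso X Y (f : hom X Y) (fi : is_iso f) : is_iso (inv fi).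
Proof. by exists f; rewrite invK invKV. Qed.

Lemma idm_iso X : is_iso (idm X).
Proof. by exists (idm X); rewrite compm1. Qed.

Lemma comp_iso X Y Z (g : hom Y Z) (f : hom X Y) :
  is_iso g -> is_iso f -> is_iso (g ∘ f).
Proof.
move=> [g' [g'g gg']] [f' [f'f ff']]; exists (f' ∘ g'); split.
  by rewrite compA -(compA f') g'g compm1.
by rewrite compA -(compA g) ff' compm1.
Qed.

Lemma iso_epi X Y (f : hom X Y) : is_iso f -> is_epi f.
Proof.
by move=> [g [_ fg]] Z u v uv; rewrite -(compm1 u) -(compm1 v) -fg !compA uv.
Qed.

Lemma iso_mono X Y (f : hom X Y) : is_iso f -> is_mono f.
Proof.
by move=> [g [gf _]] Z u v uv; rewrite -(comp1m u) -(comp1m v) -gf -!compA uv.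
Qed.

Lemma split_mono X Y (f : hom X Y) g : g ∘ f = idm X -> is_mono f.
Proof. by move=> gf Z u v uv; rewrite -(comp1m u) -gf -compA uv compA gf comp1m. Qed.

Lemma split_epi X Y (f : hom X Y) g : f ∘ g = idm Y -> is_epi f.
Proof. by move=> fg Z u v uv; rewrite -(compm1 u) -fg compA uv -compA fg compm1. Qed.

Lemma comp0m X Y Z (f : hom X Y) : (0 : hom Y Z) ∘ f = 0.
Proof.
by have := comp_linl (Z := Z) f (-1) 0 0; rewrite /= scaler0 addr0 => {1}->; rewrite scaleN1r addNr.
Qed.

Lemma compm0 X Y Z (g : hom Y Z) : g ∘ (0 : hom X Y) = 0.
Proof.
by have := comp_linr (X := X) g (-1) 0 0; rewrite /= scaler0 addr0 => {1}->; rewrite scaleN1r addNr.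
Qed.

Lemma compDl X Y Z (g h : hom Y Z) (f : hom X Y) : (g + h) ∘ f = g ∘ f + h ∘ f.
Proof. by have := comp_linl f 1 g h; rewrite !scale1r. Qed.

Lemma compDr X Y Z (g : hom Y Z) (f h : hom X Y) : g ∘ (f + h) = g ∘ f + g ∘ h.
Proof. by have := comp_linr g 1 f h; rewrite !scale1r. Qed.

Lemma compNl X Y Z (g : hom Y Z) (f : hom X Y) : (- g) ∘ f = - (g ∘ f).
Proof. by have := comp_linl f (-1) g 0; rewrite !scaleN1r !addr0 comp0m addr0. Qed.

Lemma compNr X Y Z (g : hom Y Z) (f : hom X Y) : g ∘ (- f) = - (g ∘ f).
Proof. by have := comp_linr g (-1) f 0; rewrite !scaleN1r !addr0 compm0 addr0. Qed.

Lemma compBl X Y Z (g h : hom Y Z) (f : hom X Y) : (g - h) ∘ f = g ∘ f - h ∘ f.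
Proof. by rewrite compDl compNl. Qed.

Lemma compBr X Y Z (g : hom Y Z) (f h : hom X Y) : g ∘ (f - h) = g ∘ f - g ∘ h.
Proof. by rewrite compDr compNr. Qed.

Lemma monoP X Y (f : hom X Y) :
  is_mono f <-> forall Z (g : hom Z X), f ∘ g = 0 -> g = 0.
Proof.
split=> fm Z g; first by move=> fg; apply: fm; rewrite fg compm0.
by move=> h fgh; apply/subr0_eq/fm; rewrite compBr fgh subrr.
Qed.

Lemma epiP X Y (f : hom X Y) :
  is_epi f <-> forall Z (g : hom Y Z), g ∘ f = 0 -> g = 0.
Proof.
split=> fm Z g; first by move=> fg; apply: fm; rewrite fg comp0m.
by move=> h fgh; apply/subr0_eq/fm; rewrite compBl fgh subrr.
Qed.

Lemma mono_comp X Y Z (g : hom Y Z) (f : hom X Y) :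
  is_mono g -> is_mono f -> is_mono (g ∘ f).
Proof. by move=> gm fm W u v; rewrite -!compA => /gm /fm. Qed.

Lemma epi_comp X Y Z (g : hom Y Z) (f : hom X Y) :
  is_epi g -> is_epi f -> is_epi (g ∘ f).
Proof. by move=> ge fe W u v; rewrite !compA => /fe /ge. Qed.

Lemma epi_compl X Y Z (g : hom Y Z) (f : hom X Y) : is_epi (g ∘ f) -> is_epi g.
Proof. by move=> ge W u v uv; apply: ge; rewrite !compA uv. Qed.

Lemma zero_obP X : is_zero_ob X <-> idm X = 0.
Proof.
split=> [[+ _]|X0]; first exact.
by split=> Y f; [rewrite -(compm1 f) X0 compm0 | rewrite -(comp1m f) X0 comp0m].
Qed.

Lemma zero_ob_iso X Y (f : hom X Y) : is_iso f -> is_zero_ob X -> is_zero_ob Y.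
Proof. by move=> [g [_ fg]] [X0 _]; apply/zero_obP; rewrite -fg (X0 _ f) comp0m. Qed.

Lemma zero_ob_mono X Y (f : hom X Y) : is_mono f -> is_zero_ob Y -> is_zero_ob X.
Proof. by move=> fm [_ Y0]; apply/zero_obP/fm; rewrite !(Y0 _ (f ∘ _)). Qed.

Lemma zero_ob_epi X Y (f : hom X Y) : is_epi f -> is_zero_ob X -> is_zero_ob Y.
Proof. by move=> fm [X0 _]; apply/zero_obP/fm; rewrite !(X0 _ (_ ∘ f)). Qed.

Lemma kernel_mono X Y K (f : hom X Y) (i : hom K X) : is_kernel f i -> is_mono i.
Proof.
move=> [fi0 ker] Z u v uv; have [|w [_ w_uniq]] := ker _ (i ∘ u).
  by rewrite compA fi0 comp0m.
by rewrite -(w_uniq u) // -(w_uniq v).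
Qed.

Lemma cokernel_epi X Y Q (f : hom X Y) (q : hom Y Q) : is_cokernel f q -> is_epi q.
Proof.
move=> [qf0 cok] Z u v uv; have [|w [_ w_uniq]] := cok _ (u ∘ q).
  by rewrite -compA qf0 compm0.
by rewrite -(w_uniq u) // -(w_uniq v).
Qed.

Lemma kernel_lift X Y K (f : hom X Y) (i : hom K X) Z (g : hom Z X) :
  is_kernel f i -> f ∘ g = 0 -> exists h, i ∘ h = g.
Proof. by move=> [_ ker] /ker [h [<- _]]; exists h. Qed.

Lemma cokernel_desc X Y Q (f : hom X Y) (q : hom Y Q) Z (g : hom Y Z) :
  is_cokernel f q -> g ∘ f = 0 -> exists h, h ∘ q = g.
Proof. by move=> [_ cok] /cok [h [<- _]]; exists h. Qed.

Lemma is_kernelI X Y K (f : hom X Y) (i : hom K X) : f ∘ i = 0 -> is_mono i ->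
  (forall Z (g : hom Z X), f ∘ g = 0 -> exists h, i ∘ h = g) -> is_kernel f i.
Proof.
move=> fi im ker; split=> // Z g /ker [h hg]; exists h; split=> // h' h'g.
by apply: im; rewrite hg.
Qed.

Lemma is_cokernelI X Y Q (f : hom X Y) (q : hom Y Q) : q ∘ f = 0 -> is_epi q ->
  (forall Z (g : hom Y Z), g ∘ f = 0 -> exists h, h ∘ q = g) -> is_cokernel f q.
Proof.
move=> qf qe cok; split=> // Z g /cok [h hg]; exists h; split=> // h' h'g.
by apply: qe; rewrite hg.
Qed.

Lemma cokernel_iso X Y Q Q' (f : hom X Y) (q : hom Y Q) (q' : hom Y Q') :
  is_cokernel f q -> is_cokernel f q' -> exists2 u : hom Q Q', is_iso u & u ∘ q = q'.
Proof.
move=> kq kq'; have [u qu] := cokernel_desc kq kq'.1; have [v qv] := cokernel_desc kq' kq.1.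
exists u => //; exists v; split; [apply: (cokernel_epi kq) | apply: (cokernel_epi kq')].
  by rewrite -compA qu qv comp1m.
by rewrite -compA qv qu comp1m.
Qed.

Lemma kernel_zeroP X Y K (f : hom X Y) (i : hom K X) :
  is_kernel f i -> is_zero_ob K <-> is_mono f.
Proof.
move=> ki; split=> [[_ K0]|fm].
  by apply/monoP => Z g /(kernel_lift ki) [h <-]; rewrite (K0 _ h) compm0.
by apply/zero_obP/(kernel_mono ki)/fm; rewrite !compA ki.1 !comp0m.
Qed.

Lemma cokernel_zeroP X Y Q (f : hom X Y) (q : hom Y Q) :
  is_cokernel f q -> is_zero_ob Q <-> is_epi f.
Proof.
move=> kq; split=> [[Q0 _]|fe].
  by apply/epiP => Z g /(cokernel_desc kq) [h <-]; rewrite (Q0 _ h) comp0m.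
by apply/zero_obP/(cokernel_epi kq)/fe; rewrite -!compA kq.1 !compm0.
Qed.

Lemma is_kernel_comp X Y Z K (f : hom X Y) (i : hom K X) (g : hom Y Z) :
  is_kernel f i -> is_mono g -> is_kernel (g ∘ f) i.
Proof.
move=> ki gm; apply: is_kernelI; first by rewrite -compA ki.1 compm0.
  exact: kernel_mono ki.
by move=> W u gfu; apply: (kernel_lift ki); move/monoP: gm; apply; rewrite compA.
Qed.

Lemma is_cokernel_comp X Y Z Q (f : hom X Y) (q : hom Y Q) (g : hom Z X) :
  is_cokernel f q -> is_epi g -> is_cokernel (f ∘ g) q.
Proof.
move=> kq ge; apply: is_cokernelI; first by rewrite compA kq.1 comp0m.
  exact: cokernel_epi kq.
by move=> W u gfu; apply: (cokernel_desc kq); move/epiP: ge; apply; rewrite -compA.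
Qed.

Lemma is_cokernel_isol X Y Q Q' (f : hom X Y) (q : hom Y Q) (u : hom Q Q') :
  is_cokernel f q -> is_iso u -> is_cokernel f (u ∘ q).
Proof.
move=> kq ui; apply: is_cokernelI; first by rewrite -compA kq.1 compm0.
  exact: epi_comp (iso_epi ui) (cokernel_epi kq).
move=> W g /(cokernel_desc kq) [h <-]; exists (h ∘ inv ui).
by rewrite -compA (compA _ u) invK comp1m.
Qed.

(** The split coequalizer in additive form: [f] plays the difference of the two parallel maps, and
    [s], [t] are the splittings. *)
Lemma split_coker X Y Q (f : hom X Y) (q : hom Y Q) (s : hom Q Y) (t : hom Y X) :
  q ∘ f = 0 -> q ∘ s = idm Q -> f ∘ t = idm Y - s ∘ q -> is_cokernel f q.
Proof.
move=> qf qs ft; apply: is_cokernelI => //; first exact: split_epi qs.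
move=> Z g gf; exists (g ∘ s); have /subr0_eq <- // : g - g ∘ s ∘ q = 0.
by rewrite -{1}(compm1 g) -compA -compBr -ft compA gf comp0m.
Qed.

Lemma projective_biproduct X Y S (i1 : hom X S) (i2 : hom Y S) (p1 : hom S X) (p2 : hom S Y) :
  is_biproduct i1 i2 p1 p2 -> is_projective X -> is_projective Y -> is_projective S.
Proof.
move=> [_ _ _ _ e1] Xp Yp U V e f ee.
have [g1 eg1] := Xp _ _ e (f ∘ i1) ee; have [g2 eg2] := Yp _ _ e (f ∘ i2) ee.
exists (g1 ∘ p1 + g2 ∘ p2).
by rewrite compDr !compA eg1 eg2 -!compA -compDr e1 compm1.
Qed.

End LinearCategories.

(** * Kernels, cokernels and images in an abelian category *)

Section AbelianCategories.
Context {k : fieldType} {A : lincat k}.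
Hypothesis Aab : is_abelian A.
Implicit Types X Y Z P Q S : A.

(** [e] is a cokernel of some [g], and [g] factors through the kernel [i]; so whatever kills [i]
    kills [g]. *)
Lemma epi_is_cokernel X Y K (e : hom X Y) (i : hom K X) :
  is_epi e -> is_kernel e i -> is_cokernel i e.
Proof.
move=> ee ki; have [Z [g kg]] := epi_cokernel Aab ee.
have [h ih] := kernel_lift ki kg.1.
apply: is_cokernelI => //; first exact: ki.1.
by move=> W f fi; apply: (cokernel_desc kg); rewrite -ih compA fi comp0m.
Qed.

Lemma mono_is_kernel X Y Q (m : hom X Y) (q : hom Y Q) :
  is_mono m -> is_cokernel m q -> is_kernel q m.
Proof.
move=> mm kq; have [Z [g kg]] := mono_kernel Aab mm.
have [h hq] := cokernel_desc kq kg.1.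
apply: is_kernelI => //; first exact: kq.1.
by move=> W f fi; apply: (kernel_lift kg); rewrite -hq -compA fi compm0.
Qed.

Lemma mono_epi_iso X Y (f : hom X Y) : is_mono f -> is_epi f -> is_iso f.
Proof.
move=> fm fe; have [K [i ki]] := has_kernels Aab f.
have kf := epi_is_cokernel fe ki; have [K0 _] := (kernel_zeroP ki).2 fm.
have [g gf] : exists g, g ∘ f = idm X by apply: (cokernel_desc kf); rewrite (K0 _ i) compm0.
by exists g; split=> //; apply: fe; rewrite -compA gf compm1 comp1m.
Qed.

Lemma image X Y (f : hom X Y) : exists (I : A) (e : hom X I) (m : hom I Y),
  [/\ is_epi e, is_mono m & f = m ∘ e].
Proof.
have [K [i ki]] := has_kernels Aab f; have [I [e ke]] := has_cokernels Aab i.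
have [m me] := cokernel_desc ke ki.1; exists I, e, m; split=> //; first exact: cokernel_epi ke.
(* if m g = 0, then e factors through coker g, which is thus invertible *)
apply/monoP => Z g mg; have [J [q kq]] := has_cokernels Aab g.
have [m' m'q] := cokernel_desc kq mg.
have [L [j kj]] := has_kernels Aab (q ∘ e).
have qe_epi : is_epi (q ∘ e) := epi_comp (cokernel_epi kq) (cokernel_epi ke).
have kqe := epi_is_cokernel qe_epi kj.
have [h ih] : exists h, i ∘ h = j.
  by apply: (kernel_lift ki); rewrite -me -m'q -2!compA (compA q) kj.1 compm0.
have [r rq] : exists r, r ∘ (q ∘ e) = e.
  by apply: (cokernel_desc kqe); rewrite -ih compA ke.1 comp0m.
have rqi : r ∘ q = idm I by apply: (cokernel_epi ke); rewrite -compA rq comp1m.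
by rewrite -(comp1m g) -rqi -compA kq.1 compm0.
Qed.

Lemma cokernel_of_epi_kernel X Y Z (f : hom X Y) (q : hom Y Z) :
  is_cokernel f q -> exists (I : A) (e : hom X I) (m : hom I Y),
    [/\ is_epi e, is_kernel q m & f = m ∘ e].
Proof.
move=> kq; have [I [e [m [ee mm fE]]]] := image f; exists I, e, m; split=> //.
apply: mono_is_kernel => //; apply: is_cokernelI; last 1 first.
- by move=> W g gm; apply: (cokernel_desc kq); rewrite fE compA gm comp0m.
- by apply/(epiP e).1 => //; rewrite -compA -fE kq.1.
- exact: cokernel_epi kq.
Qed.

Lemma kernel_of_mono_cokernel X Y K (f : hom X Y) (i : hom K X) :
  is_kernel f i -> exists (I : A) (e : hom X I) (m : hom I Y),
    [/\ is_mono m, is_cokernel i e & f = m ∘ e].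
Proof.
move=> ki; have [I [e [m [ee mm fE]]]] := image f; exists I, e, m; split=> //.
apply: epi_is_cokernel => //; apply: is_kernelI; last 1 first.
- by move=> W g gm; apply: (kernel_lift ki); rewrite fE -compA gm compm0.
- by apply/(monoP m).1 => //; rewrite compA -fE ki.1.
- exact: kernel_mono ki.
Qed.

Lemma simple_epi X S (f : hom X S) : is_simple S -> f <> 0 -> is_epi f.
Proof.
move=> [_ Ss] f0; have [I [e [m [ee mm fE]]]] := image f.
have [[_ I0]|mi] := Ss _ _ mm; first by case: f0; rewrite fE (I0 _ e) compm0.
by rewrite fE; apply: epi_comp => //; apply: iso_epi.
Qed.

Lemma simple_mono S Y (f : hom S Y) : is_simple S -> f <> 0 -> is_mono f.
Proof.
move=> [_ Ss] f0; have [K [i ki]] := has_kernels Aab f.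
have [K0|ii] := Ss _ _ (kernel_mono ki); first exact/(kernel_zeroP ki).
by case: f0; rewrite -(compm1 f) -(invKV ii) compA ki.1 comp0m.
Qed.

Lemma simple_quotient X : finite_length X -> ~ is_zero_ob X ->
  exists (S : A) (p : hom X S), is_simple S /\ is_epi p.
Proof.
by case=> [//|{}X Y S i p _ kp Ss _ _]; exists S, p; split=> //; apply: cokernel_epi kp.
Qed.

End AbelianCategories.

(** * Exactness of functors *)

Section FunctorBasics.
Context {k : fieldType} {A B : lincat k} (F : functor A B).
Implicit Types X Y Z : A.

Lemma fmor0 X Y : fmor F (0 : hom X Y) = 0.
Proof.
by have := fmor_lin F (-1) (0 : hom X Y) 0; rewrite scaler0 addr0 => {1}->; rewrite scaleN1r addNr.
Qed.

Lemma fmorD X Y (f g : hom X Y) : fmor F (f + g) = fmor F f + fmor F g.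
Proof. by have := fmor_lin F 1 f g; rewrite !scale1r. Qed.

Lemma fmorN X Y (f : hom X Y) : fmor F (- f) = - fmor F f.
Proof. by have := fmor_lin F (-1) f 0; rewrite !scaleN1r !addr0 fmor0 addr0. Qed.

Lemma fmorB X Y (f g : hom X Y) : fmor F (f - g) = fmor F f - fmor F g.
Proof. by rewrite fmorD fmorN. Qed.

Lemma fmor_iso X Y (f : hom X Y) : is_iso f -> is_iso (fmor F f).
Proof. by move=> [g [gf fg]]; exists (fmor F g); rewrite -!fmorM gf fg !fmor1. Qed.

Lemma fmor_zero_ob X : is_zero_ob X -> is_zero_ob (F X).
Proof. by move/zero_obP => X0; apply/zero_obP; rewrite -fmor1 X0 fmor0. Qed.

Hypotheses (Aab : is_abelian A).

Lemma left_exact_mono X Y (f : hom X Y) : left_exact F -> is_mono f -> is_mono (fmor F f).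
Proof.
move=> Fl fm; have [Z [q kq]] := has_cokernels Aab f.
exact: kernel_mono (Fl _ _ _ _ _ (mono_is_kernel Aab fm kq)).
Qed.

Lemma right_exact_epi X Y (f : hom X Y) : right_exact F -> is_epi f -> is_epi (fmor F f).
Proof.
move=> Fr fe; have [Z [q kq]] := has_kernels Aab f.
exact: cokernel_epi (Fr _ _ _ _ _ (epi_is_cokernel Aab fe kq)).
Qed.

End FunctorBasics.

Section FunctorExactness.
Context {k : fieldType} {A B : lincat k} (F : functor A B).
Hypotheses (Aab : is_abelian A) (Bab : is_abelian B).

(** Factor [f] through its image as [m ∘ e]. Right exactness and [fmor F i] mono keep the short
    exact sequence of [i] and [e], and [fmor F m], being mono, does not change the kernel. *)
Lemma right_exact_mono_exact :
  right_exact F -> (forall (X Y : A) (f : hom X Y), is_mono f -> is_mono (fmor F f)) -> left_exact F.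
Proof.
move=> Fr Fm X Y K f i ki.
have [I [e [m [mm ke ->]]]] := kernel_of_mono_cokernel Aab ki.
rewrite fmorM; apply: is_kernel_comp (Fm _ _ _ mm).
exact (mono_is_kernel Bab (Fm _ _ _ (kernel_mono ki)) (Fr _ _ _ _ _ ke)).
Qed.

Lemma left_exact_epi_exact :
  left_exact F -> (forall (X Y : A) (f : hom X Y), is_epi f -> is_epi (fmor F f)) -> right_exact F.
Proof.
move=> Fl Fe X Y K f q kq.
have [I [e [m [ee km ->]]]] := cokernel_of_epi_kernel Aab kq.
rewrite fmorM; apply: is_cokernel_comp (Fe _ _ _ ee).
exact (epi_is_cokernel Bab (Fe _ _ _ (cokernel_epi kq)) (Fl _ _ _ _ _ km)).
Qed.

Lemma exact_faithful_iso (X Y : A) (f : hom X Y) :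
  exact_functor F -> faithful F -> is_iso (fmor F f) -> is_iso f.
Proof.
move=> [Fl Fr] Ff fi; apply: (mono_epi_iso Aab).
  by apply/monoP => Z g fg; apply: Ff; apply: (iso_mono fi); rewrite -!fmorM fg compm0.
by apply/epiP => Z g fg; apply: Ff; apply: (iso_epi fi); rewrite -!fmorM fg comp0m.
Qed.

End FunctorExactness.

(** * Projective objects and lengths *)

Section HomDimension.
Context {k : fieldType} {A : lincat k}.
Implicit Types X Y Z P : A.

Definition hdim X Y := \dim {:hom X Y}.

Definition postcomp P X Y (f : hom X Y) (g : hom P X) : hom P Y := f ∘ g.

Lemma postcomp_lin P X Y (f : hom X Y) : linear (@postcomp P X Y f).
Proof. exact: comp_linr. Qed.

HB.instance Definition _ P X Y (f : hom X Y) :=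
  GRing.isLinear.Build k _ _ _ (@postcomp P X Y f) (@postcomp_lin P X Y f).

Lemma linear_inj_dim (U V : vectType k) (f : U -> V) :
  linear f -> injective f -> (\dim {:U} <= \dim {:V})%N.
Proof.
move=> flin fi; pose g : {linear U -> V} := HB.pack f (GRing.isLinear.Build k U V _ f flin).
have <- : \dim (limg (linfun g)) = \dim {:U}.
  apply: limg_dim_eq; apply/eqP; rewrite -subv0; apply/subvP => u.
  rewrite memv_cap memv_ker lfunE => /andP [_ /eqP f0].
  by rewrite memv0; apply/eqP/fi; rewrite [RHS](linear0 g).
exact/dimvS/subvf.
Qed.

Lemma hdim_mono P X Y (f : hom X Y) : is_mono f -> (hdim P X <= hdim P Y)%N.
Proof. by move=> fm; apply: (linear_inj_dim (@postcomp_lin P X Y f)) => u v /fm. Qed.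

Lemma hdim_cokernel P X Y Z (f : hom X Y) (q : hom Y Z) :
  (forall g : hom P Y, q ∘ g = 0 -> exists h : hom P X, f ∘ h = g) ->
  (hdim P Y <= hdim P X + hdim P Z)%N.
Proof.
move=> ex; rewrite /hdim -(limg_ker_dim (linfun (@postcomp P Y Z q)) fullv) capfv.
apply: leq_add; last exact/dimvS/subvf.
rewrite (leq_trans (n := \dim (limg (linfun (@postcomp P X Y f))))) //.
  apply/dimvS/subvP => g; rewrite memv_ker lfunE => /eqP /ex [h <-].
  by apply/memv_imgP; exists h; rewrite ?memvf // lfunE.
by rewrite /hdim -(limg_ker_dim (linfun (@postcomp P X Y f)) fullv) leq_addl.
Qed.

Lemma hdim_short P X Y Z (f : hom X Y) (q : hom Y Z) :
  is_projective P -> is_kernel q f -> is_epi q -> hdim P Y = (hdim P X + hdim P Z)%N.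
Proof.
move=> Pp kf qe; apply/eqP; rewrite eqn_leq (hdim_cokernel (f := f) (q := q)) /=; last first.
  by move=> g; apply: kernel_lift.
rewrite /hdim -(limg_ker_dim (linfun (@postcomp P Y Z q)) fullv) capfv; apply: leq_add.
  have <- : \dim (limg (linfun (@postcomp P X Y f))) = \dim {:hom P X}.
    apply: limg_dim_eq; apply/eqP; rewrite -subv0; apply/subvP => u.
    rewrite memv_cap memv_ker lfunE => /andP [_ /eqP f0].
    by rewrite memv0; apply/eqP; apply: ((monoP f).1 (kernel_mono kf)) f0.
  apply/dimvS/subvP => _ /memv_imgP [h _ ->].
  by rewrite memv_ker !lfunE /= /postcomp compA kf.1 comp0m.
apply/dimvS/subvP => g _; have [h <-] := Pp _ _ q g qe.
by apply/memv_imgP; exists h; rewrite ?memvf // lfunE.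
Qed.

Lemma hdim_epi P X Y (e : hom X Y) :
  is_abelian A -> is_projective P -> is_epi e -> (hdim P Y <= hdim P X)%N.
Proof.
move=> Aab Pp ee; have [K [i ki]] := has_kernels Aab e.
by rewrite (hdim_short Pp ki ee) leq_addl.
Qed.

End HomDimension.

Section ProjectiveGenerators.
Context {k : fieldType} {A : lincat k} (Aab : is_abelian A) (Alf : is_locally_finite A).
Implicit Types X Y Z S : A.

(** Weaker than a list of projective covers: members may repeat, decompose or vanish. *)
Definition generating_projectives n (P : 'I_n -> A) :=
  (forall i, is_projective (P i)) /\
  forall S, is_simple S -> exists (i : 'I_n) (f : hom (P i) S), is_epi f.

Context {n : nat} {P : 'I_n -> A} (Pgen : generating_projectives P).

Lemma gen_nonzero X : ~ is_zero_ob X -> exists i (g : hom (P i) X), g <> 0.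
Proof.
move=> /(simple_quotient (Alf X)) [S [p [Ss pe]]]; have [i [q qe]] := Pgen.2 S Ss.
have [g pg] := Pgen.1 i _ _ p q pe; exists i, g => g0.
by apply: Ss.1; apply/zero_obP/qe; rewrite comp1m comp0m -pg g0 compm0.
Qed.

(** Otherwise the image of [f] receives a nonzero map from some [P i], which lifts along the
    epimorphism onto the image. *)
Lemma gen_detect X Y (f : hom X Y) : (forall i (g : hom (P i) X), f ∘ g = 0) -> f = 0.
Proof.
move=> f0; have [I [e [m [ee mm fE]]]] := image Aab f.
have [I0|/gen_nonzero [i [q q0]]] := EM (is_zero_ob I); first by rewrite fE (I0.2 _ e) compm0.
have [g eg] := Pgen.1 i _ _ e q ee; case: q0; rewrite -eg.
by apply: ((monoP m).1 mm); rewrite compA -fE f0.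
Qed.

(** A weighted length: by additivity, a composition factor S counts with the total dimension of the
    spaces [hom (P i) S], which is positive. *)
Definition plen X := (\sum_i hdim (P i) X)%N.

Lemma plen_mono X Y (f : hom X Y) : is_mono f -> (plen X <= plen Y)%N.
Proof. by move=> fm; apply: leq_sum => i _; apply: hdim_mono fm. Qed.

Lemma plen_epi X Y (f : hom X Y) : is_epi f -> (plen Y <= plen X)%N.
Proof. by move=> fe; apply: leq_sum => i _; apply: (hdim_epi Aab (Pgen.1 i) fe). Qed.

Lemma plen_iso X Y (f : hom X Y) : is_iso f -> plen X = plen Y.
Proof.
move=> fi; apply/eqP; rewrite eqn_leq (plen_mono (iso_mono fi)).
exact: plen_epi (iso_epi fi).
Qed.

Lemma plen_short X Y Z (f : hom X Y) (q : hom Y Z) :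
  is_kernel q f -> is_epi q -> plen Y = (plen X + plen Z)%N.
Proof.
move=> kf qe; rewrite -big_split; apply: eq_bigr => i _.
exact: hdim_short (Pgen.1 i) kf qe.
Qed.

Lemma plen_cokernel X Y Z (f : hom X Y) (q : hom Y Z) :
  is_cokernel f q -> (plen Y <= plen X + plen Z)%N.
Proof.
move=> kq; have [I [e [m [ee km fE]]]] := cokernel_of_epi_kernel Aab kq.
by rewrite (plen_short km (cokernel_epi kq)) leq_add2r (plen_epi ee).
Qed.

Lemma plen_biproduct X Y S (i1 : hom X S) (i2 : hom Y S) (p1 : hom S X) (p2 : hom S Y) :
  is_biproduct i1 i2 p1 p2 -> plen S = (plen X + plen Y)%N.
Proof.
move=> [p1i1 p2i2 p1i2 p2i1 e]; apply: (plen_short (f := i1) (q := p2)).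
  apply: is_kernelI => //; first exact: split_mono p1i1.
  move=> Z g p2g; exists (p1 ∘ g).
  by rewrite -[RHS]comp1m -e compDl -(compA i2) p2g compm0 addr0 compA.
exact: split_epi p2i2.
Qed.

Lemma plen_eq0 X : plen X = 0%N -> is_zero_ob X.
Proof.
move=> /eqP; rewrite sum_nat_eq0 => /forallP X0; apply/zero_obP/gen_detect => i g.
have := X0 i; rewrite /hdim dimv_eq0 => /eqP h0.
by have := memvf g; rewrite h0 memv0 => /eqP ->; rewrite compm0.
Qed.

Lemma zero_plen X : is_zero_ob X -> plen X = 0%N.
Proof.
move=> [_ X0]; apply: big1 => i _; apply/eqP; rewrite /hdim dimv_eq0 -subv0.
by apply/subvP => g _; rewrite (X0 _ g) mem0v.
Qed.

Lemma plen_epi_iso X Y (f : hom X Y) : is_epi f -> (plen X <= plen Y)%N -> is_iso f.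
Proof.
move=> fe le; apply: (mono_epi_iso Aab) => //; have [K [i ki]] := has_kernels Aab f.
apply/(kernel_zeroP ki)/plen_eq0; move: le; rewrite (plen_short ki fe).
by rewrite -{2}(add0n (plen Y)) leq_add2r leqn0 => /eqP.
Qed.

Lemma plen_mono_iso X Y (f : hom X Y) : is_mono f -> (plen Y <= plen X)%N -> is_iso f.
Proof.
move=> fe le; apply: (mono_epi_iso Aab) => //; have [K [i ki]] := has_cokernels Aab f.
apply/(cokernel_zeroP ki)/plen_eq0; move: le.
rewrite (plen_short (mono_is_kernel Aab fe ki) (cokernel_epi ki)).
by rewrite -{2}(addn0 (plen X)) leq_add2l leqn0 => /eqP.
Qed.

(** Induction on the length: a cover of the subobject [Y] and a lift to [X] of a cover of the simple
    quotient [S] together cover [X]. *)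
Lemma enough_projectives X : exists (Q : A) (p : hom Q X), is_projective Q /\ is_epi p.
Proof.
elim: (Alf X) => {X} [X X0|X Y S i p ki kp Ss _ [Q [q [Qp qe]]]].
  exists X, (idm X); split; last exact/iso_epi/idm_iso.
  by move=> Y Z e f _; exists 0; rewrite compm0 (X0.1 _ f).
have [j [s se]] := Pgen.2 S Ss; have [t pt] := Pgen.1 j _ _ p s (cokernel_epi kp).
have [R [i1 [i2 [p1 [p2 Rb]]]]] := has_biproducts Aab Q (P j).
exists R, (i ∘ q ∘ p1 + t ∘ p2); split; first exact: projective_biproduct Rb Qp (Pgen.1 j).
have [p1i1 p2i2 p1i2 p2i1 _] := Rb.
apply/epiP => Z g g0.
have gi : g ∘ i = 0.
  apply: (epiP q).1 => //; move: (congr1 (fun f => f ∘ i1) g0).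
  by rewrite comp0m -compA compDl -!compA p1i1 p2i1 !compm0 addr0 compm1 compA.
have gt : g ∘ t = 0.
  move: (congr1 (fun f => f ∘ i2) g0).
  by rewrite comp0m -compA compDl -!compA p1i2 p2i2 !compm0 add0r compm1.
have [h hp] := cokernel_desc kp gi; rewrite -hp ((epiP s).1 se _ h) ?comp0m //.
by rewrite -pt compA hp.
Qed.

(* By induction on the length: [E S] is a quotient of some [E (P i)] when [S] is simple. *)
Lemma right_exact_growth (E : functor A A) : right_exact E ->
  exists c, forall X, (plen (E X) <= c * plen X)%N.
Proof.
move=> Er; exists (\sum_i plen (E (P i)))%N => X.
elim: (Alf X) => {X} [X X0|X Y S i p ki kp Ss _ IH].
  by rewrite (zero_plen (fmor_zero_ob E X0)).
apply: leq_trans (plen_cokernel (Er _ _ _ _ _ kp)) _.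
rewrite (plen_short ki (cokernel_epi kp)) mulnDr; apply: leq_add => //.
have [j [s se]] := Pgen.2 S Ss.
apply: leq_trans (plen_epi (right_exact_epi Aab Er se)) _.
rewrite (bigD1 j) //= mulnDl; apply: leq_trans (leq_addr _ _).
by rewrite leq_pmulr // lt0n; apply/eqP => /plen_eq0; apply: Ss.1.
Qed.

End ProjectiveGenerators.

Lemma finite_cat_generators (k : fieldType) (A : lincat k) :
  is_finite_cat A -> exists n (P : 'I_n -> A), generating_projectives P.
Proof.
move=> [Aab _ [n [S Sall]] cov]; exists n.
have [Z Z0] := has_zero Aab.
have [i|P HP] := @choice 'I_n A (fun i P => is_projective P /\
    (is_simple (S i) -> exists p : hom P (S i), is_epi p)).
  have [/cov [P [p [Pp pe _]]]|nS] := EM (is_simple (S i)); first by exists P; split=> // _; exists p.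
  by exists Z; split=> // X Y e f _; exists 0; rewrite compm0 (Z0.1 _ f).
exists P; split=> [i|X Xs]; first exact: (HP i).1.
have [i [f fi]] := Sall X Xs; have Ss : is_simple (S i).
  split=> [S0|Y j jm]; first by apply: Xs.1; apply: zero_ob_iso (inv_iso fi) S0.
  have [|ji] := Xs.2 _ (inv fi ∘ j) (mono_comp (iso_mono (inv_iso fi)) jm); first by left.
  by right; rewrite -(comp1m j) -(invKV fi) -compA; apply: comp_iso.
have [p pe] := (HP i).2 Ss; exists i, (inv fi ∘ p).
exact: epi_comp (iso_epi (inv_iso fi)) pe.
Qed.

(** * Adjunctions *)

Record adjunction (k : fieldType) (A B : lincat k) (L : functor A B) (R : functor B A) := Adjunction {
  aunit : forall X, hom X (R (L X));
  acounit : forall Y, hom (L (R Y)) Y;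
  aunit_nat : forall X X' (f : hom X X'), aunit X' ∘ f = fmor R (fmor L f) ∘ aunit X;
  acounit_nat : forall Y Y' (g : hom Y Y'), acounit Y' ∘ fmor L (fmor R g) = g ∘ acounit Y;
  atri1 : forall X, acounit (L X) ∘ fmor L (aunit X) = idm (L X);
  atri2 : forall Y, fmor R (acounit Y) ∘ aunit (R Y) = idm (R Y) }.

Section Adjunctions.
Context {k : fieldType} {A B : lincat k} {L : functor A B} {R : functor B A}.
Variable adj : adjunction L R.
Local Notation eta := (aunit adj).
Local Notation eps := (acounit adj).

Definition radj X Y (g : hom (L X) Y) : hom X (R Y) := fmor R g ∘ eta X.
Definition ladj X Y (f : hom X (R Y)) : hom (L X) Y := eps Y ∘ fmor L f.

Lemma radjK X Y (g : hom (L X) Y) : ladj (radj g) = g.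
Proof. by rewrite /ladj /radj fmorM compA acounit_nat -compA atri1 compm1. Qed.

Lemma ladjK X Y (f : hom X (R Y)) : radj (ladj f) = f.
Proof. by rewrite /ladj /radj fmorM -compA -aunit_nat compA atri2 comp1m. Qed.

Lemma ladj_inj X Y (f g : hom X (R Y)) : eps Y ∘ fmor L f = eps Y ∘ fmor L g -> f = g.
Proof. by rewrite -!/(ladj _) => e; rewrite -(ladjK f) e ladjK. Qed.

Lemma radj_inj X Y (f g : hom (L X) Y) : fmor R f ∘ eta X = fmor R g ∘ eta X -> f = g.
Proof. by rewrite -!/(radj _) => e; rewrite -(radjK f) e radjK. Qed.

Lemma radj_comp X Y Y' (g : hom (L X) Y) (h : hom Y Y') : radj (h ∘ g) = fmor R h ∘ radj g.
Proof. by rewrite /radj fmorM compA. Qed.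

Lemma right_adjoint_mono X Y (f : hom X Y) : is_mono f -> is_mono (fmor R f).
Proof.
move=> fm; apply/monoP => Z g fg; apply: ladj_inj; apply: fm.
by rewrite !compA -!acounit_nat -!compA -!fmorM fg compm0.
Qed.

Lemma left_adjoint_epi X Y (f : hom X Y) : is_epi f -> is_epi (fmor L f).
Proof.
move=> fe; apply/epiP => Z g gf; apply: radj_inj; apply: fe.
by rewrite -!compA !aunit_nat !compA -!fmorM gf comp0m.
Qed.

Lemma right_adjoint_left_exact : left_exact R.
Proof.
move=> X Y K f i ki; apply: is_kernelI.
- by rewrite -fmorM ki.1 fmor0.
- exact/right_adjoint_mono/(kernel_mono ki).
move=> Z g fg; have [|h ih] := kernel_lift (g := ladj g) ki.
  by rewrite /ladj compA -acounit_nat -compA -fmorM fg fmor0 compm0.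
by exists (radj h); rewrite -radj_comp ih ladjK.
Qed.

Lemma left_adjoint_right_exact : right_exact L.
Proof.
move=> X Y Q f q kq; apply: is_cokernelI.
- by rewrite -fmorM kq.1 fmor0.
- exact/left_adjoint_epi/(cokernel_epi kq).
move=> Z g gf; have [|h hq] := cokernel_desc (g := radj g) kq.
  by rewrite /radj -compA aunit_nat compA -fmorM gf fmor0 comp0m.
by exists (ladj h); rewrite /ladj -compA -fmorM hq -/(ladj _) radjK.
Qed.

Lemma left_adjoint_projective P :
  (forall (X Y : B) (f : hom X Y), is_epi f -> is_epi (fmor R f)) ->
  is_projective P -> is_projective (L P).
Proof.
move=> Re Pp X Y e f ee; have [g eg] := Pp _ _ _ (radj f) (Re _ _ _ ee).
by exists (ladj g); rewrite /ladj compA -acounit_nat -compA -fmorM eg -/(ladj _) radjK.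
Qed.

(** Cover [R Y] by a projective [Q]. The adjunct of the cover starts at the projective [L Q] and
    lifts along [e]; hence the cover factors through [fmor R e]. *)
Lemma right_adjoint_epi X Y (e : hom X Y) :
  (forall X : A, exists (Q : A) (p : hom Q X), is_projective Q /\ is_epi p) ->
  (forall P, is_projective P -> is_projective (L P)) -> is_epi e -> is_epi (fmor R e).
Proof.
move=> enough Lp ee; have [Q [p [Qp pe]]] := enough (R Y).
have [g eg] := Lp _ Qp _ _ e (ladj p) ee.
by apply: (epi_compl (f := radj g)); rewrite -radj_comp eg ladjK.
Qed.

End Adjunctions.

(** * Right adjoints from universal arrows *)

Section UniversalArrows.
Context {k : fieldType} {A B : lincat k} (L : functor A B).
Context (R : B -> A) (e : forall Y, hom (L (R Y)) Y).
Hypothesis e_univ : forall Y X (g : hom (L X) Y), exists h : hom X (R Y), e Y ∘ fmor L h = g.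
Hypothesis e_uniq : forall Y X (h h' : hom X (R Y)),
  e Y ∘ fmor L h = e Y ∘ fmor L h' -> h = h'.

Let adjt Y X (g : hom (L X) Y) : hom X (R Y) := projT1 (cid (e_univ g)).

Let adjtE Y X (g : hom (L X) Y) : e Y ∘ fmor L (adjt g) = g.
Proof. by rewrite /adjt; case: cid. Qed.

Definition universal_functor : functor B A.
Proof.
exists R (fun Y Y' g => adjt (g ∘ e Y)).
- move=> Y Y' a f g; apply: e_uniq.
  by rewrite adjtE fmor_lin comp_linl comp_linr !adjtE.
- by move=> Y; apply: e_uniq; rewrite adjtE fmor1 comp1m compm1.
- by move=> X Y Z g f; apply: e_uniq; rewrite fmorM compA !adjtE -!compA adjtE.
Defined.

Definition universal_adjunction : adjunction L universal_functor.
Proof.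
exists (fun X => adjt (idm (L X))) e.
- move=> X X' f; apply: e_uniq.
  by rewrite !fmorM !compA !adjtE -compA adjtE compm1 comp1m.
- by move=> Y Y' g; rewrite /= adjtE.
- by move=> X; rewrite adjtE.
- by move=> Y; apply: e_uniq; rewrite !fmorM !compA adjtE -compA adjtE fmor1.
Defined.

End UniversalArrows.

(* For fixed Q in B consider the pairs (X, x : H X -> Q). Call such a pair minimal if
   f |-> x ∘ H f is injective; every pair maps to a minimal one by an epimorphism, and
   the lengths of minimal pairs are bounded, since hom (P i) X embeds into
   hom (H (P i)) Q. A minimal pair of maximal length is terminal. *)
Section AdjointFunctorTheorem.
Context {k : fieldType} {A B : lincat k} (Aab : is_abelian A) (Alf : is_locally_finite A).
Context {n : nat} {P : 'I_n -> A} (Pgen : generating_projectives P).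
Context (H : functor A B) (Hr : right_exact H).

Definition minimal_pair Q X (x : hom (H X) Q) :=
  forall Y (f : hom Y X), x ∘ fmor H f = 0 -> f = 0.

(** A nonzero [f] with [x ∘ fmor H f = 0] is divided out: by right exactness of [H], [x] descends to
    the cokernel of [f], whose length is smaller. *)
Lemma minimal_quotient Q X (x : hom (H X) Q) : exists (X' : A) (q : hom X X') (x' : hom (H X') Q),
  minimal_pair x' /\ x = x' ∘ fmor H q.
Proof.
have [m] := ubnP (plen (P := P) X); elim: m X x => // m IH X x; rewrite ltnS => le.
have [|/existsNP [Y /existsNP [f /not_implyP [xf f0]]]] := EM (minimal_pair x).
  by exists X, (idm X), x; rewrite fmor1 compm1.
have [X1 [q kq]] := has_cokernels Aab f.
have [x1 x1q] := cokernel_desc (Hr kq) xf.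
have [|X' [q' [x' [x'm x1E]]]] := IH X1 x1.
  apply: leq_trans le; rewrite ltnNge; apply/negP => le.
  have qi := plen_epi_iso Aab Alf Pgen (cokernel_epi kq) le.
  by apply: f0; apply: (iso_mono qi); rewrite compm0 kq.1.
by exists X', (q' ∘ q), x'; split=> //; rewrite fmorM compA -x1E.
Qed.

Lemma minimal_pair_bound Q X (x : hom (H X) Q) : minimal_pair x ->
  (plen (P := P) X <= \sum_i hdim (H (P i)) Q)%N.
Proof.
move=> xm; apply: leq_sum => i _.
have xlin : linear (fun g : hom (P i) X => x ∘ fmor H g).
  by move=> a g h; rewrite fmor_lin comp_linr.
apply: (linear_inj_dim xlin) => g h gh.
by apply/subr0_eq/xm; rewrite fmorB compBr gh subrr.
Qed.

Lemma maximal_pair Q : exists (X : A) (x : hom (H X) Q), minimal_pair x /\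
  forall X' (x' : hom (H X') Q), minimal_pair x' -> (plen (P := P) X' <= plen (P := P) X)%N.
Proof.
pose b := (\sum_i hdim (H (P i)) Q)%N.
have [X0 X0z] := has_zero Aab.
have x0m : minimal_pair (0 : hom (H X0) Q) by move=> Y f _; apply: X0z.2.
have [m] := ubnP (b - plen (P := P) X0); elim: m X0 (0 : hom _ _) x0m {X0z} => // m IH X x xm.
rewrite ltnS => le.
have [|/existsNP [X' /existsNP [x' /not_implyP [x'm /negP]]]] := EM (forall X' (x' : hom (H X') Q),
    minimal_pair x' -> (plen (P := P) X' <= plen (P := P) X)%N); first by exists X, x.
rewrite -ltnNge => lt; apply: (IH X' x' x'm); apply: leq_trans le; apply: ltn_sub2l => //.
exact: leq_trans lt (minimal_pair_bound x'm).
Qed.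

Lemma terminal_pair Q : exists (X : A) (x : hom (H X) Q),
  (forall Y (y : hom (H Y) Q), exists h : hom Y X, x ∘ fmor H h = y) /\
  forall Y (h h' : hom Y X), x ∘ fmor H h = x ∘ fmor H h' -> h = h'.
Proof.
have [X [x [xm xmax]]] := maximal_pair Q; exists X, x; split=> [Y y|Y h h' e]; last first.
  by apply/subr0_eq/xm; rewrite fmorB compBr e subrr.
have [S [i1 [i2 [p1 [p2 [p1i1 p2i2 p1i2 p2i1 _]]]]]] := has_biproducts Aab X Y.
(* In the minimal quotient [Z] of the sum of [X] and [Y], the object [X] embeds because its pair is
   minimal, and fills [Z] because its length is maximal. The required map is then [Y -> Z ≅ X]. *)
have [Z [q [z [zm zq]]]] := minimal_quotient (x ∘ fmor H p1 + y ∘ fmor H p2).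
have zi1 : z ∘ fmor H (q ∘ i1) = x.
  by rewrite fmorM compA -zq compDl -!compA -!fmorM p1i1 p2i1 fmor0 fmor1 compm0 addr0 compm1.
have zi2 : z ∘ fmor H (q ∘ i2) = y.
  by rewrite fmorM compA -zq compDl -!compA -!fmorM p1i2 p2i2 fmor0 fmor1 compm0 add0r compm1.
have qm : is_mono (q ∘ i1).
  by apply/monoP => W f qf; apply: xm; rewrite -zi1 -compA -fmorM qf fmor0 compm0.
have qi := plen_mono_iso Aab Alf Pgen qm (xmax _ _ zm).
exists (inv qi ∘ (q ∘ i2)); rewrite -zi1 -compA -fmorM.
by rewrite (compA (q ∘ i1)) invKV comp1m.
Qed.

Theorem right_exact_has_right_adjoint : exists G : functor B A, inhabited (adjunction H G).
Proof.
pose t Q := cid (terminal_pair Q); pose t2 Q := cid (projT2 (t Q)).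
have univ Y X (g : hom (H X) Y) : exists h : hom X (projT1 (t Y)), projT1 (t2 Y) ∘ fmor H h = g.
  exact: (projT2 (t2 Y)).1.
have uniq Y X (h h' : hom X (projT1 (t Y))) :
    projT1 (t2 Y) ∘ fmor H h = projT1 (t2 Y) ∘ fmor H h' -> h = h'.
  exact: (projT2 (t2 Y)).2.
by exists (universal_functor univ uniq); split; exact: universal_adjunction.
Qed.

End AdjointFunctorTheorem.

(** * Fully faithful, essentially surjective functors *)

Section FullyFaithful.
Context {k : fieldType} {A B : lincat k} (F : functor A B).
Hypothesis Ffull : forall X Y (g : hom (F X) (F Y)), exists f : hom X Y, fmor F f = g.
Hypothesis Ffaith : faithful F.
Hypothesis Fsurj : forall Y : B, exists X : A, isomorphic (F X) Y.

Lemma fully_faithful_equivalence : is_equivalence F.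
Proof.
pose o Y := projT1 (cid (Fsurj Y)).
pose u Y := projT1 (cid (projT2 (cid (Fsurj Y)))).
have ui Y : is_iso (u Y : hom (F (o Y)) Y) by exact: projT2 (cid (projT2 (cid (Fsurj Y)))).
pose m X Y (g : hom X Y) := projT1 (cid (Ffull (inv (ui Y) ∘ g ∘ u X))).
have mE X Y (g : hom X Y) : fmor F (m X Y g) = inv (ui Y) ∘ g ∘ u X.
  exact: projT2 (cid (Ffull (inv (ui Y) ∘ g ∘ u X))).
have mlin X Y : linear (m X Y).
  by move=> a f g; apply: Ffaith; rewrite fmor_lin !mE comp_linr comp_linl.
have m1 X : m X X (idm X) = idm (o X).
  by apply: Ffaith; rewrite mE compm1 invK fmor1.
have mM X Y Z (g : hom Y Z) (f : hom X Y) : m _ _ (g ∘ f) = m _ _ g ∘ m _ _ f.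
  apply: Ffaith; rewrite fmorM !mE !compA; congr (_ ∘ _ ∘ _).
  by rewrite -(compA _ (u Y)) invKV compm1.
pose G := Functor mlin m1 mM; exists G; split.
  pose b X := projT1 (cid (Ffull (u (F X)))).
  have bE X : fmor F (b X) = u (F X) by exact: projT2 (cid (Ffull (u (F X)))).
  exists b; split=> [X Y f|X].
    by apply: Ffaith; rewrite /= !fmorM !bE mE !compA invKV comp1m.
  have [c cE] := Ffull (inv (ui (F X))); exists c.
  by split; apply: Ffaith; rewrite fmorM bE cE fmor1 (invK, invKV).
exists u; split=> // X Y f.
by rewrite /= mE !compA invKV comp1m.
Qed.

(** The definition of a module functor asks for left exactness, so equivalences must supply it too.
    Test objects may be taken in the image of [F], up to isomorphism. *)
Lemma fully_faithful_left_exact : left_exact F.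
Proof.
move=> X Y K f i ki; apply: is_kernelI; first by rewrite -fmorM ki.1 fmor0.
  apply/monoP => Z g ig; have [W [u ui]] := Fsurj Z.
  apply: (iso_epi ui); rewrite comp0m; have [h hE] := Ffull (g ∘ u); rewrite -hE.
  rewrite ((monoP i).1 (kernel_mono ki) _ h) ?fmor0 //.
  by apply: Ffaith; rewrite fmorM hE compA ig comp0m fmor0.
move=> Z g fg; have [W [u ui]] := Fsurj Z; have [h hE] := Ffull (g ∘ u).
have [|h' ih] := kernel_lift (g := h) ki.
  by apply: Ffaith; rewrite fmorM hE compA fg comp0m fmor0.
by exists (fmor F h' ∘ inv ui); rewrite compA -fmorM ih hE -compA invKV compm1.
Qed.

End FullyFaithful.

(** * Monoidal and module categories *)

Section Bifunctors.
Context {k : fieldType} {A B D : lincat k} (F : bifunctor A B D).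

Lemma bmor_iso X X' Y Y' (f : hom X X') (g : hom Y Y') :
  is_iso f -> is_iso g -> is_iso (bmor F f g).
Proof.
move=> [f' [f'f ff']] [g' [g'g gg']]; exists (bmor F f' g').
by rewrite -!bmorM f'f ff' g'g gg' !bmor1.
Qed.

Lemma bmor0l X X' Y Y' (g : hom Y Y') : bmor F (0 : hom X X') g = 0.
Proof.
by have := bmor_linl F g (-1) (0 : hom X X') 0; rewrite /= scaler0 addr0 => {1}->; rewrite scaleN1r addNr.
Qed.

Lemma bmor0r X X' Y Y' (f : hom X X') : bmor F f (0 : hom Y Y') = 0.
Proof.
by have := bmor_linr F f (-1) (0 : hom Y Y') 0; rewrite /= scaler0 addr0 => {1}->; rewrite scaleN1r addNr.
Qed.

Lemma bmorDl X X' Y Y' (f f' : hom X X') (g : hom Y Y') :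
  bmor F (f + f') g = bmor F f g + bmor F f' g.
Proof. by have := bmor_linl F g 1 f f'; rewrite /= !scale1r. Qed.

Lemma bmorDr X X' Y Y' (f : hom X X') (g g' : hom Y Y') :
  bmor F f (g + g') = bmor F f g + bmor F f g'.
Proof. by have := bmor_linr F f 1 g g'; rewrite /= !scale1r. Qed.

Lemma bmor_zero_ob2 X Y : is_zero_ob Y -> is_zero_ob (F X Y).
Proof. by move/zero_obP => Y0; apply/zero_obP; rewrite -bmor1 Y0 bmor0r. Qed.

End Bifunctors.

Section Monoidal.
Context {k : fieldType} (C : moncat k).

(** Naturality of [lunit] makes tensoring with the unit faithful. After tensoring, the identity
    follows from the pentagon and two triangles. *)
Lemma lunit_tens (X Y : C) : lunit (X ⊗ Y) ∘ assoc (munit C) X Y = lunit X ⊗m idm Y.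
Proof.
suff e : idm (munit C) ⊗m (lunit (X ⊗ Y) ∘ assoc (munit C) X Y)
    = idm (munit C) ⊗m (lunit X ⊗m idm Y).
  by apply: (iso_epi (lunit_iso _)); rewrite -!lunit_nat e.
apply: (iso_epi (assoc_iso _ _ _)).
apply: (iso_epi (bmor_iso _ (assoc_iso (munit C) (munit C) X) (idm_iso Y))).
rewrite bmor_compr -!compA (compA _ (assoc _ _ _) (assoc _ _ _ ⊗m _)) pentagon.
rewrite !compA triangle -(bmor1 (tens C) X Y) -assoc_nat -assoc_nat -!compA; congr (_ ∘ _).
by rewrite -bmorM triangle comp1m.
Qed.

Definition rev_tens : bifunctor C C C.
Proof.
exists (fun X Y => Y ⊗ X) (fun X X' Y Y' f g => g ⊗m f).
- by move=> X X' Y Y' g; apply: bmor_linr.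
- by move=> X X' Y Y' f; apply: bmor_linl.
- by move=> X Y; apply: bmor1.
- by move=> *; apply: bmorM.
Defined.

(* C with the opposite tensor product, so that statements about left actions
   also apply to the right multiplications of C. *)
Definition rev : moncat k.
Proof.
exists C rev_tens (munit C) (fun X Y Z => inv (assoc_iso Z Y X)) (@runit _ C) (@lunit _ C).
- move=> X X' Y Y' Z Z' f g h /=.
  apply: (iso_mono (assoc_iso _ _ _)); rewrite !compA invKV comp1m assoc_nat.
  by rewrite -compA invKV compm1.
- exact: runit_nat.
- exact: lunit_nat.
- by move=> X Y Z; apply: inv_iso.
- exact: runit_iso.
- exact: lunit_iso.
- move=> X Y Z W /=.
  apply: (iso_mono (assoc_iso _ _ _)); apply: (iso_mono (assoc_iso _ _ _)).
  rewrite [LHS]compA -pentagon !compA.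
  rewrite -(compA _ (assoc W Z Y ⊗m idm X)) -bmorM invKV comp1m bmor1 compm1.
  rewrite -(compA _ (assoc W (Z ⊗ Y) X)) invKV compm1 -bmorM invKV comp1m bmor1.
  by rewrite -(compA (assoc W Z (Y ⊗ X))) invKV compm1 invKV.
- move=> X Y /=; apply: (iso_epi (assoc_iso _ _ _)).
  by rewrite -compA invK compm1 triangle.
Defined.

Definition reg : lax_modcat C.
Proof.
exists C (tens C) (fun X Y M => assoc X Y M) (fun M => lunit M).
- by move=> *; apply: assoc_nat.
- by move=> *; apply: lunit_nat.
- by move=> *; apply: pentagon.
- by move=> *; apply: triangle.
- by move=> *; apply: lunit_tens.
Defined.

Lemma rev_left_dual (X X' : C) (ev : hom (X' ⊗ X) (munit C)) (coev : hom (munit C) (X ⊗ X')) :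
  is_left_dual ev coev -> is_left_dual (C := rev) (X := X') (X' := X) ev coev.
Proof.
move=> [z1 z2]; split=> /=; first by apply: z2; apply: invKV.
move=> a aE; rewrite -z1; congr (_ ∘ _ ∘ _).
by apply: (iso_mono (inv_iso (assoc_iso X X' X))); rewrite invK.
Qed.

End Monoidal.

Section ModuleDuality.
Context {k : fieldType} {V : moncat k} {M : lax_modcat V}.
Hypothesis Hm : forall (X Y : V) (P : M), is_iso (act_m X Y P).
Hypothesis Hl : forall P : M, is_iso (act_l P).

Section Pair.
Context (X X' : V) (ev : hom (X' ⊗ X) (munit V)) (coev : hom (munit V) (X ⊗ X')).

(* Locked, because rewriting with [compA] would otherwise see through the definition. *)
Definition dual_unit (W : M) : hom W (X ⊳ (X' ⊳ W)) :=
  locked (act_m X X' W ∘ (coev ⊳m idm W) ∘ inv (Hl W)).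

Definition dual_counit (W : M) : hom (X' ⊳ (X ⊳ W)) W :=
  locked (act_l W ∘ (ev ⊳m idm W) ∘ inv (Hm X' X W)).

Lemma dual_unitE W : dual_unit W = act_m X X' W ∘ (coev ⊳m idm W) ∘ inv (Hl W).
Proof. by rewrite /dual_unit -lock. Qed.

Lemma dual_counitE W : dual_counit W = act_l W ∘ (ev ⊳m idm W) ∘ inv (Hm X' X W).
Proof. by rewrite /dual_counit -lock. Qed.

Lemma dual_unit_nat (W W' : M) (f : hom W W') :
  dual_unit W' ∘ f = (idm X ⊳m (idm X' ⊳m f)) ∘ dual_unit W.
Proof.
rewrite !dual_unitE !compA -act_m_nat bmor1 -[in RHS](compA (act_m _ _ _)) -bmorM compm1 comp1m.
apply: (iso_epi (Hl W)); rewrite -!compA invK compm1 -act_l_nat (compA (inv _)) invK comp1m.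
by rewrite -bmorM compm1 comp1m.
Qed.

Lemma dual_counit_nat (W W' : M) (f : hom W W') :
  dual_counit W' ∘ (idm X' ⊳m (idm X ⊳m f)) = f ∘ dual_counit W.
Proof.
rewrite !dual_counitE !compA -act_l_nat -[in RHS](compA (act_l _)) -bmorM comp1m compm1.
apply: (iso_epi (Hm X' X W)); rewrite -!compA invK compm1 -act_m_nat (compA (inv (Hm _ _ _))) invK comp1m.
by rewrite bmor1 -bmorM compm1 comp1m.
Qed.

Hypothesis dual : is_left_dual ev coev.

Lemma dual_tri2 W : (idm X ⊳m dual_counit W) ∘ dual_unit (X ⊳ W) = idm (X ⊳ W).
Proof.
have ei : is_iso (act_l (X ⊳ W) ∘ act_m (munit V) X W) by apply: comp_iso.
apply: (iso_epi ei); rewrite comp1m [RHS]act_lunit !dual_unitE -!compA (compA (inv _)) invK comp1m.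
rewrite -(bmor1 (act M) X W) -act_m_nat (compA (act_m X X' _)) -act_pentagon.
rewrite !dual_counitE bmor_compr -!compA.
rewrite (compA (idm X ⊳m inv _) (idm X ⊳m _)) -bmorM invK comp1m bmor1 comp1m.
rewrite bmor_compr -!compA (compA (idm X ⊳m (ev ⊳m _))) -act_m_nat -!bmorM.
rewrite -compA -bmorM compA act_runit -bmorM !compm1.
by rewrite !compA dual.1.
Qed.

Lemma dual_tri1 W : dual_counit (X' ⊳ W) ∘ (idm X' ⊳m dual_unit W) = idm (X' ⊳ W).
Proof.
have ei : is_iso ((idm X' ⊳m act_l W) ∘ act_m X' (munit V) W).
  by apply: comp_iso => //; apply: bmor_iso => //; apply: idm_iso.
apply: (iso_epi ei); rewrite comp1m [RHS]act_runit !dual_unitE compA.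
rewrite -(compA (dual_counit _)) -bmorM comp1m -!compA invK compm1.
rewrite bmor_compr -!compA -act_m_nat !dual_counitE.
have := act_pentagon X' X X' W; set a := assoc _ _ _ => pent.
have {}pent : (idm X' ⊳m act_m X X' W) ∘ act_m X' (X ⊗ X') W
    = act_m X' X (X' ⊳ W) ∘ act_m (X' ⊗ X) X' W ∘ (inv (assoc_iso X' X X') ⊳m idm W).
  by rewrite -pent -!compA -bmorM invKV comp1m bmor1 compm1.
rewrite (compA (idm X' ⊳m act_m _ _ _)) pent -!compA (compA (inv _)) invK comp1m.
rewrite (compA (ev ⊳m _)) -(bmor1 (act M) X' W) -act_m_nat -!compA (compA (act_l _)) act_lunit.
by rewrite -!bmorM !comp1m !compA (dual.2 _ (invKV _)).
Qed.

Definition dual_adjunction : adjunction (bfix1 (act M) X') (bfix1 (act M) X).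
Proof.
exists dual_unit dual_counit.
- exact: dual_unit_nat.
- exact: dual_counit_nat.
- exact: dual_tri1.
- exact: dual_tri2.
Defined.

End Pair.

(** The hypothesis says that [u'] is the transpose of [u]. *)
Lemma dual_counit_dinat (X1 X1' X2 X2' : V)
    (ev1 : hom (X1' ⊗ X1) (munit V)) (ev2 : hom (X2' ⊗ X2) (munit V))
    (u : hom X1 X2) (u' : hom X2' X1') (W : M) :
  ev1 ∘ (u' ⊗m idm X1) = ev2 ∘ (idm X2' ⊗m u) ->
  dual_counit ev1 W ∘ (u' ⊳m idm (X1 ⊳ W)) = dual_counit ev2 W ∘ (idm X2' ⊳m (u ⊳m idm W)).
Proof.
move=> e; apply: (iso_epi (Hm X2' X1 W)); rewrite !dual_counitE -!compA.
rewrite -(bmor1 (act M) X1 W) -act_m_nat -act_m_nat !(compA (inv _) (act_m _ _ _)) !invK !comp1m.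
by rewrite -!bmorM e.
Qed.

End ModuleDuality.

Section LaxFunctorDuality.
Context {k : fieldType} {V : moncat k} {M N : lax_modcat V}.
Hypothesis Mm : forall (X Y : V) (P : M), is_iso (act_m X Y P).
Hypothesis Ml : forall P : M, is_iso (act_l P).
Hypothesis Nm : forall (X Y : V) (P : N), is_iso (act_m X Y P).
Hypothesis Nl : forall P : N, is_iso (act_l P).
Context (F : functor M N) (d : forall (X : V) (P : M), hom (X ⊳ F P) (F (X ⊳ P))).
Hypothesis d_nat : forall (X Y : V) (P Q : M) (f : hom X Y) (g : hom P Q),
  d Y Q ∘ (f ⊳m fmor F g) = fmor F (f ⊳m g) ∘ d X P.
Hypothesis d_m : forall (X Y : V) (P : M),
  fmor F (act_m X Y P) ∘ d (X ⊗ Y) P = d X (Y ⊳ P) ∘ (idm X ⊳m d Y P) ∘ act_m X Y (F P).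
Hypothesis d_l : forall P : M, fmor F (act_l P) ∘ d (munit V) P = act_l (F P).

(** A lax module functor is strong at dualizable objects. The inverse of [d X P] is the mate of
    [d X']: the unit of the duality at [F (X ⊳ P)], then [d X'], then the counit inside [F]. *)
Lemma lax_functor_strong (X X' : V)
    (ev : hom (X' ⊗ X) (munit V)) (coev : hom (munit V) (X ⊗ X')) (P : M) :
  is_left_dual ev coev -> is_iso (d X P).
Proof.
move=> dual.
have d_unit (R : M) : d X (X' ⊳ R) ∘ (idm X ⊳m d X' R) ∘ dual_unit Nl coev (F R)
    = fmor F (dual_unit Ml coev R).
  rewrite !dual_unitE !compA -d_m !fmorM -!compA; congr (_ ∘ _).
  rewrite compA -(fmor1 F) d_nat -compA; congr (_ ∘ _).
  apply: (iso_mono (fmor_iso F (Ml R))).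
  by rewrite compA d_l invKV -fmorM invKV fmor1.
have d_counit : fmor F (dual_counit Mm ev P) ∘ d X' (X ⊳ P) ∘ (idm X' ⊳m d X P)
    = dual_counit Nm ev (F P).
  apply: (iso_epi (Nm X' X (F P))); rewrite -!compA (compA (d _ _)) -d_m compA -fmorM.
  rewrite !dual_counitE -!compA invK !compm1 fmorM -compA -d_nat fmor1.
  by rewrite compA d_l invK compm1.
exists ((idm X ⊳m fmor F (dual_counit Mm ev P)) ∘ (idm X ⊳m d X' (X ⊳ P))
  ∘ dual_unit Nl coev (F (X ⊳ P))); split.
  rewrite -[LHS]compA dual_unit_nat -(compA (idm X ⊳m _)) (compA (idm X ⊳m d _ _)) -bmorM comp1m.
  rewrite compA -bmorM comp1m compA d_counit.
  exact: (dual_tri2 Nm Nl dual).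
rewrite !compA d_nat -!compA (compA (d _ _)) d_unit -fmorM.
by rewrite (dual_tri2 Mm Ml dual) fmor1.
Qed.

End LaxFunctorDuality.

(** * Tensor categories *)

Section TensorCategory.
Context {k : fieldType} {C : moncat k}.

Lemma lunit_runit1 : lunit (munit C) = runit (munit C).
Proof.
suff e : lunit (munit C) ⊗m idm (munit C) = runit (munit C) ⊗m idm (munit C).
  by apply: (iso_epi (runit_iso _)); rewrite -!runit_nat e.
rewrite -lunit_tens -triangle; congr (_ ∘ _).
by apply: (iso_mono (lunit_iso _)); rewrite lunit_nat.
Qed.

Definition left_mul_adjunction (X X' : C) (ev : hom (X' ⊗ X) (munit C))
    (coev : hom (munit C) (X ⊗ X')) (dual : is_left_dual ev coev) :
  adjunction (bfix1 (tens C) X') (bfix1 (tens C) X) :=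
  dual_adjunction (M := reg C) (@assoc_iso _ C) (@lunit_iso _ C) dual.

(** The functors coming from [rev C] agree with these on objects and morphisms, which is all that
    the fields involve; so the adjunction is repacked field by field. *)
Definition right_mul_adjunction (X X' : C) (ev : hom (X' ⊗ X) (munit C))
    (coev : hom (munit C) (X ⊗ X')) (dual : is_left_dual ev coev) :
  adjunction (bfix2 (tens C) X) (bfix2 (tens C) X') :=
  let a := dual_adjunction (M := reg (rev C)) (@assoc_iso _ (rev C))
    (@lunit_iso _ (rev C)) (rev_left_dual dual) in
  Adjunction (L := bfix2 (tens C) X) (R := bfix2 (tens C) X')
    (aunit_nat a) (acounit_nat a) (atri1 a) (atri2 a).

Lemma right_mul_counitE (X X' : C) (ev : hom (X' ⊗ X) (munit C))
    (coev : hom (munit C) (X ⊗ X')) (dual : is_left_dual ev coev) W :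
  acounit (right_mul_adjunction dual) W = runit W ∘ (idm W ⊗m ev) ∘ assoc W X' X.
Proof.
apply: etrans (dual_counitE (M := reg (rev C)) (@assoc_iso _ (rev C)) ev W) _.
rewrite /=; congr (_ ∘ _).
by apply: (iso_epi (inv_iso (assoc_iso W X' X))); rewrite invK invKV.
Qed.

Lemma right_mul_counit_dinat (A A' B B' : C)
    (evA : hom (A' ⊗ A) (munit C)) (coevA : hom (munit C) (A ⊗ A')) (dA : is_left_dual evA coevA)
    (evB : hom (B' ⊗ B) (munit C)) (coevB : hom (munit C) (B ⊗ B')) (dB : is_left_dual evB coevB)
    (j : hom A B) (j' : hom B' A') W :
  evA ∘ (j' ⊗m idm A) = evB ∘ (idm B' ⊗m j) ->
  acounit (right_mul_adjunction dB) W ∘ (idm (W ⊗ B') ⊗m j)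
  = acounit (right_mul_adjunction dA) W ∘ ((idm W ⊗m j') ⊗m idm A).
Proof.
move=> e; exact: (dual_counit_dinat (M := reg (rev C)) (@assoc_iso _ (rev C))
  (ev1 := evB) (ev2 := evA) (u := j') (u' := j) W (esym e)).
Qed.

Lemma ev_right_mul_counit (X X' : C) (ev : hom (X' ⊗ X) (munit C))
    (coev : hom (munit C) (X ⊗ X')) (d : is_left_dual ev coev) :
  ev ∘ (lunit X' ⊗m idm X) = acounit (right_mul_adjunction d) (munit C).
Proof.
rewrite right_mul_counitE -lunit_tens compA; congr (_ ∘ _).
by rewrite -lunit_nat lunit_runit1.
Qed.

Lemma ev_mate (X X' W : C) (ev : hom (X' ⊗ X) (munit C))
    (coev : hom (munit C) (X ⊗ X')) (d : is_left_dual ev coev) (g : hom (W ⊗ X) (munit C)) :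
  exists f : hom W X', ev ∘ (f ⊗m idm X) = g.
Proof.
exists (lunit X' ∘ radj (right_mul_adjunction d) g); rewrite bmor_compl compA.
by rewrite (ev_right_mul_counit d); apply: (radjK (right_mul_adjunction d)).
Qed.

Lemma ev_mate_inj (X X' W : C) (ev : hom (X' ⊗ X) (munit C))
    (coev : hom (munit C) (X ⊗ X')) (d : is_left_dual ev coev) (f g : hom W X') :
  ev ∘ (f ⊗m idm X) = ev ∘ (g ⊗m idm X) -> f = g.
Proof.
have e (h : hom W X') : lunit X' ∘ (inv (lunit_iso X') ∘ h) = h by rewrite compA invKV comp1m.
move=> fg; rewrite -(e f) -(e g); congr (_ ∘ _).
apply: (ladj_inj (adj := right_mul_adjunction d)).
by rewrite -(ev_right_mul_counit d) /= -!compA -!bmor_compl !e.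
Qed.

Hypothesis (Cab : is_abelian C) (Crig : is_rigid C).

(** [X ⊗ -] has an adjoint on each side, one for each of the two duals of [X]. *)
Lemma left_mul_exact (X : C) : exact_functor (bfix1 (tens C) X).
Proof.
split.
  have [X' [ev [coev d]]] := Crig.1 X.
  exact: (right_adjoint_left_exact (left_mul_adjunction d)).
have [X' [ev [coev d]]] := Crig.2 X.
exact: (left_adjoint_right_exact (left_mul_adjunction d)).
Qed.

Lemma right_mul_exact (X : C) : exact_functor (bfix2 (tens C) X).
Proof.
split.
  have [X' [ev [coev d]]] := Crig.2 X.
  exact: (right_adjoint_left_exact (right_mul_adjunction d)).
have [X' [ev [coev d]]] := Crig.1 X.
exact: (left_adjoint_right_exact (right_mul_adjunction d)).
Qed.

Lemma left_mul_mono (X : C) (Y Z : C) (f : hom Y Z) : is_mono f -> is_mono (idm X ⊗m f).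
Proof. exact: (left_exact_mono Cab (left_mul_exact X).1). Qed.

Lemma left_mul_epi (X : C) (Y Z : C) (f : hom Y Z) : is_epi f -> is_epi (idm X ⊗m f).
Proof. exact: (right_exact_epi Cab (left_mul_exact X).2). Qed.

Lemma right_mul_mono (X : C) (Y Z : C) (f : hom Y Z) : is_mono f -> is_mono (f ⊗m idm X).
Proof. exact: (left_exact_mono Cab (right_mul_exact X).1). Qed.

Lemma right_mul_epi (X : C) (Y Z : C) (f : hom Y Z) : is_epi f -> is_epi (f ⊗m idm X).
Proof. exact: (right_exact_epi Cab (right_mul_exact X).2). Qed.

Lemma projective_tensl (P X : C) : is_projective P -> is_projective (P ⊗ X).
Proof.
have [X' [ev [coev d]]] := Crig.1 X.
apply: (left_adjoint_projective (right_mul_adjunction d)) => Y Z f.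
exact: right_mul_epi.
Qed.

(** If [h ∘ j' = 0], the mate [1 -> A ⊗ E] of [h] becomes zero after [j ⊗ E], because that composite
    is the mate of [h ∘ j']. Since [j ⊗ E] is mono, [h] vanishes. The extra factor [munit C] of [E]
    avoids unitors in the adjunctions. *)
Lemma transpose_epi (A A' B B' : C)
    (evA : hom (A' ⊗ A) (munit C)) (coevA : hom (munit C) (A ⊗ A')) (dA : is_left_dual evA coevA)
    (evB : hom (B' ⊗ B) (munit C)) (coevB : hom (munit C) (B ⊗ B')) (dB : is_left_dual evB coevB)
    (j : hom A B) (j' : hom B' A') :
  evA ∘ (j' ⊗m idm A) = evB ∘ (idm B' ⊗m j) -> is_mono j -> is_epi j'.
Proof.
move=> e jm; apply/epiP => E h hj'.
pose aA := left_mul_adjunction dA; pose aB := left_mul_adjunction dB.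
pose phi := h ⊗m idm (munit C); pose u := radj aA (phi : hom (bfix1 (tens C) A' (munit C)) _).
have u0 : u = 0.
  apply: (right_mul_mono (X := E ⊗ munit C) jm); rewrite compm0.
  apply: (ladj_inj (adj := aB)); rewrite fmor0 compm0 fmorM compA /=.
  have := dual_counit_dinat (M := reg C) (@assoc_iso _ C) (E ⊗ munit C) e => /= <-.
  rewrite -compA -bmorM comp1m compm1 -(compm1 u) -(comp1m j') bmorM compA.
  have /= := radjK aA phi; rewrite /ladj /= -/u => ->.
  by rewrite -bmorM hj' bmor0l.
apply: (iso_epi (runit_iso _)); rewrite -!runit_nat bmor0l compm0.
rewrite -/phi; have <- := radjK aA (phi : hom (bfix1 (tens C) A' (munit C)) _).
by rewrite /ladj -/u u0 fmor0 !compm0.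
Qed.

(* The retraction is the mate of a lift of the unit Q -> (Q ⊗ A) ⊗ A' along
   the epimorphism (Q ⊗ A) ⊗ j'. *)
Lemma projective_tens_split (Q A B : C) (j : hom A B) : is_projective Q -> is_mono j ->
  exists r : hom (Q ⊗ B) (Q ⊗ A), r ∘ (idm Q ⊗m j) = idm (Q ⊗ A).
Proof.
move=> Qp jm; have [A' [evA [coevA dA]]] := Crig.1 A; have [B' [evB [coevB dB]]] := Crig.1 B.
have [j' j'E] := ev_mate dA (evB ∘ (idm B' ⊗m j)).
have [t tE] := Qp _ _ _ (aunit (right_mul_adjunction dA) Q)
  (left_mul_epi (X := Q ⊗ A) (transpose_epi dA dB j'E jm)).
exists (acounit (right_mul_adjunction dB) (Q ⊗ A) ∘ (t ⊗m idm B)).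
rewrite -compA -bmorM comp1m compm1 -(compm1 j) -(comp1m t) bmorM compA.
rewrite (right_mul_counit_dinat dA dB _ j'E) -compA -bmorM tE compm1.
exact: (atri1 (right_mul_adjunction dA)).
Qed.

(** By the zigzag identity [Q] is a retract of [Q ⊗ (Q' ⊗ Q)]. The retraction of [j] goes from [B]
    to [Q ⊗ (Q' ⊗ B)] by the unit, back along a splitting of [Q ⊗ (Q' ⊗ j)], and ends with [ev]. *)
Lemma projective_injective (Q B : C) (j : hom Q B) : is_projective Q -> is_mono j ->
  exists r : hom B Q, r ∘ j = idm Q.
Proof.
move=> Qp jm; have [Q' [ev [coev d]]] := Crig.1 Q.
have [s sE] := projective_tens_split Qp (left_mul_mono (X := Q') jm).
pose a := left_mul_adjunction d.
exists (runit Q ∘ (idm Q ⊗m ev) ∘ s ∘ aunit a B).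
rewrite -!compA; have /= -> := aunit_nat a j; rewrite (compA s) sE comp1m.
have -> := dual_unitE (M := reg C) (@lunit_iso _ C) coev Q.
rewrite /=; apply: (iso_epi (lunit_iso Q)); rewrite -!compA invK compm1 comp1m.
by rewrite !compA d.1.
Qed.

End TensorCategory.

(** * Exactness of Hopf monads *)

Lemma fmor_biproduct (k : fieldType) (A B : lincat k) (F : functor A B) (X Y S : A)
    (i1 : hom X S) (i2 : hom Y S) (p1 : hom S X) (p2 : hom S Y) :
  is_biproduct i1 i2 p1 p2 -> is_biproduct (fmor F i1) (fmor F i2) (fmor F p1) (fmor F p2).
Proof.
move=> [e1 e2 e3 e4 e5].
by split; rewrite -!fmorM ?e1 ?e2 ?e3 ?e4 ?fmor0 ?fmor1 -?fmorD ?e5 ?fmor1.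
Qed.

Lemma split_mono_biproduct (k : fieldType) (A : lincat k) (X Y : A) (j : hom X Y) (r : hom Y X) :
  is_abelian A -> r ∘ j = idm X ->
  exists (Z : A) (i : hom Z Y) (p : hom Y Z), is_biproduct j i r p.
Proof.
move=> Aab rj; have [Z [i ki]] := has_kernels Aab r.
have [|p ip] := kernel_lift (g := idm Y - j ∘ r) ki.
  by rewrite compBr compA rj comp1m compm1 subrr.
have im := kernel_mono ki.
exists Z, i, p; split=> //; last by rewrite ip addrC subrK.
- by apply: im; rewrite compA ip compBl -compA ki.1 compm0 subr0 comp1m compm1.
- exact: ki.1.
- by apply: im; rewrite compA ip compBl -compA rj comp1m compm1 subrr compm0.
Qed.

Section TensorPowers.
Context {k : fieldType} {C : moncat k} (Y : C).

(* (Y ⊗ -) iterated m times; [opow] unfolds from the outside, [lpow] from the inside. *)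
Fixpoint lpow m : functor C C :=
  if m is m'.+1 then fcomp (lpow m') (bfix1 (tens C) Y) else fid C.

Fixpoint opow m : functor C C :=
  if m is m'.+1 then fcomp (bfix1 (tens C) Y) (opow m') else fid C.

Lemma lpow_tens m (W X : C) : exists f : hom (lpow m W ⊗ X) (lpow m (W ⊗ X)), is_iso f.
Proof.
elim: m W => [|m IH] W /=; first by exists (idm _); apply: idm_iso.
have [f fi] := IH (Y ⊗ W); exists (fmor (lpow m) (assoc Y W X) ∘ f).
exact: comp_iso (fmor_iso _ (assoc_iso _ _ _)) fi.
Qed.

Lemma opow_tens m (W X : C) : exists f : hom (opow m W ⊗ X) (opow m (W ⊗ X)), is_iso f.
Proof.
elim: m => [|m [f fi]] /=; first by exists (idm _); apply: idm_iso.
exists ((idm Y ⊗m f) ∘ assoc Y (opow m W) X).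
exact: comp_iso (bmor_iso _ (idm_iso _) fi) (assoc_iso _ _ _).
Qed.

Hypothesis (Cab : is_abelian C) (Crig : is_rigid C).

Lemma opow_mono m (W X : C) (f : hom W X) : is_mono f -> is_mono (fmor (opow m) f).
Proof. by move=> fm; elim: m => //= m IH; apply: left_mul_mono. Qed.

Lemma lpow_epi m (W X : C) (f : hom W X) : is_epi f -> is_epi (fmor (lpow m) f).
Proof. by elim: m W X f => //= m IH W X f fe; apply/IH/left_mul_epi. Qed.

End TensorPowers.

(* If T i is not mono for some mono i, let V be its kernel. Put Y = T Q with Q a projective
   covering the unit; Y = Q ⊕ Z since Q embeds into T Q and is injective. The fusion
   operators give T (Y^n ⊗ i) = Y^n ⊗ T i, and projective summands of Y^n do not
   contribute to its kernel Y^n ⊗ V, so the length of Y^n is at most a constant times that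
   of Z^n. On the other hand it is at least n times the length of Z^(n-1). *)
Section HopfMonadExact.
Context {k : fieldType} {C : moncat k} (T : hopf_monad C).
Hypothesis (Cft : is_finite_tensor_category C) (Tr : right_exact T) (Tf : faithful T).

Let Cab : is_abelian C := let: conj (And5 h _ _ _ _) _ := Cft in h.
Let Crig : is_rigid C := let: conj (And5 _ h _ _ _) _ := Cft in h.
Let Clf : is_locally_finite C := let: conj (And5 _ _ h _ _) _ := Cft in h.
Let C1 : is_simple (munit C) := let: conj (And5 _ _ _ h _) _ := Cft in h.

(** [fmor T] of the unit is split by the multiplication, and a faithful functor reflects the
    vanishing of [g]. *)
Lemma hopf_eta_mono X : is_mono (monad_eta T X).
Proof.
apply/monoP => Z g eg; apply: Tf; rewrite fmor0 -(comp1m (fmor T g)) -(monad_mu1r T X).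
by rewrite -compA -fmorM eg fmor0 compm0.
Qed.

Section Growth.
Context {n : nat} {P : 'I_n -> C} (Pgen : generating_projectives P).
Context {Q Z : C} (iQ : hom Q (T Q)) (iZ : hom Z (T Q)) (pQ : hom (T Q) Q) (pZ : hom (T Q) Z).
Hypothesis (YQZ : is_biproduct iQ iZ pQ pZ).
Hypothesis (Qp : is_projective Q) (q : hom Q (munit C)) (qe : is_epi q).
Local Notation Y := (T Q).
Local Notation plen := (plen (P := P)).

Lemma plen_lpow_step m W :
  plen (lpow Z m (Y ⊗ W)) = (plen (lpow Z m (Q ⊗ W)) + plen (lpow Z m.+1 W))%N.
Proof. exact: plen_biproduct (fmor_biproduct (lpow Z m) (fmor_biproduct (bfix2 (tens C) W) YQZ)). Qed.

(** From each of the [r] factors [Y] keep only the summand [Z]. *)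
Lemma plen_lpow_opow r m : (plen (lpow Z (m + r) (munit C)) <= plen (lpow Z m (opow Y r (munit C))))%N.
Proof.
elim: r m => [|r IH] m; first by rewrite addn0.
by rewrite -addSnnS plen_lpow_step; apply: leq_trans (IH m.+1) _; rewrite leq_addl.
Qed.

Lemma plen_lpow_Q m W : (plen (lpow Z m W) <= plen (lpow Z m (Q ⊗ W)))%N.
Proof.
have e : is_epi (lunit W ∘ (q ⊗m idm W)).
  exact: epi_comp (iso_epi (lunit_iso W)) (right_mul_epi Cab Crig qe).
exact: (plen_epi Cab Pgen (lpow_epi Cab Crig (m := m) e)).
Qed.

(** The factors [Y] are split one after another. The summand [Q] of the current factor covers the
    unit, so the other factors alone already contribute the length of [lpow Z N]; the summand [Z] is
    carried on to the next step. *)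
Lemma plen_opow_lower r m N : (m + r)%N = N.+1 ->
  (r * plen (lpow Z N (munit C)) <= plen (lpow Z m (opow Y r (munit C))))%N.
Proof.
elim: r m => [|r IH] m // mrN.
rewrite plen_lpow_step mulSn; apply: leq_add; last by apply: IH; rewrite -mrN addSnnS.
apply: leq_trans (plen_lpow_Q _ _); apply: leq_trans (plen_lpow_opow _ _).
by move: mrN; rewrite addnS => - [->].
Qed.

Lemma plen_opow_gt0 r : (0 < plen (opow Y r (munit C)))%N.
Proof.
elim: r => [|r IH].
  by rewrite lt0n; apply/eqP => /(plen_eq0 Cab Clf Pgen); apply: C1.1.
have := plen_lpow_step 0 (opow Y r (munit C)) => /= ->.
by apply: leq_trans IH _; apply: leq_trans (plen_lpow_Q 0 _) (leq_addr _ _).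
Qed.

Context {X X' : C} (i : hom X' X) (im : is_mono i).

(** [Q ⊗ j] is a split mono, so it stays mono under [lpow Z m] and [T], and the [Q]-component of [a]
    vanishes. Thus [A] still embeds after the projection [pZ], which trades one [Y] for one [Z]. *)
Lemma kernel_opow_bound r m A (a : hom A (T (lpow Z m (opow Y r X')))) : is_mono a ->
  fmor T (fmor (lpow Z m) (fmor (opow Y r) i)) ∘ a = 0 ->
  (plen A <= plen (T (lpow Z (m + r) X')))%N.
Proof.
elim: r m A a => [|r IH] m A a am ia; first by rewrite addn0; apply: plen_mono am.
pose W' := opow Y r X'; pose j : hom W' _ := fmor (opow Y r) i.
pose b : hom A (T (lpow Z m.+1 W')) := fmor T (fmor (lpow Z m) (pZ ⊗m idm W')) ∘ a.
rewrite -addSnnS; apply: (IH _ _ b).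
  apply/monoP => B f bf.
  have Qf : fmor T (fmor (lpow Z m) (pQ ⊗m idm W')) ∘ (a ∘ f) = 0.
    have [s sE] := projective_tens_split Cab Crig Qp (opow_mono Cab Crig (m := r) im : is_mono j).
    have /split_mono /monoP : fmor T (fmor (lpow Z m) s) ∘ fmor T (fmor (lpow Z m) (idm Q ⊗m j)) = idm _.
      by rewrite -!fmorM sE !fmor1.
    apply; rewrite compA -!fmorM -bmorM comp1m compm1.
    rewrite -(compm1 pQ) -(comp1m j) bmorM !fmorM -!compA (compA _ a f) ia comp0m.
    by rewrite compm0.
  apply: ((monoP a).1 am); have [_ _ _ _ e] := YQZ.
  rewrite -[LHS]comp1m -(fmor1 T) -(fmor1 (lpow Z m)) -[idm (Y ⊗ W')]bmor1 -e.
  have -> : (iQ ∘ pQ + iZ ∘ pZ) ⊗m idm W'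
      = (iQ ⊗m idm W') ∘ (pQ ⊗m idm W') + (iZ ⊗m idm W') ∘ (pZ ⊗m idm W').
    by rewrite bmorDl -!bmorM comp1m.
  rewrite !fmorD !fmorM compDl -!compA Qf compm0 add0r.
  by rewrite [X in _ ∘ X](compA _ a f) bf compm0.
rewrite /b /= compA -!fmorM -bmorM comp1m compm1.
rewrite -(compm1 pZ) -(comp1m (fmor _ i)) bmorM !fmorM -!compA ia.
by rewrite compm0.
Qed.

End Growth.

(** Here the form [T Q] of [Y] matters: the right fusion operator is an isomorphism
    [T (T Q ⊗ W) ≅ T Q ⊗ T W], natural in [W], and can be iterated. *)
Lemma fusion_opow Q r : exists phi : forall W, hom (opow (T Q) r (T W)) (T (opow (T Q) r W)),
  (forall W, is_iso (phi W)) /\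
  forall W W' (f : hom W W'),
    fmor T (fmor (opow (T Q) r) f) ∘ phi W = phi W' ∘ fmor (opow (T Q) r) (fmor T f).
Proof.
elim: r => [|r [phi [phi_iso phi_nat]]].
  exists (fun W => idm (T W)); split=> [W|W W' f]; first exact: idm_iso.
  by rewrite /= comp1m compm1.
exists (fun W => inv (hopf_fusionr T Q (opow (T Q) r W)) ∘ (idm _ ⊗m phi W)); split=> [W|W W' f].
  exact: comp_iso (inv_iso _) (bmor_iso _ (idm_iso _) (phi_iso W)).
rewrite /= -[RHS]compA -bmorM comp1m -phi_nat -(comp1m (idm (T Q))) bmorM.
rewrite comp1m compA [RHS]compA; congr (_ ∘ _).
apply: (iso_mono (hopf_fusionr T Q (opow (T Q) r W'))); rewrite [RHS]compA invKV comp1m.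
apply: (iso_epi (hopf_fusionr T Q (opow (T Q) r W))).
rewrite -!compA invK compm1 hopf_xi_nat fmor1 !compA -!bmorM !comp1m !compm1.
by [].
Qed.

Lemma hopf_monad_mono (X X' : C) (i : hom X' X) : is_mono i -> is_mono (fmor T i).
Proof.
move=> im; have [n [P Pgen]] := finite_cat_generators Cft.2.
pose l := plen (P := P).
have [V [v kv]] := has_kernels Cab (fmor T i).
apply/(kernel_zeroP kv); apply: contrapT => V0.
have [Q [q [Qp qe]]] := enough_projectives Cab Clf Pgen (munit C).
have [r0 r0E] := projective_injective Cab Crig Qp (hopf_eta_mono (X := Q)).
have [Z [iZ [pZ QZ]]] := split_mono_biproduct Cab r0E.
have [V' [ev [coev d]]] := Crig.1 V.
(* The unit is simple, and [coev = 0] would make [V] zero by the zigzag identity. *)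
have coev_mono : is_mono coev.
  apply: (simple_mono Cab C1) => coev0; apply/V0/zero_obP/(iso_epi (lunit_iso V)).
  by rewrite comp1m comp0m -d.1 coev0 bmor0l !compm0.
have [cV HV] := right_exact_growth Cab Clf Pgen (right_mul_exact Crig V').2.
have [cT HT] := right_exact_growth Cab Clf Pgen Tr.
have growth W : exists c, forall r, (l (lpow Z r W) <= c * l (lpow Z r (munit C)))%N.
  have [c Hc] := right_exact_growth Cab Clf Pgen (right_mul_exact Crig W).2.
  exists c => r; apply: leq_trans (Hc _) => /=.
  have [f fi] := lpow_tens Z r (munit C) W; rewrite [plen _](plen_iso Cab Pgen fi).
  apply: eq_leq; apply: (plen_iso Cab Pgen).
  exact: (fmor_iso (lpow Z r) (inv_iso (lunit_iso W))).
have [cX HX] := growth X'; have [cZ HZ] := growth (Z ⊗ munit C).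
(* [coev] embeds [Y^r] into [Y^r ⊗ V ⊗ V']. Through the fusion isomorphisms [Y^r ⊗ V] becomes a
   subobject of [T (Y^r ⊗ X')] killed by [T (Y^r ⊗ i)], to which the kernel bound applies. *)
have upper r : (l (opow (T Q) r (munit C)) <= cV * (cT * (cX * l (lpow Z r (munit C)))))%N.
  have [f fi] := opow_tens (T Q) r V V'.
  apply: leq_trans (plen_mono (opow_mono Cab Crig (m := r) coev_mono)) _.
  rewrite -(plen_iso Cab Pgen fi); apply: leq_trans (HV _) _; rewrite leq_mul2l.
  apply/orP; right.
  have [phi [phi_iso phi_nat]] := fusion_opow Q r.
  have am : is_mono (phi X' ∘ fmor (opow (T Q) r) v).
    exact: mono_comp (iso_mono (phi_iso _)) (opow_mono Cab Crig (kernel_mono kv)).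
  have := @kernel_opow_bound n P Q Z _ iZ _ pZ QZ Qp X X' i im r 0 _ _ am.
  rewrite /= compA phi_nat -compA -fmorM kv.1 fmor0 compm0 => /(_ erefl) /leq_trans; apply.
  by apply: leq_trans (HT _) _; rewrite leq_mul2l HX orbT.
(* The upper bound at [r = N.+1] involves [Z^(N+1)]; the factor [cZ] brings it down to [N] times the
   length of [Z^N], against [N.+1] times in the lower bound. *)
pose N := (cV * (cT * (cX * cZ)))%N.
have lower := plen_opow_lower Pgen QZ qe (r := N.+1) (m := 0) (N := N) erefl.
have le : (N.+1 * l (lpow Z N (munit C)) <= N * l (lpow Z N (munit C)))%N.
  apply: leq_trans lower _; apply: leq_trans (upper N.+1) _.
  by rewrite /N -!mulnA !leq_mul2l (HZ N) !orbT.
(* The common factor cancels unless [Z^N] has length zero; in that case the upper bound would force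
   [Y^(N+1)] to have length zero. *)
move: le; rewrite leq_pmul2r ?ltnn // lt0n; apply/eqP => L0.
have := leq_trans (plen_opow_gt0 Pgen QZ qe N.+1) (upper N.+1).
have := HZ N; rewrite L0 muln0 leqn0 => /eqP HZ0.
by rewrite [X in (cX * X)%N](_ : _ = 0%N) // !muln0.
Qed.

Lemma hopf_monad_exact : exact_functor T.
Proof. by split=> //; apply: right_exact_mono_exact => // X Y f; apply: hopf_monad_mono. Qed.

End HopfMonadExact.

(** * Modules over a Hopf monad *)

Section FreeModules.
Context {k : fieldType} {A : lincat k} (T : monad A).
Implicit Types X Y : A.

Definition em_free_ob X : em_cat T := EMOb (monad_muA T X) (monad_mu1 T X).

Lemma em_free_subproof X Y (f : hom X Y) :
  fmor T f ∘ em_act (em_free_ob X) = em_act (em_free_ob Y) ∘ fmor T (fmor T f).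
Proof. exact: (esym (monad_mu_nat T f)). Qed.

Definition em_free : functor A (em_cat T).
Proof.
exists em_free_ob (fun X Y f => em_mk (em_free_ob X) (em_free_ob Y) _ (em_free_subproof f)).
- by move=> X Y a f g; apply: val_inj; apply: fmor_lin.
- by move=> X; apply: val_inj; apply: fmor1.
- by move=> X Y Z g f; apply: val_inj; apply: fmorM.
Defined.

Definition em_forget : functor (em_cat T) A.
Proof.
exists (fun X : em_cat T => em_car X) (fun (M N : em_cat T) (f : hom M N) => vsval f).
- by move=> M N a f g; rewrite linearP.
- by [].
- by [].
Defined.

Lemma em_counit_subproof (X : em_cat T) :
  em_act X ∘ em_act (em_free_ob (em_car X)) = em_act X ∘ fmor T (em_act X).
Proof. by rewrite /= em_actM. Qed.

Definition em_counit (X : em_cat T) : hom (em_free (em_car X)) X :=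
  em_mk (em_free_ob (em_car X)) X _ (em_counit_subproof X).

Definition em_adjunction : adjunction em_free em_forget.
Proof.
exists (fun X => monad_eta T X) em_counit.
- by move=> X Y f; rewrite (monad_eta_nat T f).
- by move=> X Y f; apply: val_inj; rewrite /= em_homE.
- by move=> X; apply: val_inj; rewrite /= monad_mu1r.
- by move=> X; rewrite /= em_act1.
Defined.

Lemma em_counit_epi (X : em_cat T) : is_epi (em_counit X).
Proof.
apply/epiP => Y g /(congr1 val) /= ge; apply: val_inj => /=.
by rewrite -[LHS]compm1 -(em_act1 X) compA ge comp0m.
Qed.

Lemma em_left_exact : left_exact T -> left_exact em_free.
Proof.
move=> Tl X Y K f i ki; have kT := Tl _ _ _ _ _ ki.
apply: is_kernelI.
- by rewrite -fmorM ki.1 fmor0.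
- by move=> Z u v /(congr1 val) /= uv; apply: val_inj; apply: (kernel_mono kT).
move=> Z g /(congr1 val) /= fg; have [h hE] := kernel_lift kT fg.
suff Hh : h ∘ em_act Z = em_act (em_free K) ∘ fmor T h by exists (em_mk Z (em_free K) h Hh); apply: val_inj.
apply: (kernel_mono kT) => /=; rewrite !compA hE; apply: etrans (em_homE g) _.
rewrite /= -hE fmorM !compA; congr (_ ∘ _).
exact (monad_mu_nat T i).
Qed.

Hypothesis (Aab : is_abelian A) (Tr : right_exact T).

(** Since [T] preserves cokernels, the cokernel in [A] of the underlying map carries a module
    structure; its projection is then a module morphism killing [e], hence zero. *)
Lemma em_forget_epi (X Y : em_cat T) (e : hom X Y) :
  is_epi e -> is_epi (vsval e : hom (em_car X) (em_car Y)).
Proof.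
move=> ee; have [Q [q kq]] := has_cokernels Aab (vsval e : hom (em_car X) (em_car Y)).
have kTq := Tr kq; have qe := cokernel_epi kq; have Tqe := cokernel_epi kTq.
have TTqe := right_exact_epi Aab Tr Tqe.
have [|s sE] := cokernel_desc (g := q ∘ em_act Y) kTq.
  by rewrite -compA -em_homE compA kq.1 comp0m.
have sM : s ∘ fmor T s = s ∘ monad_mu T Q.
  apply: TTqe; rewrite -!compA -fmorM sE fmorM compA sE.
  by have /= -> := monad_mu_nat T q; rewrite [RHS]compA sE -!compA em_actM.
have s1 : s ∘ monad_eta T Q = idm Q.
  apply: qe; rewrite -compA; have /= -> := monad_eta_nat T q.
  by rewrite compA sE -compA em_act1 compm1 comp1m.
pose Q' : em_cat T := EMOb sM s1.
have qT : q ∘ em_act Y = em_act Q' ∘ fmor T q by rewrite /= sE.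
have /(congr1 val) /= q0 : em_mk Y Q' q qT = 0.
  by apply: (epiP e).1 => //; apply: val_inj; apply: kq.1.
by apply/(cokernel_zeroP kq)/zero_obP/qe; rewrite comp1m comp0m q0.
Qed.

(** Exactness of an action in its first variable speaks of cokernels, so an epimorphism of modules
    has to be exhibited as one. The kernel in [A] inherits the module structure. *)
Lemma em_epi_cokernel (X Y : em_cat T) (e : hom X Y) :
  is_epi e -> exists (K : em_cat T) (i : hom K X), is_cokernel i e.
Proof.
move=> ee; have ve := em_forget_epi ee; have Tve := right_exact_epi Aab Tr ve.
have [K [i ki]] := has_kernels Aab (vsval e : hom (em_car X) (em_car Y)).
have im := kernel_mono ki; have ke := epi_is_cokernel Aab ve ki.
have [|s sE] := kernel_lift (g := em_act X ∘ fmor T i) ki.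
  by rewrite compA em_homE -compA -fmorM ki.1 fmor0 compm0.
have sM : s ∘ fmor T s = s ∘ monad_mu T K.
  apply: im; rewrite !compA sE -!compA -fmorM sE fmorM !compA em_actM -compA.
  by have /= -> := monad_mu_nat T i; rewrite compA.
have s1 : s ∘ monad_eta T K = idm K.
  apply: im; rewrite compA sE -compA; have /= <- := monad_eta_nat T i.
  by rewrite compA em_act1 comp1m compm1.
pose K' : em_cat T := EMOb sM s1.
exists K', (em_mk K' X i sE); apply: is_cokernelI => //; first exact/val_inj/ke.1.
move=> Z g /(congr1 vsval) gi; have [h hE] := cokernel_desc ke (gi : vsval g ∘ i = 0).
suff hT : h ∘ em_act Y = em_act Z ∘ fmor T h by exists (em_mk Y Z h hT); apply: val_inj.
by apply: Tve; rewrite -!compA -em_homE compA hE em_homE -hE fmorM.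
Qed.

Lemma em_free_projective P : is_projective P -> is_projective (em_free P).
Proof. by apply: (left_adjoint_projective em_adjunction) => X Y f; apply: em_forget_epi. Qed.

End FreeModules.

(** * Left duals of modules over a Hopf monad *)

Section HopfModuleDuals.
Context {k : fieldType} {C : moncat k} (T : hopf_monad C).

Section Fusion.
Context (X : C).

Let fus Y : hom (T (X ⊗ T Y)) (T X ⊗ T Y) :=
  locked ((idm _ ⊗m monad_mu T Y) ∘ hopf_xi T X (T Y)).

Let fusE Y : fus Y = (idm _ ⊗m monad_mu T Y) ∘ hopf_xi T X (T Y).
Proof. by rewrite /fus -lock. Qed.

Let fus_iso Y : is_iso (fus Y).
Proof. by rewrite fusE; apply: hopf_fusionl. Qed.

Let fus_nat Y Y' (g : hom (T Y) (T Y')) : g ∘ monad_mu T Y = monad_mu T Y' ∘ fmor T g ->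
  (idm _ ⊗m g) ∘ fus Y = fus Y' ∘ fmor T (idm X ⊗m g).
Proof.
by move=> gT; rewrite !fusE compA -bmorM gT -[RHS]compA hopf_xi_nat compA -bmorM fmor1.
Qed.

Definition module_fusion (Y : em_cat T) : hom (T (X ⊗ em_car Y)) (T X ⊗ em_car Y) :=
  locked ((idm _ ⊗m em_act Y) ∘ hopf_xi T X (em_car Y)).

Lemma module_fusionE (Y : em_cat T) :
  module_fusion Y = (idm _ ⊗m em_act Y) ∘ hopf_xi T X (em_car Y).
Proof. by rewrite /module_fusion -lock. Qed.

(* The fusion operator of a free module is invertible; a general Y is a split coequalizer
   of free modules. *)
Lemma module_fusion_iso Y : is_iso (module_fusion Y).
Proof.
pose r := em_act Y; pose y := em_car Y.
have Hr : module_fusion Y ∘ fmor T (idm X ⊗m r) = (idm (T X) ⊗m r) ∘ fus y.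
  rewrite !module_fusionE fusE -compA hopf_xi_nat fmor1 !compA -!bmorM !comp1m.
  by rewrite /r em_actM.
have inv_nat Z Z' (g : hom (T Z) (T Z')) : g ∘ monad_mu T Z = monad_mu T Z' ∘ fmor T g ->
    inv (fus_iso Z') ∘ (idm _ ⊗m g) = fmor T (idm X ⊗m g) ∘ inv (fus_iso Z).
  move=> gT; apply: (iso_mono (fus_iso Z')); apply: (iso_epi (fus_iso Z)).
  by rewrite !compA invKV comp1m fus_nat // -compA invK compm1.
exists (fmor T (idm X ⊗m r) ∘ inv (fus_iso y) ∘ (idm _ ⊗m monad_eta T y)); split.
  have re : is_epi (fmor T (idm X ⊗m r)).
    by apply: (split_epi (g := fmor T (idm X ⊗m monad_eta T y))); rewrite -fmorM -bmorM comp1m em_act1 bmor1 fmor1.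
  apply: re; rewrite comp1m -compA Hr -!compA (compA (idm _ ⊗m _)) -bmorM comp1m.
  have /= -> := monad_eta_nat T r.
  rewrite -(comp1m (idm (T X))) bmorM !compA -(compA _ (inv _)).
  rewrite inv_nat; last by rewrite -(monad_mu_nat T).
  rewrite !compA -fmorM -bmorM comp1m em_actM -(comp1m (idm X)) bmorM fmorM.
  rewrite -(compA _ (fmor T _)) -inv_nat; last by rewrite monad_muA.
  rewrite !compA comp1m -(compA _ (idm (T X) ⊗m _) (idm (T X) ⊗m _)) -bmorM comp1m.
  by rewrite monad_mu1 bmor1 compm1 -compA invK compm1.
rewrite !compA Hr -(compA _ (fus y)) invKV compm1 -bmorM comp1m.
by rewrite em_act1 bmor1.
Qed.

End Fusion.

Hypothesis (Cdual : forall X : C, exists (X' : C)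
     (ev : hom (X' ⊗ X) (munit C)) (coev : hom (munit C) (X ⊗ X')), is_left_dual ev coev).

(** The action [s] is forced by linearity of [ev]: transport [hopf_phi T ∘ fmor T ev] along the
    fusion isomorphism [T (y' ⊗ y) ≅ T y' ⊗ y] and take its mate. The module axioms are then checked
    after pairing with [ev]. *)
Lemma hopf_dual_action (Y : em_cat T) (y' : C) (ev : hom (y' ⊗ em_car Y) (munit C))
    (coev : hom (munit C) (em_car Y ⊗ y')) : is_left_dual ev coev ->
  exists s : hom (T y') y',
    [/\ s ∘ fmor T s = s ∘ monad_mu T y', s ∘ monad_eta T y' = idm y',
        ev ∘ ((s ⊗m em_act Y) ∘ hopf_xi T y' (em_car Y)) = hopf_phi T ∘ fmor T ev
      & coev ∘ hopf_phi T = (em_act Y ⊗m s) ∘ hopf_xi T (em_car Y) y' ∘ fmor T coev].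
Proof.
move: ev coev; set y := em_car Y; set r := em_act Y => ev coev d.
pose H X := module_fusion X Y; have Hi X : is_iso (H X) := module_fusion_iso X Y.
have HE X : H X = (idm _ ⊗m r) ∘ hopf_xi T X y by exact: module_fusionE.
clearbody H.
have [s sE] := ev_mate d (hopf_phi T ∘ fmor T ev ∘ inv (Hi y')).
have {}sE : ev ∘ (s ⊗m idm y) ∘ H y' = hopf_phi T ∘ fmor T ev.
  by rewrite sE -[LHS]compA invK compm1.
have Hnat X X' (f : hom X X') : H X' ∘ fmor T (f ⊗m idm y) = (fmor T f ⊗m idm y) ∘ H X.
  by rewrite !HE -compA hopf_xi_nat !compA -!bmorM fmor1 !(comp1m, compm1).
have sM : s ∘ fmor T s = s ∘ monad_mu T y'.
  apply: (ev_mate_inj d); apply: (iso_epi (Hi (T y'))).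
  apply: (iso_epi (fmor_iso T (Hi y'))).
  have Hmu : (monad_mu T y' ⊗m idm y) ∘ (H (T y') ∘ fmor T (H y')) = H y' ∘ monad_mu T (y' ⊗ y).
    rewrite !HE fmorM !compA -(compA _ (hopf_xi T _ _) (fmor T _)) hopf_xi_nat.
    rewrite fmor1 !compA -!bmorM !(comp1m, compm1) em_actM.
    by rewrite -[RHS]compA hopf_mu_xi !compA -!bmorM comp1m.
  rewrite !(bmor_compl _ s) -!compA Hmu (compA (fmor T s ⊗m _)) -Hnat !compA sE.
  rewrite -!compA -!fmorM (compA ev) sE !fmorM (compA (hopf_phi T)) -hopf_mu_phi -!compA.
  by have /= -> := monad_mu_nat T ev.
have s1 : s ∘ monad_eta T y' = idm y'.
  apply: (ev_mate_inj d); rewrite bmor_compl compA.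
  have -> : monad_eta T y' ⊗m idm y = H y' ∘ monad_eta T (y' ⊗ y).
    by rewrite !HE -compA hopf_eta_xi -bmorM comp1m em_act1.
  rewrite compA sE -compA; have /= <- := monad_eta_nat T ev.
  by rewrite compA hopf_eta_phi comp1m bmor1 compm1.
have evT : ev ∘ ((s ⊗m r) ∘ hopf_xi T y' y) = hopf_phi T ∘ fmor T ev.
  by rewrite -sE !HE !compA -[in RHS](compA ev) -bmorM comp1m compm1.
(* Both sides are compared through their mates, where the zigzag identity reduces linearity of
   [coev] to that of [ev]. *)
have coevT : coev ∘ hopf_phi T = (r ⊗m s) ∘ hopf_xi T y y' ∘ fmor T coev.
  apply: (ladj_inj (adj := right_mul_adjunction d)).
  rewrite !right_mul_counitE /=; apply: (iso_epi (Hi (munit C))).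
  rewrite bmor_compl !compA d.1.
  have -> : lunit y ∘ (hopf_phi T ⊗m idm y) ∘ H (munit C) = r ∘ fmor T (lunit y).
    rewrite HE !compA -(compA (lunit y)) -bmorM comp1m compm1.
    rewrite -(comp1m (hopf_phi T)) -(compm1 r) bmorM !compA lunit_nat compm1.
    by rewrite -!compA (compA (lunit _)) hopf_xi1.
  rewrite -d.1 !fmorM HE.
  have E : ((r ⊗m s ∘ hopf_xi T y y' ∘ fmor T coev) ⊗m idm y) ∘ ((idm _ ⊗m r) ∘ hopf_xi T (munit C) y)
      = ((r ⊗m s) ⊗m r) ∘ ((hopf_xi T y y' ⊗m idm _) ∘ (hopf_xi T (y ⊗ y') y ∘ fmor T (coev ⊗m idm y))).
    by rewrite hopf_xi_nat fmor1 !compA -!bmorM !(compm1, comp1m).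
  rewrite -[RHS]compA E -hopf_xi1r.
  rewrite -!compA (compA (assoc _ _ _)) assoc_nat -!compA.
  rewrite (compA (hopf_xi T y y' ⊗m _)) (compA (assoc _ _ _)) (compA (assoc _ _ _)) -hopf_xiA -!compA.
  rewrite (compA (r ⊗m (s ⊗m r))) -bmorM (compA (idm y ⊗m ev)) -bmorM compA.
  rewrite evT comp1m compm1 -!compA (compA (hopf_xi T y _)) hopf_xi_nat fmor1 -!compA.
  rewrite (compA r (runit _)) -runit_nat -!compA; congr (_ ∘ _).
  by rewrite (compA (r ⊗m idm _)) -bmorM compm1 comp1m (compA (r ⊗m hopf_phi T)) -bmorM compm1.
by exists s.
Qed.

Lemma hopf_modules_left_dual (Y : hopf_modules T) : exists (Y' : hopf_modules T)
  (ev : hom (Y' ⊗ Y) (munit _)) (coev : hom (munit _) (Y ⊗ Y')), is_left_dual ev coev.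
Proof.
have [y' [ev [coev d]]] := Cdual (em_car Y).
have [s [sM s1 evT coevT]] := hopf_dual_action d.
pose Y' : em_cat T := EMOb sM s1.
exists Y', (em_mk (hopf_tens T Y' Y) (hopf_unit T) ev evT),
  (em_mk (hopf_unit T) (hopf_tens T Y Y') coev coevT).
split=> [|a aE]; apply: val_inj.
  rewrite -[LHS]/(runit _ ∘ (idm _ ⊗m ev) ∘ assoc _ _ _ ∘ (coev ⊗m idm _)).
  exact: d.1.
rewrite -[LHS]/(lunit _ ∘ (ev ⊗m idm _) ∘ vsval a ∘ (idm _ ⊗m coev)).
exact (d.2 _ (congr1 vsval aE)).
Qed.

End HopfModuleDuals.

(** * Adjunctions of module categories *)

Record comonoidal (k : fieldType) (C V : moncat k) := Comonoidal {
  cm_fun :> functor C V;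
  cm_xi : forall X Y : C, hom (cm_fun (X ⊗ Y)) (cm_fun X ⊗ cm_fun Y);
  cm_phi : hom (cm_fun (munit C)) (munit V);
  cm_nat : forall (X X' Y Y' : C) (f : hom X X') (g : hom Y Y'),
    cm_xi X' Y' ∘ fmor cm_fun (f ⊗m g) = (fmor cm_fun f ⊗m fmor cm_fun g) ∘ cm_xi X Y;
  cm_A : forall X Y Z : C,
    (idm _ ⊗m cm_xi Y Z) ∘ cm_xi X (Y ⊗ Z) ∘ fmor cm_fun (assoc X Y Z)
    = assoc _ _ _ ∘ (cm_xi X Y ⊗m idm _) ∘ cm_xi (X ⊗ Y) Z;
  cm_1 : forall X : C,
    lunit _ ∘ (cm_phi ⊗m idm _) ∘ cm_xi (munit C) X = fmor cm_fun (lunit X) }.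

Section Opmodule.
Context {k : fieldType} {C V : moncat k} (L : comonoidal C V).
Context {M : lax_modcat V}.

(** An oplax module functor along [L], from [C] acting on itself to [M]. *)
Record opmodule (H : functor C M) := Opmodule {
  op_c :> forall X N : C, hom (H (X ⊗ N)) (L X ⊳ H N);
  op_nat : forall (X X' N N' : C) (f : hom X X') (g : hom N N'),
    op_c X' N' ∘ fmor H (f ⊗m g) = (fmor L f ⊳m fmor H g) ∘ op_c X N;
  op_m : forall X Y N : C,
    (idm _ ⊳m op_c Y N) ∘ op_c X (Y ⊗ N) ∘ fmor H (assoc X Y N)
    = act_m _ _ _ ∘ (cm_xi L X Y ⊳m idm _) ∘ op_c (X ⊗ Y) N;
  op_l : forall N : C,
    act_l (H N) ∘ (cm_phi L ⊳m idm _) ∘ op_c (munit C) N = fmor H (lunit N) }.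

Variable P : M.

Definition free_act : functor C M := fcomp (bfix2 (act M) P) L.

Definition free_act_opmodule : opmodule free_act.
Proof.
exists (fun X N => act_m (L X) (L N) P ∘ (cm_xi L X N ⊳m idm P)).
- move=> X X' N N' f g /=.
  rewrite -compA -bmor_compl cm_nat bmor_compl [RHS]compA.
  by rewrite -act_m_nat compA.
- move=> X Y N /=; rewrite bmor_compr -!compA -bmor_compl.
  rewrite (compA (idm _ ⊳m (cm_xi L Y N ⊳m idm P))) -act_m_nat -compA -bmor_compl.
  rewrite (compA (idm _ ⊗m _)) cm_A !bmor_compl -!compA.
  rewrite (compA (act_m _ _ _) (assoc _ _ _ ⊳m _)) (compA (idm _ ⊳m act_m _ _ _)).
  rewrite (compA (idm _ ⊳m act_m _ _ _)) act_pentagon -!compA; congr (_ ∘ _).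
  by rewrite !compA -[idm (_ ⊳ P)]bmor1 -act_m_nat.
- move=> N /=.
  rewrite -!compA (compA (_ ⊳m idm (_ ⊳ P))) -[idm (_ ⊳ P)]bmor1 -act_m_nat.
  by rewrite -!compA (compA (act_l _)) act_lunit -!bmor_compl compA cm_1.
Defined.

End Opmodule.

Section HopfFree.
Context {k : fieldType} {C : moncat k} (T : hopf_monad C).
Local Notation V := (hopf_modules T).

Definition hopf_free : comonoidal C V.
Proof.
exists (em_free T : functor C V)
  (fun X Y => em_mk (em_free_ob T (X ⊗ Y)) (hopf_tens T (em_free_ob T X) (em_free_ob T Y)) _
     (hopf_mu_xi T X Y))
  (em_mk (em_free_ob T (munit C)) (hopf_unit T) _ (hopf_mu_phi T)).
- by move=> X X' Y Y' f g; apply: val_inj; apply: hopf_xi_nat.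
- by move=> X Y Z; apply: val_inj; apply: hopf_xiA.
- by move=> X; apply: val_inj; apply: hopf_xi1.
Defined.

(** The counit of the free-forgetful adjunction, as a comonoidal transformation; this is the only
    link between [L] and the modules needed to transport structure to [G]. *)
Record hopf_counits (L : comonoidal C V) := HopfCounits {
  cu :> forall Y : V, hom (L (em_car Y)) Y;
  cu_nat : forall (Y Y' : V) (f : hom Y Y'), cu Y' ∘ fmor L (vsval f) = f ∘ cu Y;
  cu_tens : forall Y Y' : V, (cu Y ⊗m cu Y') ∘ cm_xi L (em_car Y) (em_car Y') = cu (Y ⊗ Y');
  cu_unit : cu (munit V) = cm_phi L }.

Definition hopf_free_counits : hopf_counits hopf_free.
Proof.
exists (fun Y : V => em_counit Y).
- exact: (acounit_nat (em_adjunction T)).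
- by move=> Y Y'; apply: val_inj.
- exact: val_inj.
Defined.

(** The action through the forgetful functor; it makes [C] the target in which [G] becomes a functor
    of module categories over the T-modules. *)
Definition restr_act : bifunctor V C C.
Proof.
exists (fun (Y : V) X => em_car Y ⊗ X)
  (fun (Y Y' : V) X X' (f : hom Y Y') g => (vsval f : hom (em_car Y) (em_car Y')) ⊗m g).
- by move=> Y Y' X X' g a f f'; rewrite linearP bmor_linl.
- by move=> Y Y' X X' f a g g'; rewrite bmor_linr.
- by move=> Y X; apply: bmor1.
- by move=> *; apply: bmorM.
Defined.

Definition restr : lax_modcat V.
Proof.
exists C restr_act (fun Y Y' X => assoc (em_car Y) (em_car Y') X) (fun X => lunit X).
- by move=> *; apply: assoc_nat.
- by move=> *; apply: lunit_nat.
- by move=> *; apply: pentagon.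
- by move=> *; apply: triangle.
- by move=> *; apply: lunit_tens.
Defined.

End HopfFree.

Section RightAdjoint.
Context {k : fieldType} {C : moncat k} {T : hopf_monad C}.
Local Notation V := (hopf_modules T).
Context {L : comonoidal C V} (cu : hopf_counits L).
Context {M : lax_modcat V}.
Hypothesis Mm : forall (X Y : V) (P : M), is_iso (act_m X Y P).
Hypothesis Ml : forall P : M, is_iso (act_l P).
Hypothesis Vdual : forall Y : V, exists (Y' : V)
  (ev : hom (Y' ⊗ Y) (munit V)) (coev : hom (munit V) (Y ⊗ Y')), is_left_dual ev coev.
Context {H : functor C M} {G : functor M C} (adj : adjunction H G) (h : opmodule L H).
Local Notation eps := (acounit adj).

(** The mate under the adjunction of the oplax structure of [H], which gives a lax structure on [G];
    the counit [cu] replaces [L (em_car Y)] by [Y]. *)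
Definition radj_act (Y : V) (Q : M) : hom (em_car Y ⊗ G Q) (G (Y ⊳ Q)) :=
  locked (radj adj ((cu Y ⊳m eps Q) ∘ h (em_car Y) (G Q))).

Lemma radj_actE (Y : V) (Q : M) :
  eps (Y ⊳ Q) ∘ fmor H (radj_act Y Q) = (cu Y ⊳m eps Q) ∘ h (em_car Y) (G Q).
Proof. by rewrite /radj_act -lock; apply: (radjK adj). Qed.

Lemma radj_act_nat (Y Y' : V) (Q Q' : M) (f : hom Y Y') (g : hom Q Q') :
  radj_act Y' Q' ∘ ((vsval f : hom (em_car Y) (em_car Y')) ⊗m fmor G g)
  = fmor G (f ⊳m g) ∘ radj_act Y Q.
Proof.
apply: (ladj_inj (adj := adj)); rewrite !fmorM !compA radj_actE acounit_nat -!compA radj_actE.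
by rewrite op_nat !compA -!bmorM cu_nat acounit_nat.
Qed.

Lemma radj_act_m (Y Y' : V) (Q : M) :
  fmor G (act_m Y Y' Q) ∘ radj_act (Y ⊗ Y') Q
  = radj_act Y (Y' ⊳ Q) ∘ (idm (em_car Y) ⊗m radj_act Y' Q) ∘ assoc (em_car Y) (em_car Y') (G Q).
Proof.
apply: (ladj_inj (adj := adj)); rewrite !fmorM !compA radj_actE acounit_nat -!compA radj_actE.
rewrite (compA (h _ _)) op_nat fmor1 -compA (compA (cu Y ⊳m _)) -bmorM compm1 radj_actE.
rewrite -(compm1 (cu Y)) bmorM -!compA (compA (idm _ ⊳m h _ _)) op_m.
by rewrite !compA -act_m_nat -!compA (compA (_ ⊳m eps Q)) -bmorM compm1 cu_tens.
Qed.

Lemma radj_act_l (Q : M) : fmor G (act_l Q) ∘ radj_act (munit V) Q = lunit (G Q).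
Proof.
apply: (ladj_inj (adj := adj)); rewrite !fmorM !compA acounit_nat -!compA radj_actE.
rewrite cu_unit -(op_l h) -(comp1m (cm_phi L)) -(compm1 (eps Q)) bmorM !compA act_l_nat.
by rewrite compm1 comp1m.
Qed.

Lemma radj_act_iso (Y : V) (Q : M) : is_iso (radj_act Y Q).
Proof.
have [Y' [ev [coev d]]] := Vdual Y.
refine (@lax_functor_strong k V M (restr T) Mm Ml _ _ G radj_act _ _ _ Y Y' ev coev Q d).
- by move=> X X' W; apply: assoc_iso.
- exact: lunit_iso.
- exact: radj_act_nat.
- exact: radj_act_m.
- exact: radj_act_l.
Qed.

End RightAdjoint.

(** * Beck's theorem for an exact faithful right adjoint *)

Section Monadicity.
Context {k : fieldType} {A B : lincat k} {H : functor A B} {G : functor B A} (adj : adjunction H G).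
Local Notation eps := (acounit adj).

Definition adj_monad : monad A.
Proof.
exists (fcomp G H) (fun X => fmor G (eps (H X))) (aunit adj).
- by move=> X Y f /=; rewrite -!fmorM acounit_nat.
- by move=> X Y f /=; rewrite aunit_nat.
- by move=> X /=; rewrite -!fmorM acounit_nat.
- by move=> X /=; rewrite atri2.
- by move=> X /=; rewrite -fmorM atri1 fmor1.
Defined.

Lemma comparison_actM (Q : B) :
  fmor G (eps Q) ∘ fmor adj_monad (fmor G (eps Q)) = fmor G (eps Q) ∘ monad_mu adj_monad (G Q).
Proof. by rewrite /= -!fmorM acounit_nat. Qed.

Definition comparison_ob (Q : B) : em_cat adj_monad := EMOb (comparison_actM Q) (atri2 adj Q).

Lemma comparison_subproof (Q Q' : B) (f : hom Q Q') :
  fmor G f ∘ em_act (comparison_ob Q) = em_act (comparison_ob Q') ∘ fmor adj_monad (fmor G f).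
Proof. by rewrite /= -!fmorM acounit_nat. Qed.

Definition comparison : functor B (em_cat adj_monad).
Proof.
exists comparison_ob
  (fun Q Q' f => em_mk (comparison_ob Q) (comparison_ob Q') _ (comparison_subproof f)).
- by move=> Q Q' a f g; apply: val_inj; apply: fmor_lin.
- by move=> Q; apply: val_inj; apply: fmor1.
- by move=> Q Q' Q'' g f; apply: val_inj; apply: fmorM.
Defined.

Hypotheses (Aab : is_abelian A) (Bab : is_abelian B).
Hypotheses (Gr : right_exact G) (Gf : faithful G).

Let Gex : exact_functor G := conj (right_adjoint_left_exact adj) Gr.

(* G maps this to a split coequalizer, and G is exact and faithful *)
Lemma counit_cokernel (Q : B) : is_cokernel (fmor H (fmor G (eps Q)) - eps (H (G Q))) (eps Q).
Proof.
set f := _ - _; have e0 : eps Q ∘ f = 0 by rewrite compBr acounit_nat subrr.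
have [Q' [q kq]] := has_cokernels Bab f.
have [t tq] := cokernel_desc kq e0.
have Gk : is_cokernel (fmor G f) (fmor G (eps Q)).
  apply: (split_coker (s := aunit adj (G Q)) (t := - aunit adj (G (H (G Q))))).
  - by rewrite -fmorM e0 fmor0.
  - exact: atri2.
  rewrite compNr fmorB compBl opprB atri2; congr (_ - _).
  by rewrite aunit_nat.
have [u ui uE] := cokernel_iso (Gr kq) Gk.
have tu : fmor G t = u by apply: (cokernel_epi (Gr kq)); rewrite -fmorM tq uE.
have ti : is_iso t by apply: (exact_faithful_iso Bab Gex Gf); rewrite tu.
by rewrite -tq; apply: is_cokernel_isol.
Qed.

Lemma comparison_full (Q Q' : B) (g : hom (comparison Q) (comparison Q')) :
  exists f, fmor comparison f = g.
Proof.
have gE : vsval g ∘ fmor G (eps Q) = fmor G (eps Q') ∘ fmor G (fmor H (vsval g)) := em_homE g.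
have [|f fE] := cokernel_desc (g := eps Q' ∘ fmor H (vsval g)) (counit_cokernel Q).
  by rewrite compBr -!compA -fmorM gE fmorM compA acounit_nat -compA acounit_nat subrr.
exists f; apply: val_inj => /=.
have Ge : is_epi (fmor G (eps Q)) := cokernel_epi (Gr (counit_cokernel Q)).
by apply: Ge; rewrite -fmorM fE gE fmorM.
Qed.

Lemma comparison_faithful : faithful comparison.
Proof. by move=> Q Q' f g /(congr1 val) /= /Gf. Qed.

Lemma comparison_surj (N : em_cat adj_monad) : exists Q, isomorphic (comparison Q) N.
Proof.
pose n := em_car N; pose s : hom (G (H n)) n := em_act N.
have sM : s ∘ fmor G (fmor H s) = s ∘ fmor G (eps (H n)) := em_actM N.
have s1 : s ∘ aunit adj n = idm n := em_act1 N.
(* The canonical presentation of the module [N], formed in [B]; [G] turns it into the split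
   coequalizer with quotient [s]. *)
have [Q [q kq]] := has_cokernels Bab (fmor H s - eps (H n)).
have Gq := Gr kq.
have ks : is_cokernel (fmor G (fmor H s - eps (H n))) s.
  apply: (split_coker (s := aunit adj n) (t := - aunit adj (G (H n)))) => //.
    by rewrite fmorB compBr sM subrr.
  by rewrite compNr fmorB compBl opprB atri2 aunit_nat.
have [u ui uE] := cokernel_iso Gq ks.
exists Q.
have uT : u ∘ em_act (comparison Q) = s ∘ fmor adj_monad u.
  have ee : is_epi (fmor G (fmor H (fmor G q))).
    apply: (right_exact_epi Bab Gr); apply: (left_adjoint_epi adj).
    exact: cokernel_epi Gq.
  apply: ee; rewrite /= -!compA -!fmorM uE acounit_nat fmorM compA uE.
  by rewrite sM.
exists (em_mk (comparison Q) N u uT); exact: em_iso.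
Qed.

Lemma comparison_equivalence : is_equivalence comparison.
Proof.
exact: fully_faithful_equivalence comparison_full comparison_faithful comparison_surj.
Qed.

Lemma comparison_left_exact : left_exact comparison.
Proof.
exact: fully_faithful_left_exact comparison_full comparison_faithful comparison_surj.
Qed.

End Monadicity.

(** * The equivariant structure on the regular module category *)

Section EquivariantStructure.
Context {k : fieldType} {C : moncat k} {T : hopf_monad C}.
Local Notation V := (hopf_modules T).
Local Notation L := (hopf_free T).
Local Notation cu := (hopf_free_counits T).
Context {M : lax_modcat V}.
Hypothesis Mm : forall (X Y : V) (P : M), is_iso (act_m X Y P).
Hypothesis Ml : forall P : M, is_iso (act_l P).
Hypothesis Vdual : forall Y : V, exists (Y' : V)
  (ev : hom (Y' ⊗ Y) (munit V)) (coev : hom (munit V) (Y ⊗ Y')), is_left_dual ev coev.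
Context {H : functor C M} {G : functor M C} (adj : adjunction H G) (h : opmodule L H).
Local Notation eps := (acounit adj).
Local Notation eta := (aunit adj).
Local Notation d := (radj_act cu adj h).
Let d_iso : forall Y Q, is_iso (d Y Q) := radj_act_iso cu Mm Ml Vdual adj h.

(** [radj_act] at a free module, retyped so that its carrier reads [T X]; the following lemmas
    restate the rules for [radj_act] in this form, for rewriting. *)
Definition free_radj_act (X : C) (Q : M) : hom (T X ⊗ G Q) (G (L X ⊳ Q)) := d (L X) Q.
Local Notation dT := free_radj_act.

Lemma free_radj_act_iso X Q : is_iso (dT X Q).
Proof. exact: d_iso. Qed.

Lemma free_radj_act_nat (X X' : C) (Q Q' : M) (f : hom X X') (g : hom Q Q') :
  dT X' Q' ∘ (fmor T f ⊗m fmor G g) = fmor G (fmor L f ⊳m g) ∘ dT X Q.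
Proof. exact (radj_act_nat cu adj h (fmor L f) g). Qed.

Lemma free_radj_act_natr (X : C) (Q Q' : M) (g : hom Q Q') :
  dT X Q' ∘ (idm (T X) ⊗m fmor G g) = fmor G (idm (L X) ⊳m g) ∘ dT X Q.
Proof. exact (radj_act_nat cu adj h (idm (L X)) g). Qed.

Lemma free_radj_act_mu (X : C) (Q Q' : M) (g : hom Q Q') :
  dT X Q' ∘ (monad_mu T X ⊗m fmor G g) = fmor G (cu (L X) ⊳m g) ∘ dT (T X) Q.
Proof. exact (radj_act_nat cu adj h (cu (L X)) g). Qed.

Lemma free_radj_act_phi (Q : M) :
  d (munit V) Q ∘ (hopf_phi T ⊗m idm (G Q)) = fmor G (cm_phi L ⊳m idm Q) ∘ dT (munit C) Q.
Proof. by rewrite -(fmor1 G); exact (radj_act_nat cu adj h (cm_phi L) (idm Q)). Qed.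

Lemma free_radj_act_xi (X Y : C) (Q : M) :
  d (L X ⊗ L Y) Q ∘ (hopf_xi T X Y ⊗m idm (G Q)) = fmor G (cm_xi L X Y ⊳m idm Q) ∘ dT (X ⊗ Y) Q.
Proof. by rewrite -(fmor1 G); exact (radj_act_nat cu adj h (cm_xi L X Y) (idm Q)). Qed.

Lemma free_radj_act_m (X Y : C) (Q : M) :
  dT X (L Y ⊳ Q) ∘ (idm (T X) ⊗m dT Y Q) ∘ assoc (T X) (T Y) (G Q)
  = fmor G (act_m (L X) (L Y) Q) ∘ d (L X ⊗ L Y) Q.
Proof. exact (esym (radj_act_m cu adj h (L X) (L Y) Q)). Qed.

Lemma free_radj_actE (X : C) (Q : M) :
  eps (L X ⊳ Q) ∘ fmor H (dT X Q) = (cu (L X) ⊳m eps Q) ∘ h (T X) (G Q).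
Proof. exact (radj_actE cu adj h (L X) Q). Qed.

(** The composite [G (H (X ⊗ N)) -> G (L X ⊳ H N) ≅ T X ⊗ G (H N)]. The oplax structure of [H] is
    not assumed invertible, so this map is only lax, as equivariance allows. *)
Definition eqv_str (X N : C) : hom (G (H (X ⊗ N))) (T X ⊗ G (H N)) :=
  locked (inv (free_radj_act_iso X (H N)) ∘ fmor G (h X N)).

Local Notation c := eqv_str.

Lemma eqv_strE X N : dT X (H N) ∘ c X N = fmor G (h X N).
Proof. by rewrite /c -lock compA invKV comp1m. Qed.

Lemma eqv_str_nat (X X' N N' : C) (f : hom X X') (g : hom N N') :
  c X' N' ∘ fmor G (fmor H (f ⊗m g)) = (fmor T f ⊗m fmor G (fmor H g)) ∘ c X N.
Proof.
apply: (iso_mono (free_radj_act_iso _ _)); rewrite !compA eqv_strE free_radj_act_nat.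
by rewrite -compA eqv_strE -!fmorM op_nat.
Qed.

Lemma eqv_str_m (X Y N : C) :
  (idm (T X) ⊗m c Y N) ∘ c X (Y ⊗ N) ∘ fmor G (fmor H (assoc X Y N))
  = assoc _ _ _ ∘ (hopf_xi T X Y ⊗m idm _) ∘ c (X ⊗ Y) N.
Proof.
apply: (iso_mono (bmor_iso (tens C) (idm_iso (T X)) (free_radj_act_iso Y (H N)))).
apply: (iso_mono (free_radj_act_iso X (L Y ⊳ H N))).
rewrite !compA free_radj_act_m -(compA (fmor G _) (d (L X ⊗ L Y) (H N))) free_radj_act_xi.
rewrite -(compA (dT _ _) (_ ⊗m dT _ _)) -bmorM comp1m eqv_strE free_radj_act_natr.
rewrite -!compA (compA (dT _ _)) !eqv_strE -!fmorM; congr fmor.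
by rewrite !compA op_m.
Qed.

Lemma eqv_str_l (N : C) :
  lunit _ ∘ (hopf_phi T ⊗m idm _) ∘ c (munit C) N = fmor G (fmor H (lunit N)).
Proof.
rewrite -(radj_act_l cu adj h (H N)) -(compA (fmor G _)) free_radj_act_phi.
by rewrite -!compA eqv_strE -!fmorM compA op_l.
Qed.

Lemma eqv_str_mu (X N : C) :
  c X N ∘ fmor G (eps (H (X ⊗ N)))
  = (monad_mu T X ⊗m fmor G (eps (H N))) ∘ c (T X) (G (H N)) ∘ fmor G (fmor H (c X N)).
Proof.
apply: (iso_mono (free_radj_act_iso _ _)); rewrite !compA free_radj_act_mu eqv_strE.
rewrite -(compA (fmor G _) (dT _ _)) eqv_strE -!fmorM -free_radj_actE -compA -fmorM eqv_strE.
by rewrite acounit_nat.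
Qed.

Lemma eqv_str_eta (X N : C) : c X N ∘ eta (X ⊗ N) = monad_eta T X ⊗m eta N.
Proof.
apply: (iso_mono (free_radj_act_iso _ _)); rewrite !compA eqv_strE.
apply: (ladj_inj (adj := adj)); rewrite !fmorM !compA acounit_nat -compA atri1 compm1.
rewrite free_radj_actE -compA op_nat compA -bmorM atri1.
have -> : cu (L X) ∘ fmor L (monad_eta T X) = idm (L X) := atri1 (em_adjunction T) X.
by rewrite bmor1 comp1m.
Qed.

(** The inverse of [d] is a morphism of U-modules from [G (Y ⊳ Q)] to [Y ⊗ G Q]; it becomes the
    module structure of the comparison functor. *)
Lemma inv_radj_act_counit (Y : V) (Q : M) :
  inv (d_iso Y Q) ∘ fmor G (eps (Y ⊳ Q))
  = (em_act Y ⊗m fmor G (eps Q)) ∘ c (em_car Y) (G Q) ∘ fmor G (fmor H (inv (d_iso Y Q))).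
Proof.
apply: (iso_mono (d_iso Y Q)); rewrite compA invKV comp1m.
have dn : d Y Q ∘ (em_act Y ⊗m fmor G (eps Q)) = fmor G (cu Y ⊳m eps Q) ∘ dT (em_car Y) (H (G Q)).
  exact (radj_act_nat cu adj h (cu Y) (eps Q)).
rewrite !compA dn -(compA (fmor G _) (dT _ _)) eqv_strE.
rewrite -!fmorM -(radj_actE cu adj h).
by rewrite -compA -fmorM invKV fmor1 compm1.
Qed.

Hypothesis U_left_exact : left_exact (adj_monad adj).

Lemma adjoint_modfun : is_lax_modfun (M := reg C) (N := twist T (reg C)) (F := adj_monad adj) c.
Proof.
split=> //.
- exact: eqv_str_nat.
- move=> X Y N.
  rewrite -[LHS]/((fmor T (idm X) ⊗m c Y N) ∘ c X (Y ⊗ N) ∘ fmor G (fmor H (assoc X Y N))).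
  by rewrite fmor1 eqv_str_m.
- by move=> N; apply: eqv_str_l.
Qed.

Definition adjoint_equivariant : equivariant T (reg C).
Proof.
exists (adj_monad adj) c.
- exact: adjoint_modfun.
- split; first exact: monad_mu_nat.
  move=> X N; rewrite [LHS]eqv_str_mu.
  rewrite -[RHS]/((fmor T (idm X) ⊗m fmor G (eps (H N))) ∘ ((monad_mu T X ⊗m idm _)
     ∘ c (T X) (G (H N)) ∘ fmor G (fmor H (c X N)))).
  by rewrite !compA -bmorM fmor1 comp1m compm1.
- split; first exact: monad_eta_nat.
  move=> X N; rewrite [LHS]eqv_str_eta.
  rewrite -[RHS]/((fmor T (idm X) ⊗m eta N) ∘ (monad_eta T X ⊗m idm _)).
  by rewrite -bmorM fmor1 comp1m compm1.
Defined.

Local Notation U := adjoint_equivariant.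

Lemma comparison_c_subproof (Y : V) (Q : M) :
  inv (d_iso Y Q) ∘ em_act (comparison adj (Y ⊳ Q))
  = em_act (eqv_act U Y (comparison adj Q)) ∘ fmor U (inv (d_iso Y Q)).
Proof. exact (inv_radj_act_counit Y Q). Qed.

Definition comparison_c (Y : V) (Q : M) :
  hom (comparison adj (Y ⊳ Q) : eqv_modules U) (Y ⊳ (comparison adj Q : eqv_modules U)) :=
  em_mk (comparison adj (Y ⊳ Q)) (eqv_act U Y (comparison adj Q)) _ (comparison_c_subproof Y Q).

Hypothesis K_left_exact : left_exact (comparison adj).

Lemma comparison_modfun :
  is_modfun (M := M) (N := eqv_modules U) (F := comparison adj) comparison_c.
Proof.
split; last by move=> Y Q; apply: em_iso; apply: inv_iso.
split=> //.
- move=> Y Y' Q Q' f g; apply: val_inj.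
  rewrite -[LHS]/(inv (d_iso Y' Q') ∘ fmor G (f ⊳m g)).
  rewrite -[RHS]/(((vsval f : hom (em_car Y) (em_car Y')) ⊗m fmor G g) ∘ inv (d_iso Y Q)).
  apply: (iso_mono (d_iso Y' Q')); apply: (iso_epi (d_iso Y Q)).
  rewrite !compA invKV comp1m -radj_act_nat -!compA invK compm1.
  by [].
- move=> Y Y' Q; apply: val_inj.
  rewrite -[LHS]/((idm (em_car Y) ⊗m inv (d_iso Y' Q)) ∘ inv (d_iso Y (Y' ⊳ Q))
     ∘ fmor G (act_m Y Y' Q)).
  rewrite -[RHS]/(assoc (em_car Y) (em_car Y') (G Q) ∘ inv (d_iso (Y ⊗ Y') Q)).
  apply: (iso_epi (d_iso (Y ⊗ Y') Q)).
  apply: (iso_mono (bmor_iso (tens C) (idm_iso (em_car Y)) (d_iso Y' Q))).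
  apply: (iso_mono (d_iso Y (Y' ⊳ Q))).
  rewrite -!compA invK compm1 radj_act_m.
  rewrite (compA (idm _ ⊗m _)) -bmorM invKV comp1m bmor1 comp1m.
  by rewrite (compA (d _ _)) invKV comp1m -compA.
- move=> Q; apply: val_inj.
  rewrite -[LHS]/(lunit (G Q) ∘ inv (d_iso (munit V) Q)).
  rewrite -[RHS]/(fmor G (act_l Q)).
  by rewrite -(radj_act_l cu adj h Q) -compA invKV compm1.
Qed.

End EquivariantStructure.

(** * Direct sum decompositions *)

(** These closure properties let the full subcategory on [p] inherit zero objects, kernels,
    cokernels and biproducts from [A]. *)
Record subquotient_closed (k : fieldType) (A : lincat k) (p : A -> Prop) : Prop := SubquotientClosed {
  sq_zero : forall X, is_zero_ob X -> p X;
  sq_sub : forall (X Y : A) (f : hom X Y), is_mono f -> p Y -> p X;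
  sq_quo : forall (X Y : A) (f : hom X Y), is_epi f -> p X -> p Y;
  sq_sum : forall (X Y S : A) (i1 : hom X S) (i2 : hom Y S) (p1 : hom S X) (p2 : hom S Y),
    is_biproduct i1 i2 p1 p2 -> p X -> p Y -> p S }.

Section FullSubcategory.
Context {k : fieldType} {A : lincat k} (p : A -> Prop).

Definition fullsub : lincat k.
Proof.
exists {X : A | p X} (fun X Y => hom (sval X) (sval Y)) (fun X => idm (sval X))
  (fun X Y Z g f => g ∘ f).
- by move=> X Y Z f; apply: comp_linl.
- by move=> X Y Z g; apply: comp_linr.
- by move=> *; apply: compA.
- by move=> *; apply: comp1m.
- by move=> *; apply: compm1.
Defined.

Hypotheses (Aab : is_abelian A) (Alf : is_locally_finite A) (pc : subquotient_closed p).
Implicit Types X Y Z : fullsub.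

Lemma fullsub_mono X Y (f : hom X Y) : is_mono f -> is_mono (f : hom (sval X) (sval Y)).
Proof.
move=> fm; have [K [i ki]] := has_kernels Aab (f : hom (sval X) (sval Y)).
have pK : p K := sq_sub pc (kernel_mono ki) (svalP X).
apply/(kernel_zeroP ki)/zero_obP/(kernel_mono ki).
by apply: (fm (exist _ K pK : fullsub)) => /=; rewrite !compA ki.1 !comp0m.
Qed.

Lemma fullsub_epi X Y (f : hom X Y) : is_epi f -> is_epi (f : hom (sval X) (sval Y)).
Proof.
move=> fe; have [K [i ki]] := has_cokernels Aab (f : hom (sval X) (sval Y)).
have pK : p K := sq_quo pc (cokernel_epi ki) (svalP Y).
apply/(cokernel_zeroP ki)/zero_obP/(cokernel_epi ki).
by apply: (fe (exist _ K pK : fullsub)) => /=; rewrite -!compA ki.1 !compm0.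
Qed.

Lemma fullsub_kernel X Y Z (f : hom X Y) (i : hom Z X) :
  is_kernel (f : hom (sval X) (sval Y)) (i : hom (sval Z) (sval X)) <-> is_kernel f i.
Proof.
split=> [[fi ker]|[fi ker]]; first by split=> // W g; apply: ker.
have [K [j kj]] := has_kernels Aab (f : hom (sval X) (sval Y)).
have pK : p K := sq_sub pc (kernel_mono kj) (svalP X).
apply: is_kernelI => //.
  by apply: fullsub_mono; apply: kernel_mono; split; [exact: fi | exact: ker].
move=> W g /(kernel_lift kj) [h <-].
have [u [uE _]] := ker (exist _ K pK : fullsub) j kj.1.
by exists ((u : hom K (sval Z)) ∘ h); rewrite compA; congr (_ ∘ _).
Qed.

Lemma fullsub_cokernel X Y Z (f : hom X Y) (q : hom Y Z) :
  is_cokernel (f : hom (sval X) (sval Y)) (q : hom (sval Y) (sval Z)) <-> is_cokernel f q.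
Proof.
split=> [[fi ker]|[fi ker]]; first by split=> // W g; apply: ker.
have [K [j kj]] := has_cokernels Aab (f : hom (sval X) (sval Y)).
have pK : p K := sq_quo pc (cokernel_epi kj) (svalP Y).
apply: is_cokernelI => //.
  by apply: fullsub_epi; apply: cokernel_epi; split; [exact: fi | exact: ker].
move=> W g /(cokernel_desc kj) [h <-].
have [u [uE _]] := ker (exist _ K pK : fullsub) j kj.1.
by exists (h ∘ (u : hom (sval Z) K)); rewrite -compA; congr (_ ∘ _).
Qed.

Lemma fullsub_zero X : is_zero_ob (sval X) <-> is_zero_ob X.
Proof. by split=> /zero_obP X0; apply/zero_obP. Qed.

Lemma fullsub_abelian : is_abelian fullsub.
Proof.
split.
- by have [Z Z0] := has_zero Aab; exists (exist _ Z (sq_zero pc Z0)); apply/fullsub_zero.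
- move=> X Y; have [S [i1 [i2 [p1 [p2 b]]]]] := has_biproducts Aab (sval X) (sval Y).
  exists (exist _ S (sq_sum pc b (svalP X) (svalP Y))), i1, i2, p1, p2.
  by case: b => *; split.
- move=> X Y f; have [K [i ki]] := has_kernels Aab (f : hom (sval X) (sval Y)).
  exists (exist _ K (sq_sub pc (kernel_mono ki) (svalP X))), i.
  exact/fullsub_kernel.
- move=> X Y f; have [K [i ki]] := has_cokernels Aab (f : hom (sval X) (sval Y)).
  exists (exist _ K (sq_quo pc (cokernel_epi ki) (svalP Y))), i.
  exact/fullsub_cokernel.
- move=> X Y f /fullsub_mono fm; have [Q [q kq]] := has_cokernels Aab (f : hom (sval X) (sval Y)).
  exists (exist _ Q (sq_quo pc (cokernel_epi kq) (svalP Y))), q.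
  by apply/fullsub_kernel; apply: mono_is_kernel.
- move=> X Y f /fullsub_epi fm; have [Q [q kq]] := has_kernels Aab (f : hom (sval X) (sval Y)).
  exists (exist _ Q (sq_sub pc (kernel_mono kq) (svalP X))), q.
  by apply/fullsub_cokernel; apply: epi_is_cokernel.
Qed.

Lemma fullsub_locally_finite : is_locally_finite fullsub.
Proof.
move=> [X pX]; elim: (Alf X) pX => {X} [X X0|X Y S i q ki kq Ss _ IH] pX.
  by apply: finite_length0; apply/fullsub_zero.
have pY : p Y := sq_sub pc (kernel_mono ki) pX.
have pS : p S := sq_quo pc (cokernel_epi kq) pX.
apply: (@finite_lengthS _ fullsub (exist _ X pX) (exist _ Y pY) (exist _ S pS) i q).
- exact/fullsub_kernel.
- exact/fullsub_cokernel.
- split=> [/fullsub_zero|Z j /fullsub_mono jm]; first exact: Ss.1.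
  by have [Z0|[g gj]] := Ss.2 _ _ jm; [left; apply/fullsub_zero | right; exists g].
- exact: IH.
Qed.

End FullSubcategory.

Section FullSubmodule.
Context {k : fieldType} {V : moncat k} (M : lax_modcat V) (p : M -> Prop).
Hypothesis pact : forall (X : V) (P : M), p P -> p (X ⊳ P).

Definition fullsub_act : bifunctor V (fullsub p) (fullsub p).
Proof.
exists (fun X P => exist _ (X ⊳ sval P) (pact X (svalP P)) : fullsub p)
  (fun X X' (P P' : fullsub p) f (g : hom (sval P) (sval P')) => f ⊳m g).
- by move=> X X' P P' g; apply: bmor_linl.
- by move=> X X' P P' f; exact: (bmor_linr (act M) f).
- by move=> X P; apply: bmor1.
- by move=> *; apply: bmorM.
Defined.

Definition fullsub_mod : lax_modcat V.
Proof.
exists (fullsub p) fullsub_act (fun X Y P => act_m X Y (sval P)) (fun P => act_l (sval P)).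
- by move=> X X' Y Y' P P' f g h; apply: act_m_nat.
- by move=> P P' h; apply: act_l_nat.
- by move=> X Y Z P; apply: act_pentagon.
- by move=> X P; apply: act_runit.
- by move=> X P; apply: act_lunit.
Defined.

Lemma fullsub_is_modcat : subquotient_closed p -> is_modcat M -> is_modcat fullsub_mod.
Proof.
move=> pc [Mab Mlf [Mb1 Mb2] Mm Ml]; split.
- exact: fullsub_abelian.
- exact: fullsub_locally_finite.
- split=> [X|P]; split=> X1 X2 X3 f i ki.
  + by apply/(fullsub_kernel Mab pc); apply: ((Mb1 X).1); apply/(fullsub_kernel Mab pc).
  + by apply/(fullsub_cokernel Mab pc); apply: ((Mb1 X).2); apply/(fullsub_cokernel Mab pc).
  + by apply/(fullsub_kernel Mab pc); apply: ((Mb2 (sval P)).1).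
  + by apply/(fullsub_cokernel Mab pc); apply: ((Mb2 (sval P)).2).
- by move=> X Y P; have [g gE] := Mm X Y (sval P); exists g.
- by move=> P; have [g gE] := Ml (sval P); exists g.
Qed.

Section Component.
Context (R : M -> M) (pR : forall Q, p (R Q)) (i : forall Q, hom (R Q) Q) (r : forall Q, hom Q (R Q)).
Hypothesis ri : forall Q, r Q ∘ i Q = idm (R Q).
Hypothesis K1 : forall (W Q : M) (f : hom W Q), p W -> i Q ∘ (r Q ∘ f) = f.
Hypothesis K2 : forall (W Q : M) (f : hom Q W), p W -> f ∘ i Q ∘ r Q = f.
Hypothesis K3 : forall (W Q : M) (X : V) (f : hom W (X ⊳ Q)), p W -> (idm X ⊳m (i Q ∘ r Q)) ∘ f = f.

(** [R Q] is the summand of [Q] lying in [p]. By [K1] and [K2], maps between [Q] and objects of [p]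
    pass through it, which makes compression by [r] and [i] multiplicative; [K3] is the same inside
    [X ⊳ Q]. *)
Definition component : functor M fullsub_mod.
Proof.
exists (fun Q => exist _ (R Q) (pR Q) : fullsub p) (fun Q Q' f => r Q' ∘ f ∘ i Q).
- by move=> X Y a f g; rewrite comp_linr comp_linl.
- by move=> X; rewrite compm1 ri.
- by move=> X Y Z g f /=; rewrite -!compA K1.
Defined.

Definition component_c (X : V) (Q : M) : hom (R (X ⊳ Q)) (X ⊳ R Q) := (idm X ⊳m r Q) ∘ i (X ⊳ Q).

Lemma component_nat (X Y : V) (P Q : M) (f : hom X Y) (g : hom P Q) :
  component_c Y Q ∘ (r _ ∘ (f ⊳m g) ∘ i _) = (f ⊳m (r Q ∘ g ∘ i P)) ∘ component_c X P.
Proof.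
rewrite /component_c -!compA K1 //; rewrite [RHS]compA -bmorM compm1 !compA K2 //.
by rewrite -bmorM comp1m.
Qed.

Lemma component_m (X Y : V) (P : M) :
  (idm X ⊳m component_c Y P) ∘ component_c X (Y ⊳ P) ∘ (r _ ∘ act_m X Y P ∘ i _)
  = act_m X Y (R P) ∘ component_c (X ⊗ Y) P.
Proof.
rewrite /component_c -!compA K1 // [LHS]compA -bmorM comp1m K2; last exact: pact.
by rewrite !compA -act_m_nat bmor1.
Qed.

Lemma component_l (P : M) : act_l (R P) ∘ component_c (munit V) P = r P ∘ act_l P ∘ i _.
Proof. by rewrite /component_c compA act_l_nat. Qed.

Lemma component_iso X P : exists g, g ∘ component_c X P = idm _ /\ component_c X P ∘ g = idm _.
Proof.
exists (r (X ⊳ P) ∘ (idm X ⊳m i P)); rewrite /component_c; split.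
  by rewrite -compA (compA (idm X ⊳m i P)) -bmorM comp1m K3 // ri.
by rewrite -compA K1 -?bmorM ?comp1m ?ri ?bmor1 //; apply: pact.
Qed.

End Component.
End FullSubmodule.

Section Decomposition.
Context {k : fieldType} {V : moncat k} (M : lax_modcat V) (p1 p2 : M -> Prop).
Hypothesis p1act : forall (X : V) (P : M), p1 P -> p1 (X ⊳ P).
Hypothesis p2act : forall (X : V) (P : M), p2 P -> p2 (X ⊳ P).
Hypothesis orth12 : forall (W1 W2 : M) (f : hom W1 W2), p1 W1 -> p2 W2 -> f = 0.
Hypothesis orth21 : forall (W2 W1 : M) (f : hom W2 W1), p2 W2 -> p1 W1 -> f = 0.

Record splitting (Q : M) := Splitting {
  spl1 : M; spl2 : M;
  spl_i1 : hom spl1 Q; spl_i2 : hom spl2 Q; spl_r1 : hom Q spl1; spl_r2 : hom Q spl2;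
  spl_b : is_biproduct spl_i1 spl_i2 spl_r1 spl_r2;
  spl_p1 : p1 spl1; spl_p2 : p2 spl2 }.

Variable s : forall Q, splitting Q.
Hypothesis Mab : is_abelian M.

Let ri1 Q : spl_r1 (s Q) ∘ spl_i1 (s Q) = idm _. Proof. by case: (spl_b (s Q)). Qed.
Let ri2 Q : spl_r2 (s Q) ∘ spl_i2 (s Q) = idm _. Proof. by case: (spl_b (s Q)). Qed.
Let ir Q : spl_i1 (s Q) ∘ spl_r1 (s Q) + spl_i2 (s Q) ∘ spl_r2 (s Q) = idm Q.
Proof. by case: (spl_b (s Q)). Qed.

Let K11 (W Q : M) (f : hom W Q) : p1 W -> spl_i1 (s Q) ∘ (spl_r1 (s Q) ∘ f) = f.
Proof.
move=> pW; rewrite -[RHS]comp1m -(ir Q) compDl -!compA.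
by rewrite (orth12 (spl_r2 (s Q) ∘ f) pW (spl_p2 (s Q))) compm0 addr0.
Qed.

Let K21 (W Q : M) (f : hom Q W) : p1 W -> f ∘ spl_i1 (s Q) ∘ spl_r1 (s Q) = f.
Proof.
move=> pW; rewrite -[RHS]compm1 -(ir Q) compDr !compA.
by rewrite (orth21 (f ∘ spl_i2 (s Q)) (spl_p2 (s Q)) pW) comp0m addr0.
Qed.

Let K31 (W Q : M) (X : V) (f : hom W (X ⊳ Q)) : p1 W ->
  (idm X ⊳m (spl_i1 (s Q) ∘ spl_r1 (s Q))) ∘ f = f.
Proof.
move=> pW; rewrite -[RHS]comp1m -bmor1 -(ir Q) bmorDr compDl.
rewrite [X in _ = _ + X](_ : _ = 0) ?addr0 // bmor_compr -compA.
by rewrite (orth12 ((idm X ⊳m spl_r2 (s Q)) ∘ f) pW (p2act X (spl_p2 (s Q)))) compm0.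
Qed.

Let K12 (W Q : M) (f : hom W Q) : p2 W -> spl_i2 (s Q) ∘ (spl_r2 (s Q) ∘ f) = f.
Proof.
move=> pW; rewrite -[RHS]comp1m -(ir Q) compDl -!compA.
by rewrite (orth21 (spl_r1 (s Q) ∘ f) pW (spl_p1 (s Q))) compm0 add0r.
Qed.

Let K22 (W Q : M) (f : hom Q W) : p2 W -> f ∘ spl_i2 (s Q) ∘ spl_r2 (s Q) = f.
Proof.
move=> pW; rewrite -[RHS]compm1 -(ir Q) compDr !compA.
by rewrite (orth12 (f ∘ spl_i1 (s Q)) (spl_p1 (s Q)) pW) comp0m add0r.
Qed.

Let K32 (W Q : M) (X : V) (f : hom W (X ⊳ Q)) : p2 W ->
  (idm X ⊳m (spl_i2 (s Q) ∘ spl_r2 (s Q))) ∘ f = f.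
Proof.
move=> pW; rewrite -[RHS]comp1m -bmor1 -(ir Q) bmorDr compDl.
rewrite [X in _ = X + _](_ : _ = 0) ?add0r // bmor_compr -compA.
by rewrite (orth21 ((idm X ⊳m spl_r1 (s Q)) ∘ f) pW (p1act X (spl_p1 (s Q)))) compm0.
Qed.

Let F1 := component p1act (fun Q => spl_p1 (s Q)) ri1 K11.
Let F2 := component p2act (fun Q => spl_p2 (s Q)) ri2 K12.

Definition decompose : functor M (modcat_sum (fullsub_mod p1act) (fullsub_mod p2act)).
Proof.
exists (fun Q => (F1 Q, F2 Q)) (fun Q Q' f => (fmor F1 f, fmor F2 f)).
- by move=> X Y a f g; congr pair; apply: fmor_lin.
- by move=> X; congr pair; apply: fmor1.
- by move=> X Y Z g f; congr pair; apply: fmorM.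
Defined.

Lemma decompose_full Q Q' (g : hom (decompose Q) (decompose Q')) : exists f, fmor decompose f = g.
Proof.
pose g1 : hom (spl1 (s Q)) (spl1 (s Q')) := g.1.
pose g2 : hom (spl2 (s Q)) (spl2 (s Q')) := g.2.
exists (spl_i1 (s Q') ∘ g1 ∘ spl_r1 (s Q) + spl_i2 (s Q') ∘ g2 ∘ spl_r2 (s Q)).
have [_ _ e3 e4 _] := spl_b (s Q); have [_ _ f3 f4 _] := spl_b (s Q').
rewrite [RHS](surjective_pairing g); congr pair; rewrite /= compDr compDl -!compA.
  by rewrite e4 ri1 !compm0 addr0 compm1 compA ri1 comp1m.
by rewrite e3 ri2 !compm0 add0r compm1 compA ri2 comp1m.
Qed.

(** By orthogonality the off-diagonal components of a morphism vanish, so the two diagonal ones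
    determine it. *)
Lemma decompose_faithful : faithful decompose.
Proof.
move=> Q Q' f g; case=> e1 e2; rewrite -[LHS]compm1 -[RHS]compm1 -(ir Q) !compDr !compA.
rewrite -(K11 (f ∘ spl_i1 (s Q)) (spl_p1 _)) -(K12 (f ∘ spl_i2 (s Q)) (spl_p2 _)).
by rewrite !(compA _ f) e1 e2 -!(compA _ g) K11 ?K12 //; apply: spl_p1 || apply: spl_p2.
Qed.

Lemma decompose_surj (Y : modcat_sum (fullsub_mod p1act) (fullsub_mod p2act)) :
  exists Q, isomorphic (decompose Q) Y.
Proof.
case: Y => [[Y1 pY1] [Y2 pY2]].
have [S [i1 [i2 [r1 [r2 [a1 a2 a3 a4 a5]]]]]] := has_biproducts Mab Y1 Y2.
exists S, (r1 ∘ spl_i1 (s S), r2 ∘ spl_i2 (s S)), (spl_r1 (s S) ∘ i1, spl_r2 (s S) ∘ i2).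
split; congr pair; rewrite /=.
- rewrite -compA (compA i1) -[idm (spl1 _)]ri1.
  rewrite -[in RHS](comp1m (spl_i1 (s S))) -a5 compDl -!compA.
  by rewrite (orth12 (r2 ∘ _) (spl_p1 _) pY2) compm0 addr0.
- rewrite -compA (compA i2) -[idm (spl2 _)]ri2.
  rewrite -[in RHS](comp1m (spl_i2 (s S))) -a5 compDl -!compA.
  by rewrite (orth21 (r1 ∘ _) (spl_p2 _) pY1) compm0 add0r.
- by rewrite -compA K11.
- by rewrite -compA K12.
Qed.

Lemma decompose_equivalent :
  modcat_equivalent M (modcat_sum (fullsub_mod p1act) (fullsub_mod p2act)).
Proof.
exists decompose, (fun X P => (component_c (fun Q => spl_i1 (s Q)) (fun Q => spl_r1 (s Q)) X P,
  component_c (fun Q => spl_i2 (s Q)) (fun Q => spl_r2 (s Q)) X P)); split; last first.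
  exact: fully_faithful_equivalence decompose_full decompose_faithful decompose_surj.
split; last first.
  move=> X P.
  have [g1 [g1E g1E']] := component_iso p1act (fun Q => spl_p1 (s Q)) ri1 K11 K31 X P.
  have [g2 [g2E g2E']] := component_iso p2act (fun Q => spl_p2 (s Q)) ri2 K12 K32 X P.
  by exists (g1, g2); split; congr pair.
split.
- exact: fully_faithful_left_exact decompose_full decompose_faithful decompose_surj.
- move=> X Y P Q f g; congr pair.
    exact: (component_nat (fun Q => spl_p1 (s Q)) K11 K21).
  exact: (component_nat (fun Q => spl_p2 (s Q)) K12 K22).
- move=> X Y P; congr pair.
    exact: (component_m p1act (fun Q => spl_p1 (s Q)) K11 K21).
  exact: (component_m p2act (fun Q => spl_p2 (s Q)) K12 K22).
- move=> P; congr pair.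
    exact: (component_l (fun Q => spl_i1 (s Q)) (fun Q => spl_r1 (s Q))).
  exact: (component_l (fun Q => spl_i2 (s Q)) (fun Q => spl_r2 (s Q))).
Qed.

End Decomposition.

(** * Generators and simplicity *)

Section HopfModuleCategories.
Context {k : fieldType} {C : moncat k} {T : hopf_monad C}.
Local Notation V := (hopf_modules T).
Local Notation L := (hopf_free T).
Hypotheses (Cft : is_finite_tensor_category C) (Tr : right_exact T) (Tf : faithful T).

Let Cab : is_abelian C := let: conj (And5 h _ _ _ _) _ := Cft in h.
Let Crig : is_rigid C := let: conj (And5 _ h _ _ _) _ := Cft in h.
Let Clf : is_locally_finite C := let: conj (And5 _ _ h _ _) _ := Cft in h.

Lemma finite_tensor_enough_projectives (X : C) :
  exists (Q : C) (p : hom Q X), is_projective Q /\ is_epi p.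
Proof.
have [n [P Pgen]] := finite_cat_generators Cft.2.
exact: (enough_projectives Cab Clf Pgen).
Qed.

Lemma hopf_dual (Y : V) : exists (Y' : V)
  (ev : hom (Y' ⊗ Y) (munit V)) (coev : hom (munit V) (Y ⊗ Y')), is_left_dual ev coev.
Proof. exact: (hopf_modules_left_dual Crig.1). Qed.

Lemma hopf_unit_cover : exists (Y : V) (e : hom Y (munit V)), is_projective Y /\ is_epi e.
Proof.
have [Q [p [Qp pe]]] := finite_tensor_enough_projectives (munit C).
exists (em_free T Q), (em_counit (hopf_unit T) ∘ fmor (em_free T) p); split.
  exact: (em_free_projective Cab Tr Qp).
apply: epi_comp; first exact: (em_counit_epi (T := T)).
exact: (left_adjoint_epi (em_adjunction T) pe).
Qed.

Context {M : lax_modcat V} (Mmod : is_modcat M) (Mex : is_exact_modcat M).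

Let Mbi : biexact (act M) := let: And5 _ _ h _ _ := Mmod in h.
Let Ml : forall P : M, is_iso (act_l P) := let: And5 _ _ _ _ h := Mmod in h.

Lemma free_act_right_exact (P : M) : right_exact (free_act L P).
Proof.
move=> X Y Q f q kq; apply: ((Mbi.2 P).2).
exact: (left_adjoint_right_exact (em_adjunction T) kq).
Qed.

(** Left exactness of [T] enters here: the free functor inherits it, and the action on [P] is
    exact. *)
Lemma free_act_left_exact (P : M) : left_exact (free_act L P).
Proof.
move=> X Y Q f q kq; apply: ((Mbi.2 P).1).
exact: (em_left_exact (hopf_monad_exact Cft Tr Tf).1 kq).
Qed.

Lemma free_act_projective (P : M) X : is_projective X -> is_projective (free_act L P X).
Proof. by move=> Xp; apply: Mex.2; apply: (em_free_projective Cab Tr Xp). Qed.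

Lemma free_act_right_adjoint (P : M) : exists G, inhabited (adjunction (free_act L P) G).
Proof.
have [n [P' Pgen]] := finite_cat_generators Cft.2.
exact: (right_exact_has_right_adjoint Cab Clf Pgen (free_act_right_exact P)).
Qed.

(** The form [Y ⊳ Q] of the cover matters as much as its projectivity: a class of objects stable
    under the action contains it along with [Q]. *)
Lemma module_cover (Q : M) : exists (Y : V) (e : hom (Y ⊳ Q) Q), is_projective (Y ⊳ Q) /\ is_epi e.
Proof.
have [Y [e [Yp ee]]] := hopf_unit_cover.
exists Y, (act_l Q ∘ (e ⊳m idm Q)); split; first exact: Mex.2.
apply: epi_comp; first exact/iso_epi/Ml.
have [K [i ki]] := em_epi_cokernel Cab Tr ee.
exact: (cokernel_epi ((Mbi.2 Q).2 _ _ _ _ _ ki)).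
Qed.

End HopfModuleCategories.

(* For a simple P, the objects Q killed by the right adjoint G of X |-> L X ⊳ P form a direct
   summand of M, complementary to the objects generated by P. *)
Section Generation.
Context {k : fieldType} {C : moncat k} {T : hopf_monad C}.
Local Notation V := (hopf_modules T).
Local Notation L := (hopf_free T).
Hypotheses (Cft : is_finite_tensor_category C) (Tr : right_exact T).
Context {M : lax_modcat V} (Mmod : is_modcat M) (Mex : is_exact_modcat M).
Context (P : M) {G : functor M C} (adj : adjunction (free_act L P) G).

Let Cab : is_abelian C := let: conj (And5 h _ _ _ _) _ := Cft in h.
Let Mab : is_abelian M := let: And5 h _ _ _ _ := Mmod in h.
Let Mm : forall (X Y : V) (P : M), is_iso (act_m X Y P) := let: And5 _ _ _ h _ := Mmod in h.
Let Ml : forall P : M, is_iso (act_l P) := let: And5 _ _ _ _ h := Mmod in h.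

Lemma free_act_radj_right_exact : right_exact G.
Proof.
apply: (left_exact_epi_exact Mab Cab (right_adjoint_left_exact adj)) => X Y f.
apply: (right_adjoint_epi adj (finite_tensor_enough_projectives Cft)) => Q.
exact: free_act_projective.
Qed.

Let Gr := free_act_radj_right_exact.

Definition torsion (Q : M) := is_zero_ob (G Q).

Definition torsion_free (Q : M) := forall W (f : hom W Q), torsion W -> f = 0.

Lemma torsion_closed : subquotient_closed torsion.
Proof.
split=> [X|X Y f fm|X Y f fe|X Y S i1 i2 p1 p2 b X0 Y0].
- exact: fmor_zero_ob.
- exact: zero_ob_mono (right_adjoint_mono adj fm).
- exact: zero_ob_epi (right_exact_epi Mab Gr fe).
have [_ _ _ _ e] := fmor_biproduct G b; apply/zero_obP; rewrite -e.
by rewrite (X0.1 _ (fmor G i1)) (Y0.1 _ (fmor G i2)) !comp0m addr0.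
Qed.

Lemma torsion_act (Y : V) (Q : M) : torsion Q -> torsion (Y ⊳ Q).
Proof.
move=> Q0; apply: (zero_ob_iso (radj_act_iso (hopf_free_counits T) Mm Ml (hopf_dual Cft) adj
  (free_act_opmodule L P) Y Q)).
exact: bmor_zero_ob2.
Qed.

(** A torsion [W] has a projective cover [Y ⊳ W] that is again torsion. A map from [W] to [Y],
    pulled back to this cover, lifts to the torsion-free [X] and so vanishes. *)
Lemma torsion_free_quotient (X Y : M) (e : hom X Y) : is_epi e -> torsion_free X -> torsion_free Y.
Proof.
move=> ee Xf W f W0; have [Z [p [Zp pe]]] := module_cover Cft Tr Mmod Mex W.
have [g gE] := Zp _ _ e (f ∘ p) ee.
by apply: (epiP p).1 => //; rewrite -gE (Xf _ g) ?compm0 //; apply: torsion_act.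
Qed.

(** By duality a map [W -> Y ⊳ Q] corresponds to a map [Y' ⊳ W -> Q], whose source is again
    torsion. *)
Lemma torsion_free_act (Y : V) (Q : M) : torsion_free Q -> torsion_free (Y ⊳ Q).
Proof.
move=> Qf W f W0; have [Y' [ev [coev d]]] := hopf_dual Cft Y.
apply: (ladj_inj (adj := dual_adjunction Mm Ml d)).
by rewrite (Qf _ (_ ∘ _)) ?(Qf _ (_ ∘ fmor _ 0)) //; apply: torsion_act.
Qed.

Lemma torsion_free_closed : subquotient_closed torsion_free.
Proof.
split=> [X X0 W f _|X Y f fm Yf W g W0|X Y f|X Y S i1 i2 p1 p2 [_ _ _ _ e] Xf Yf W f W0].
- exact: X0.2.
- by apply: (monoP f).1 => //; apply: Yf.
- exact: torsion_free_quotient.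
rewrite -[LHS]comp1m -e compDl -!compA.
by rewrite (Xf _ (p1 ∘ f)) // (Yf _ (p2 ∘ f)) // !compm0 addr0.
Qed.

Lemma torsion_free_torsion (W Q : M) (f : hom W Q) : torsion_free W -> torsion Q -> f = 0.
Proof.
move=> Wf Q0; have [I [e [m [ee mm ->]]]] := image Mab f.
have I0 : torsion I := sq_sub torsion_closed mm Q0.
by rewrite -(comp1m e) (torsion_free_quotient ee Wf (idm I) I0) comp0m compm0.
Qed.

Hypothesis (Pf : torsion_free P).

(** The torsion-free part is the image of the counit and the torsion part its cokernel. The clause
    [True] turns inhabitation of the type [splitting] into an existential to which [cid] applies. *)
Lemma torsion_splitting (Q : M) : exists s : splitting torsion_free torsion Q, True.
Proof.
have [Q2 [q kq]] := has_cokernels Mab (acounit adj Q).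
have qe := cokernel_epi kq.
(* [G] sends the counit to a split epimorphism, so it kills [q]; right exactness then makes [G Q2]
   zero. *)
have Q20 : torsion Q2.
  have Gq0 : fmor G q = 0.
    apply: (split_epi (atri2 adj Q)).
    by rewrite comp0m -fmorM kq.1 fmor0.
  by apply/zero_obP/(right_exact_epi Mab Gr qe); rewrite Gq0 !compm0.
have [I [e [t [ee kt _]]]] := cokernel_of_epi_kernel Mab kq.
have If : torsion_free I by apply: torsion_free_quotient ee _; apply: torsion_free_act.
have [Y [p [Yp pe]]] := module_cover Cft Tr Mmod Mex Q2.
have [g gE] := Yp _ _ q p qe.
have [K [i ki]] := has_kernels Mab p.
have [|u uE] := kernel_lift (g := g ∘ i) kt; first by rewrite compA gE ki.1.
(* [K] is torsion as a subobject of [Y ⊳ Q2], and [I] is torsion-free. Hence the lift [g] of the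
   cover vanishes on [K] and descends to a section of [q]. *)
have u0 : u = 0.
  by apply: If; apply: (sq_sub torsion_closed (kernel_mono ki)); apply: torsion_act.
have [|s sE] := cokernel_desc (g := g) (epi_is_cokernel Mab pe ki); first by rewrite -uE u0 compm0.
have qs : q ∘ s = idm Q2 by apply: pe; rewrite -compA sE gE comp1m.
have [|r rE] := kernel_lift (g := idm Q - s ∘ q) kt.
  by rewrite compBr compA qs comp1m compm1 subrr.
have tm := kernel_mono kt.
have b : is_biproduct t s r q.
  split=> //; last by rewrite rE subrK.
  - by apply: tm; rewrite compA rE compBl -compA kt.1 compm0 subr0 comp1m compm1.
  - by apply: tm; rewrite compA rE compBl -compA qs comp1m compm1 subrr compm0.
  - exact: kt.1.
by exists (Splitting b If Q20).
Qed.

Hypotheses (Mind : is_indecomposable M) (P0 : ~ is_zero_ob P).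

Lemma torsion_zero (Q : M) : torsion Q -> is_zero_ob Q.
Proof.
move=> Q0; apply: contrapT => Qnz; apply: Mind.
exists (fullsub_mod torsion_free_act), (fullsub_mod torsion_act); split.
- split; first exact: fullsub_is_modcat torsion_free_closed Mmod.
  by move/(_ (exist _ P Pf))/fullsub_zero.
- split; first exact: fullsub_is_modcat torsion_closed Mmod.
  by move/(_ (exist _ Q Q0))/fullsub_zero.
apply: (@decompose_equivalent _ _ M torsion_free torsion torsion_free_act torsion_act
  torsion_free_torsion (fun W2 W1 f h1 h2 => h2 W2 f h1)
  (fun Q => projT1 (cid (torsion_splitting Q))) Mab).
Qed.

Lemma counit_epi_of_torsion (Q : M) : is_epi (acounit adj Q).
Proof.
have [Q2 [q kq]] := has_cokernels Mab (acounit adj Q).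
apply/(cokernel_zeroP kq)/torsion_zero.
have Gq0 : fmor G q = 0.
  by apply: (split_epi (atri2 adj Q)); rewrite comp0m -fmorM kq.1 fmor0.
by apply/zero_obP/(right_exact_epi Mab Gr (cokernel_epi kq)); rewrite Gq0 !compm0.
Qed.

End Generation.

(** * Simple objects generate *)

Section SimpleGenerates.
Context {k : fieldType} {C : moncat k} {T : hopf_monad C}.
Local Notation V := (hopf_modules T).
Local Notation L := (hopf_free T).
Hypotheses (Cft : is_finite_tensor_category C) (Tr : right_exact T).
Context {M : lax_modcat V} (Mmod : is_modcat M) (Mex : is_exact_modcat M).

Let Cab : is_abelian C := let: conj (And5 h _ _ _ _) _ := Cft in h.
Let Mab : is_abelian M := let: And5 h _ _ _ _ := Mmod in h.

(** A nonzero map from a torsion object would be epi, so [G P] would vanish, and with it all maps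
    [L 1 ⊳ P -> P]. But the counit [L 1 -> 1], acting on [P], is an epimorphism onto a nonzero
    object. *)
Lemma simple_torsion_free (P : M) (G : functor M C) (adj : adjunction (free_act L P) G) :
  is_simple P -> torsion_free (G := G) P.
Proof.
move=> Ps W f W0; apply: contrapT => f0.
have fe := simple_epi Mab Ps f0.
have GP0 : is_zero_ob (G P).
  exact: zero_ob_epi (right_exact_epi Mab (free_act_radj_right_exact Cft Tr Mmod Mex adj) fe) W0.
have phie : is_epi (cm_phi L).
  apply/epiP => Y g /(congr1 vsval) gE; apply: val_inj.
  have gE' : vsval g ∘ hopf_phi T = 0 := gE.
  by rewrite -[LHS](compm1 (vsval g)) -(hopf_eta_phi T) compA gE' comp0m.
have [K [i ki]] := em_epi_cokernel Cab Tr phie.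
case: Mmod => _ _ Mbi _ Ml.
have e : is_epi (act_l P ∘ (cm_phi L ⊳m idm P)).
  apply: epi_comp; first exact/iso_epi/Ml.
  exact: (cokernel_epi ((Mbi.2 P).2 _ _ _ _ _ ki)).
apply: Ps.1; apply/zero_obP/e; rewrite comp1m comp0m.
apply: (radj_inj (adj := adj)).
by rewrite (GP0.2 _ (_ ∘ _)) (GP0.2 _ (fmor G 0 ∘ _)).
Qed.

Hypothesis (Mind : is_indecomposable M).

Definition generates (P : M) := forall Q, exists (X : C) (e : hom (free_act L P X) Q), is_epi e.

Lemma simple_generates (P : M) : is_simple P -> generates P.
Proof.
move=> Ps Q; have [G [adj]] := free_act_right_adjoint Cft Mmod P.
exists (G Q), (acounit adj Q).
exact: (counit_epi_of_torsion Cft Tr Mmod Mex (simple_torsion_free adj Ps) Mind Ps.1).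
Qed.

Lemma generates_faithful (P : M) (G : functor M C) (adj : adjunction (free_act L P) G) :
  generates P -> faithful G.
Proof.
move=> Pg X Y f g fg; have [W [e ee]] := Pg X; apply: ee.
by apply: (radj_inj (adj := adj)); rewrite !fmorM fg.
Qed.

Lemma generator_exists : exists P, generates P.
Proof.
have [[Q Q0]|triv] := EM (exists Q : M, ~ is_zero_ob Q).
  case: (Mmod) => _ Mlf _ _ _.
  have [S [p [Ss _]]] := simple_quotient (Mlf Q) Q0.
  by exists S; apply: simple_generates.
(* If [M] is zero there is no simple object, and any map is an epimorphism. *)
have [Z Z0] := has_zero Mab; exists Z => Q; exists (munit C), 0; apply/epiP => W g _.
have [Q0 _] : is_zero_ob Q by apply: contrapT => nQ; apply: triv; exists Q.
exact: Q0.
Qed.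

End SimpleGenerates.

(** * The regular module category *)

Section Regular.
Context {k : fieldType} {C : moncat k} (Cft : is_finite_tensor_category C).

Let Cab : is_abelian C := let: conj (And5 h _ _ _ _) _ := Cft in h.
Let Crig : is_rigid C := let: conj (And5 _ h _ _ _) _ := Cft in h.
Let C1 : is_simple (munit C) := let: conj (And5 _ _ _ h _) _ := Cft in h.

Lemma reg_modcat : is_modcat (reg C).
Proof.
case: Cft => [[_ _ Clf _ _] _]; split=> //.
- by split=> X; [apply: left_mul_exact | apply: right_mul_exact].
- by move=> X Y P; apply: assoc_iso.
- by move=> P; apply: lunit_iso.
Qed.

Lemma reg_exact : is_exact_modcat (reg C).
Proof. by split; [exact: Cft.2 | move=> P Q; apply: projective_tensl]. Qed.

Lemma simple_idempotent (A : lincat k) (S : A) (e : hom S S) : is_abelian A -> is_simple S ->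
  e ∘ e = e -> e = 0 \/ e = idm S.
Proof.
move=> Aab Ss ee; have [|e0] := EM (e = 0); first by left.
by right; apply: (simple_mono Aab Ss e0); rewrite ee compm1.
Qed.

(** The projection of [F 1] onto its first component corresponds to an idempotent of the simple
    unit, so one component of [F 1] is zero. Every object of the sum has the form [W ⊳ F 1], so that
    summand is trivial. *)
Lemma reg_indecomposable : is_indecomposable (reg C).
Proof.
move=> [M1 [M2 [[M1mod M1nt] [M2mod M2nt] [F [c [[Fc ci] [G [[a [a_nat ai]] [b [b_nat bi]]]]]]]]]].
have Gf : faithful G.
  move=> X Y f g fg; apply: (iso_epi (bi X)).
  by have := b_nat _ _ f; have := b_nat _ _ g; rewrite /= fg => -> ->.
pose A1 := (F (munit C)).1; pose A2 := (F (munit C)).2.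
pose e : hom (F (munit C)) (F (munit C)) := (idm A1, 0).
have ee : e ∘ e = e by congr pair; rewrite /= (comp1m, comp0m).
pose e' := a (munit C) ∘ fmor G e ∘ inv (ai (munit C)).
have Ge : fmor G e = inv (ai (munit C)) ∘ e' ∘ a (munit C).
  by rewrite /e' !compA invK comp1m -compA invK compm1.
have e'e' : e' ∘ e' = e'.
  by rewrite /e' -!compA (compA (inv _)) invK comp1m (compA (fmor G e)) -fmorM ee.
have decomp X : exists W : C, isomorphic ((W ⊳ F (munit C)) : modcat_sum M1 M2) X.
  exists (G X), (b X ∘ fmor F (runit (G X)) ∘ inv (ci (G X) (munit C))).
  apply: comp_iso (inv_iso _); apply: comp_iso => //.
  exact: (fmor_iso F (runit_iso (G X))).
have [Z1 _] := has_zero (let: And5 h _ _ _ _ := M1mod in h).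
have [Z2 _] := has_zero (let: And5 h _ _ _ _ := M2mod in h).
case: (simple_idempotent Cab C1 e'e') => e'E.
  apply: M1nt => X; have [W [f [g [_ fg]]]] := decomp ((X, Z2) : modcat_sum M1 M2).
  have e0 : e = 0 by apply: Gf; rewrite Ge e'E compm0 comp0m fmor0.
  have A10 : is_zero_ob A1 by apply/zero_obP; exact: (congr1 fst e0).
  have WA0 := bmor_zero_ob2 (act M1) W A10.
  apply/zero_obP; rewrite -[LHS](congr1 fst fg) /=.
  by rewrite (WA0.1 _ f.1) comp0m.
apply: M2nt => X; have [W [f [g [_ fg]]]] := decomp ((Z1, X) : modcat_sum M1 M2).
have e1 : e = idm _ by apply: Gf; rewrite Ge e'E compm1 invK fmor1.
have A20 : is_zero_ob A2 by apply/zero_obP; exact: (esym (congr1 snd e1)).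
have WA0 := bmor_zero_ob2 (act M2) W A20.
apply/zero_obP; rewrite -[LHS](congr1 snd fg) /=.
by rewrite (WA0.1 _ f.2) comp0m.
Qed.

End Regular.

(* Given a surjective morphism a from U = GH to U', call an object Q of M good if the action
   U (G Q) -> G Q vanishes on the kernel of a, i.e. if it is a module over U'. Good objects are
   stable under quotients and under the action of the T-modules, and there is a simple good one,
   which generates M. Hence all free U-modules are good, so that a is mono. *)
Section Simplicity.
Context {k : fieldType} {C : moncat k} {T : hopf_monad C}.
Local Notation V := (hopf_modules T).
Local Notation L := (hopf_free T).
Hypotheses (Cft : is_finite_tensor_category C) (Tr : right_exact T).
Context {M : lax_modcat V} (Mmod : is_modcat M) (Mex : is_exact_modcat M).
Hypothesis (Mind : is_indecomposable M).
Context {P : M} {G : functor M C} (adj : adjunction (free_act L P) G).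
Local Notation H := (free_act L P).
Local Notation eps := (acounit adj).
Local Notation eta := (aunit adj).

Let Cab : is_abelian C := let: conj (And5 h _ _ _ _) _ := Cft in h.
Let Crig : is_rigid C := let: conj (And5 _ h _ _ _) _ := Cft in h.
Let Mab : is_abelian M := let: And5 h _ _ _ _ := Mmod in h.
Let Mlf : is_locally_finite M := let: And5 _ h _ _ _ := Mmod in h.
Let Mm : forall (X Y : V) (P : M), is_iso (act_m X Y P) := let: And5 _ _ _ h _ := Mmod in h.
Let Ml : forall P : M, is_iso (act_l P) := let: And5 _ _ _ _ h := Mmod in h.
Let Gr : right_exact G := free_act_radj_right_exact Cft Tr Mmod Mex adj.
Let Cproj := finite_tensor_enough_projectives Cft.

Local Notation c := (eqv_str Mm Ml (hopf_dual Cft) adj (free_act_opmodule L P)).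

Context (U' : equivariant T (reg C)) (a : forall N : C, hom (G (H N)) (U' N)).
Hypothesis U'nz : ~ forall N : C, is_zero_ob (U' N : C).
Hypothesis a_nat : forall (N N' : C) (f : hom N N'), a N' ∘ fmor G (fmor H f) = fmor U' f ∘ a N.
Hypothesis a_c : forall X N : C,
  (eqv_c U' X N : hom (U' (X ⊗ N) : C) (T X ⊗ U' N)) ∘ a (X ⊗ N) = (idm (T X) ⊗m a N) ∘ c X N.
Hypothesis a_mu : forall N : C,
  a N ∘ fmor G (eps (H N)) = monad_mu U' N ∘ a (U' N) ∘ fmor G (fmor H (a N)).
Hypothesis a_eta : forall N : C, a N ∘ eta N = monad_eta U' N.
Hypothesis a_epi : forall N : C, is_epi (a N).

Definition good (Q : M) := forall W (f : hom W (G (H (G Q)))), a (G Q) ∘ f = 0 -> fmor G (eps Q) ∘ f = 0.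

(** After a projective cover, [f] lifts to [f1] over [Q]. Its image under [a] comes from [U'] of the
    kernel of [fmor G e]; subtracting a lift of that part leaves a map killed by [a], to which
    goodness of [Q] applies, and the subtracted part dies in [G Q']. *)
Lemma good_quotient (Q Q' : M) (e : hom Q Q') : is_epi e -> good Q -> good Q'.
Proof.
move=> ee Qg W f af; have Gee := right_exact_epi Mab Gr ee.
have [R [p [Rp pe]]] := Cproj W.
have UGee : is_epi (fmor G (fmor H (fmor G e))).
  exact: (right_exact_epi Mab Gr (left_adjoint_epi adj Gee)).
have [f1 f1E] := Rp _ _ _ (f ∘ p) UGee.
have [K [i ki]] := has_kernels Cab (fmor G e).
have kU' := modfun_left_exact (eqv_c_modfun U') ki.
have [|x xE] := kernel_lift (g := a (G Q) ∘ f1) kU'.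
  by rewrite compA -[fmor _ _ ∘ _]a_nat -compA f1E compA af comp0m.
have [y yE] := Rp _ _ _ x (a_epi (N := K)).
have f2 : fmor G (eps Q) ∘ (f1 - fmor G (fmor H i) ∘ y) = 0.
  by apply: Qg; rewrite compBr compA a_nat -compA yE xE subrr.
apply: (epiP p).1 => //; rewrite -compA -f1E compA -!fmorM acounit_nat fmorM -compA.
rewrite -[f1](subrK (fmor G (fmor H i) ∘ y)) compDr f2 add0r !compA -!fmorM.
by rewrite -acounit_nat -compA -!fmorM ki.1 !fmor0 compm0 fmor0 comp0m.
Qed.

(** Through [G (Y ⊳ Q) ≅ Y ⊗ G Q] the action of [U] is [c] followed by the actions on the two
    factors. As [a] respects [c] and [T Y ⊗ -] preserves the kernel of [a], vanishing is inherited
    from [G Q]. *)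
Lemma good_act (Y : V) (Q : M) : good Q -> good (Y ⊳ Q).
Proof.
move=> Qg W f af.
pose d := radj_act_iso (hopf_free_counits T) Mm Ml (hopf_dual Cft) adj (free_act_opmodule L P) Y Q.
apply: (iso_mono (inv_iso d)); rewrite compm0 compA.
have -> := inv_radj_act_counit Mm Ml (hopf_dual Cft) adj (free_act_opmodule L P) Y Q.
rewrite -/d -!compA; set f' := fmor G (fmor H (inv d)) ∘ f.
have af' : a (em_car Y ⊗ G Q) ∘ f' = 0 by rewrite /f' compA a_nat -compA af compm0.
have [K [i ki]] := has_kernels Cab (a (G Q)).
have [|z <-] := kernel_lift (g := c (em_car Y) (G Q) ∘ f') ((left_mul_exact Crig (T (em_car Y))).1 _ _ _ _ _ ki).
  by rewrite /= compA -a_c -compA af' compm0.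
by rewrite /= compA -bmorM (Qg _ i ki.1) bmor0r comp0m.
Qed.

Lemma good_generates (Q : M) : is_simple Q -> good Q -> forall R, good R.
Proof.
move=> Qs Qg R; have [X [e ee]] := simple_generates Cft Tr Mmod Mex Mind Qs R.
by apply: (good_quotient ee); apply: good_act.
Qed.

(** A nonzero free [U']-module, restricted along [a], is a U-module and thus of the form [G Q]; this
    [Q] is good, and so is any simple quotient of it. *)
Lemma good_exists : exists Q, is_simple Q /\ good Q.
Proof.
have [N N0] : exists N : C, ~ is_zero_ob (U' N : C) by apply/existsNP.
pose s : hom (G (H (U' N))) (U' N) := monad_mu U' N ∘ a (U' N).
have sM : s ∘ fmor (adj_monad adj) s = s ∘ monad_mu (adj_monad adj) (U' N).
  rewrite -[LHS]/(s ∘ fmor G (fmor H s)) -[RHS]/(s ∘ fmor G (eps (H (U' N)))).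
  rewrite /s -!compA a_mu !fmorM (compA (a _)) a_nat !compA.
  by rewrite monad_muA.
have s1 : s ∘ monad_eta (adj_monad adj) (U' N) = idm (U' N).
  by rewrite -[LHS]/(s ∘ eta (U' N)) /s -compA a_eta monad_mu1.
have [Q [u ui]] := comparison_surj Mab Gr (EMOb sM s1).
have uE : vsval u ∘ fmor G (eps Q) = s ∘ fmor G (fmor H (vsval u)) := em_homE u.
have vi : is_iso (vsval u : hom (G Q) (U' N)).
  by have [v [vu uv]] := ui; exists (vsval v); split; [exact: (congr1 vsval vu) | exact: (congr1 vsval uv)].
have Qg : good Q.
  move=> W f af; apply: (iso_mono vi); rewrite compm0 compA uE /s -!compA (compA (a _)) a_nat.
  by rewrite -compA af !compm0.
have [|S [p [Ss pe]]] := simple_quotient (Mlf Q).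
  by move=> Q0; apply/N0/(zero_ob_iso vi)/fmor_zero_ob.
by exists S; split=> //; apply: good_quotient pe Qg.
Qed.

Lemma quotient_iso (N : C) : is_iso (a N).
Proof.
have [Q [Qs Qg]] := good_exists.
apply: (mono_epi_iso Cab) => //; apply/monoP => W g ag.
(* Goodness of [H N] is applied to [g] followed by [U] of the unit; the multiplication of [U] then
   gives [g] back, so [g = 0]. *)
have := @good_generates Q Qs Qg (H N) W (fmor G (fmor H (eta N)) ∘ g).
rewrite compA a_nat -compA ag compm0 compA -fmorM atri1 fmor1 comp1m.
exact.
Qed.

Hypothesis U_left_exact : left_exact (adj_monad adj).
Local Notation U := (adjoint_equivariant Mm Ml (hopf_dual Cft) (free_act_opmodule L P) U_left_exact).

Lemma quotient_eqv_iso : is_eqv_morphism (U := U) (U' := U') a -> is_eqv_iso (U := U) (U' := U') a.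
Proof.
move=> am; split=> //; have ai := quotient_iso.
exists (fun N => inv (ai N)); split; last by move=> N; rewrite invK invKV.
have b_nat (N N' : C) (f : hom N N') :
    inv (ai N') ∘ fmor U' f = fmor G (fmor H f) ∘ inv (ai N).
  apply: (iso_epi (ai N)); rewrite -!compA invK compm1 -a_nat.
  by rewrite compA invK comp1m.
split.
- split=> [N N' f|X N]; first exact: b_nat.
  rewrite -[LHS]/(c X N ∘ inv (ai (X ⊗ N))).
  rewrite -[RHS]/((fmor T (idm X) ⊗m inv (ai N)) ∘ (eqv_c U' X N : hom (U' (X ⊗ N) : C) (T X ⊗ U' N))).
  apply: (iso_epi (ai (X ⊗ N))); rewrite -!compA invK compm1 a_c fmor1.
  by rewrite compA -bmorM comp1m invK bmor1 comp1m.
- move=> N.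
  rewrite -[RHS]/(fmor G (eps (H N)) ∘ inv (ai (G (H N))) ∘ fmor U' (inv (ai N))).
  apply: (iso_epi (ai (U' N))); apply: (iso_epi (fmor_iso G (fmor_iso H (ai N)))).
  rewrite -!compA (compA (monad_mu U' N)) -a_mu compA invK comp1m.
  rewrite (compA (fmor U' _)) -a_nat -!compA -!fmorM invK !fmor1 compm1.
  by rewrite invK compm1.
- by move=> N; rewrite -a_eta compA invK comp1m.
Qed.

End Simplicity.

(** * The regular module category, the monad of the adjunction and the comparison functor *)

Theorem corollary4p13 (k : closedFieldType) (k_char0 : [pchar k]%R =i pred0)
    (C : moncat k) (C_finite_tensor : is_finite_tensor_category C)
    (T : hopf_monad C) (T_right_exact : right_exact T) (T_faithful : faithful T)
    (M : lax_modcat (hopf_modules T)) (M_modcat : is_modcat M)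
    (M_exact : is_exact_modcat M) (M_indec : is_indecomposable M) :
  exists (N : lax_modcat C) (U : equivariant T N),
    [/\ is_modcat N, is_indecomposable N /\ is_exact_modcat N,
        is_simple_eqv U, is_exact_eqv U
      & modcat_equivalent M (eqv_modules U)].
Proof.
have [[Cab _ _ _ _] _] := C_finite_tensor.
have [P Pg] := generator_exists C_finite_tensor T_right_exact M_modcat M_exact M_indec.
have [G [adj]] := free_act_right_adjoint C_finite_tensor M_modcat P.
have Gr := free_act_radj_right_exact C_finite_tensor T_right_exact M_modcat M_exact adj.
have Ul : left_exact (adj_monad adj).
  move=> X Y K f i ki; apply: (right_adjoint_left_exact adj).
  exact (free_act_left_exact C_finite_tensor T_right_exact T_faithful M_modcat P ki).
have Ur : right_exact (adj_monad adj).
  by move=> X Y K f q kq; apply: Gr; apply: (left_adjoint_right_exact adj).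
have Mab : is_abelian M by case: M_modcat.
have Gf := generates_faithful adj Pg.
(* Left exactness [Ul] is already required to form the equivariant structure, not only for its
   exactness. *)
exists (reg C), (adjoint_equivariant (let: And5 _ _ _ h _ := M_modcat in h)
  (let: And5 _ _ _ _ h := M_modcat in h) (hopf_dual C_finite_tensor)
  (free_act_opmodule (hopf_free T) P) Ul).
split.
- exact: reg_modcat.
- by split; [exact: reg_indecomposable | exact: reg_exact].
- move=> U' a U'nz am ae; apply: (quotient_eqv_iso T_right_exact M_exact M_indec) => //.
  + by case: am => [[]].
  + have [[_ a_c] _ _] := am => X N; rewrite -(fmor1 T); exact: a_c.
  + by case: am.
  + by case: am.
- by split.
exists (comparison adj), (comparison_c _ _ _ (free_act_opmodule (hopf_free T) P) Ul); split.
  by apply: comparison_modfun; apply: comparison_left_exact.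
exact: comparison_equivalence.
Qed.
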